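(* Let $\widetilde{\mathcal L}$ be the twisted $N=2$ superconformal algebra over $\mathbb C$. Then $H^1(\widetilde{\mathcal L},\widetilde{\mathcal L}\otimes\widetilde{\mathcal L})=0$, and every Lie super-bialgebra structure on $\widetilde{\mathcal L}$ is coboundary triangular.
   Context: The twisted $N=2$ superconformal algebra $\widetilde{\mathcal L}$ is the Lie superalgebra over $\mathbb C$ with basis $\{L_n,\,T_r,\,G_p,\,\mathfrak c \mid n\in\mathbb Z,\ r\in\frac12+\mathbb Z,\ p\in\frac12\mathbb Z\}$, where the $L_n,T_r,\mathfrak c$ span the even part $\widetilde{\mathcal L}_{\bar 0}$ and the $G_p$ span the odd part $\widetilde{\mathcal L}_{\bar 1}$. The non-vanishing super brackets of basis elements are (up to super skew-symmetry; $\mathfrak c$ is central) $[L_m,L_n]=(m-n)L_{m+n}+\frac{m^3-m}{12}\delta_{m+n,0}\mathfrak c$; $[L_m,T_r]=-rT_{r+m}$; $[T_r,T_s]=\frac r3\delta_{r+s,0}\mathfrak c$; $[L_m,G_p]=(\frac m2-p)G_{p+m}$; $[T_r,G_p]=G_{p+r}$; $[G_p,G_q]=(-1)^{2p}\big(2L_{p+q}+\frac13(p^2-\frac14)\delta_{p+q,0}\mathfrak c\big)$ if $p+q\in\mathbb Z$; $[G_p,G_q]=(-1)^{2p+1}(p-q)T_{p+q}$ if $p+q\in\frac12+\mathbb Z$. Let $\mathfrak g=\mathfrak g_{\bar0}\oplus\mathfrak g_{\bar1}$ be a Lie superalgebra over $\mathbb C$ with bracket $\varphi(x\otimes y)=[x,y]$;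 $[x]\in\mathbb Z_2$ denotes the parity of a homogeneous $x$, and $\mathbf 1$ the identity map (or the unit of the universal enveloping algebra). The super-twist map of $\mathfrak g\otimes\mathfrak g$ is $\tau(x\otimes y)=(-1)^{[x][y]}y\otimes x$, and the super-cyclic map of $\mathfrak g^{\otimes 3}$ is $\xi=(\mathbf1\otimes\tau)(\tau\otimes\mathbf1)$, i.e. $\xi(x_1\otimes x_2\otimes x_3)=(-1)^{[x_1]([x_2]+[x_3])}x_2\otimes x_3\otimes x_1$. The adjoint diagonal action of $\mathfrak g$ on $\mathfrak g\otimes\mathfrak g$ is $x*\big(\sum_i a_i\otimes b_i\big)=\sum_i\big([x,a_i]\otimes b_i+(-1)^{[x][a_i]}a_i\otimes[x,b_i]\big)$. $H^1(\mathfrak g,V)$ for a $\mathfrak g$-module $V$ is the first cohomology: superderivations $\mathfrak g\to V$ modulo inner ones, where a homogeneous superderivation $d$ of parity $[d]$ satisfies $d([x,y])=(-1)^{[d][x]}x\cdot d(y)-(-1)^{[y]([d]+[x])}y\cdot d(x)$, and the inner ones are spanned by the maps $x\mapsto(-1)^{[v][x]}x\cdot v$ for homogeneous $v\in V$. Here $V=\widetilde{\mathcal L}\otimes\widetilde{\mathcal L}$ carries the adjoint diagonal action. A Lie super-coalgebra is a pair $(\mathfrak g,\Delta)$ with $\mathfrak g=\mathfrak g_{\bar0}\oplus\mathfrak g_{\bar1}$ and $\Delta:\mathfrak g\to\mathfrak g\otimes\mathfrak g$ linear such that $\Delta(\mathfrak g_{\bar i})\subset\sum_{\bar j\in\mathbb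 Z_2}\mathfrak g_{\bar j}\otimes\mathfrak g_{\bar i-\bar j}$, $\mathrm{Im}\,\Delta\subset\mathrm{Im}(\mathbf1\otimes\mathbf1-\tau)$ and $(\mathbf1\otimes\mathbf1\otimes\mathbf1+\xi+\xi^2)(\mathbf1\otimes\Delta)\Delta=0$. A Lie super-bialgebra is a triple $(\mathfrak g,\varphi,\Delta)$ such that $(\mathfrak g,\varphi)$ is a Lie superalgebra, $(\mathfrak g,\Delta)$ is a Lie super-coalgebra, and $\Delta([x,y])=x*\Delta(y)-(-1)^{[x][y]}y*\Delta(x)$ for all homogeneous $x,y$. A Lie super-bialgebra structure on $\mathfrak g$ is such a $\Delta$ (with the given bracket). The structure is coboundary if there is $r\in\mathrm{Im}(\mathbf1\otimes\mathbf1-\tau)\subset\mathfrak g\otimes\mathfrak g$ with $\Delta=\Delta_r$, where $\Delta_r(x)=(-1)^{[r][x]}x*r$. It is (coboundary) triangular if moreover $r=\sum_i a_i\otimes b_i$ satisfies the classical Yang-Baxter equation $c(r)=[r^{12},r^{13}]+[r^{12},r^{23}]+[r^{13},r^{23}]=0$ in $\mathfrak g^{\otimes3}$, where $[r^{12},r^{23}]=\sum_{i,j}a_i\otimes[b_i,a_j]\otimes b_j$, $[r^{12},r^{13}]=\sum_{i,j}(-1)^{[a_j][b_i]}[a_i,a_j]\otimes b_i\otimes b_j$, and $[r^{13},r^{23}]=\sum_{i,j}(-1)^{[a_j][b_i]}a_i\otimes a_j\otimes[b_i,b_j]$. *)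

(* Defs.v *)
From HB Require Import structures.
From mathcomp Require Import all_boot all_order all_algebra.
From mathcomp Require Import finmap.
From mathcomp Require Import monalg.
From mathcomp Require Import reals.
From mathcomp Require Import complex.

Set Implicit Arguments.
Unset Strict Implicit.
Unset Printing Implicit Defensive.

Import GRing.Theory.
Local Open Scope ring_scope.

(* A superspace is presented by a homogeneous basis: a choiceType I together
   with a parity [p : I -> bool] (true = odd); its carrier is the free module
   {malg K[I]}.  The tensor product of {malg K[I]} and {malg K[J]} is
   {malg K[I * J]}, where << (i, j) >> stands for << i >> (x) << j >>. *)

Section LinearExtension.
Variables (K : fieldType) (I : choiceType) (V : lmodType K).

Definition lin_ext (f : I -> V) (x : {malg K[I]}) : V :=
  \sum_(i <- msupp x) x@_i *: f i.

Lemma lin_extEw f x (d : {fset I}) : {subset msupp x <= d} ->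
  lin_ext f x = \sum_(i <- d) x@_i *: f i.
Proof.
move=> xd; rewrite /lin_ext; apply: big_fset_incl; first exact/fsubsetP.
by move=> i _ /mcoeff_outdom ->; rewrite scale0r.
Qed.

Lemma lin_ext_is_linear f : linear (lin_ext f).
Proof.
move=> a x y; pose d := (msupp x `|` msupp y)%fset.
have xd : {subset msupp x <= d} by move=> i; rewrite inE => ->.
have yd : {subset msupp y <= d} by move=> i; rewrite inE orbC => ->.
have axyd : {subset msupp (a *: x + y) <= d}.
  move=> i /(fsubsetP (msuppD_le _ _)); rewrite !inE.
  by case/orP=> [/(fsubsetP (msuppZ_le _ _))|] ->; rewrite ?orbT.
rewrite (lin_extEw f xd) (lin_extEw f yd) (lin_extEw f axyd).
rewrite scaler_sumr -big_split /=; apply: eq_bigr => i _.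
by rewrite mcoeffD mcoeffZ scalerDl scalerA.
Qed.

HB.instance Definition _ f :=
  GRing.isLinear.Build K {malg K[I]} V _ (lin_ext f) (lin_ext_is_linear f).

Lemma lin_extU f i : lin_ext f << i >> = f i.
Proof.
have s : {subset msupp (<< i >> : {malg K[I]}) <= [fset i]%fset}.
  exact/fsubsetP/msuppU_le.
by rewrite (lin_extEw f s) big_seq_fset1 mcoeffUU scale1r.
Qed.

End LinearExtension.

Section Tensor.
Variable K : fieldType.

Definition bilin_ext (I J : choiceType) (V : lmodType K) (f : I -> J -> V)
    (x : {malg K[I]}) (y : {malg K[J]}) : V :=
  lin_ext (fun i => lin_ext (f i) y) x.

Definition tens (I J : choiceType) (x : {malg K[I]}) (y : {malg K[J]}) :
    {malg K[(I * J)%type]} :=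
  bilin_ext (fun i j => << (i, j) >>) x y.

End Tensor.

Notation "x ⊗ y" := (tens x y) (at level 40, left associativity) : ring_scope.

Section Super.
Variables (K : fieldType).

(* The Koszul sign (-1)^{ab}. *)
Definition ksign (a b : bool) : K := (-1) ^+ (a && b).

Definition par2 (I J : choiceType) (p : I -> bool) (q : J -> bool)
    (ij : I * J) : bool := p ij.1 (+) q ij.2.

(* x lies in the homogeneous component of parity e (0 lies in both). *)
Definition homog (I : choiceType) (p : I -> bool) (e : bool)
    (x : {malg K[I]}) : Prop :=
  forall i, i \in msupp x -> p i = e.

Section FirstCohomology.
Variables (I J : choiceType) (p : I -> bool) (q : J -> bool).
Variable phi : {linear {malg K[(I * I)%type]} -> {malg K[I]}}.
Variable act : {malg K[I]} -> {malg K[J]} -> {malg K[J]}.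

Definition homog_superderivation (e : bool)
    (d : {linear {malg K[I]} -> {malg K[J]}}) : Prop :=
  (forall i x, homog p i x -> homog q (i (+) e) (d x)) /\
  (forall i j x y, homog p i x -> homog p j y ->
     d (phi (x ⊗ y)) =
       ksign e i *: act x (d y) - ksign j (e (+) i) *: act y (d x)).

Definition superderivation (d : {linear {malg K[I]} -> {malg K[J]}}) : Prop :=
  exists d0 d1 : {linear {malg K[I]} -> {malg K[J]}},
    [/\ homog_superderivation false d0, homog_superderivation true d1
      & forall x, d x = d0 x + d1 x].

(* The linear map with x |-> (-1)^{e [x]} x . v for homogeneous x, where e is
   the parity of v. *)
Definition inner (e : bool) (v : {malg K[J]}) :
    {malg K[I]} -> {malg K[J]} :=
  lin_ext (fun i => ksign e (p i) *: act << i >> v).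

(* As [inner e] is linear in v, the span of the inner maps given by
   homogeneous vectors consists of the sums of an even and an odd one. *)
Definition inner_superderivation (d : {malg K[I]} -> {malg K[J]}) : Prop :=
  exists v0 v1 : {malg K[J]},
    [/\ homog q false v0, homog q true v1
      & forall x, d x = inner false v0 x + inner true v1 x].

(* H^1 = Der / Inn is the zero space. *)
Definition H1_eq0 : Prop :=
  forall d : {linear {malg K[I]} -> {malg K[J]}},
    superderivation d -> inner_superderivation d.

End FirstCohomology.

Section Bialgebra.
Variables (I : choiceType) (p : I -> bool).

Let g := {malg K[I]}.
Let g2 := {malg K[(I * I)%type]}.
Let g3 := {malg K[(I * (I * I))%type]}.

Definition twist : g2 -> g2 :=
  lin_ext (fun ab => ksign (p ab.1) (p ab.2) *: << (ab.2, ab.1) >>).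

Definition supercyc : g3 -> g3 :=
  lin_ext (fun abc => let: (a, (b, c)) := abc in
    ksign (p a) (p b (+) p c) *: << (b, (c, a)) >>).

(* Im (1 (x) 1 - tau) *)
Definition im_1Btwist (r : g2) : Prop := exists s : g2, r = s - twist s.

Record lie_superalgebra (phi : {linear g2 -> g}) : Prop := LieSuperalgebra {
  lsa_par : forall i j x y, homog p i x -> homog p j y ->
    homog p (i (+) j) (phi (x ⊗ y));
  lsa_skew : forall i j x y, homog p i x -> homog p j y ->
    phi (x ⊗ y) = - (ksign i j *: phi (y ⊗ x));
  lsa_jacobi : forall i j k x y z,
    homog p i x -> homog p j y -> homog p k z ->
    phi (x ⊗ phi (y ⊗ z)) =
      phi (phi (x ⊗ y) ⊗ z) + ksign i j *: phi (y ⊗ phi (x ⊗ z))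
}.

(* 1 (x) Delta; no sign occurs, both maps being even. *)
Definition id_tens (Delta : {linear g -> g2}) : g2 -> g3 :=
  lin_ext (fun ab => << ab.1 >> ⊗ Delta << ab.2 >>).

Record lie_supercoalgebra (Delta : {linear g -> g2}) : Prop :=
  LieSupercoalgebra {
  lsc_par : forall i x, homog p i x -> homog (par2 p p) i (Delta x);
  lsc_skew : forall x, im_1Btwist (Delta x);
  lsc_jacobi : forall x, let u := id_tens Delta (Delta x) in
    u + supercyc u + supercyc (supercyc u) = 0
}.

Section Bracket.
Variable phi : {linear g2 -> g}.

(* The adjoint diagonal action of g on g (x) g. *)
Definition adiag (x : g) (u : g2) : g2 :=
  bilin_ext (fun i ab =>
    phi << (i, ab.1) >> ⊗ << ab.2 >>
    + ksign (p i) (p ab.1) *: (<< ab.1 >> ⊗ phi << (i, ab.2) >>)) x u.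

Record lie_superbialgebra (Delta : {linear g -> g2}) : Prop :=
  LieSuperbialgebra {
  lsb_algebra : lie_superalgebra phi;
  lsb_coalgebra : lie_supercoalgebra Delta;
  lsb_compat : forall i j x y, homog p i x -> homog p j y ->
    Delta (phi (x ⊗ y)) = adiag x (Delta y) - ksign i j *: adiag y (Delta x)
}.

(* The classical Yang-Baxter expression: << ab >> and << ab' >> range over the
   basis tensors a_i (x) b_i and a_j (x) b_j in the two copies of r. *)
Definition r12r13 (r : g2) : g3 :=
  bilin_ext (fun ab ab' => ksign (p ab'.1) (p ab.2) *:
    (phi << (ab.1, ab'.1) >> ⊗ (<< ab.2 >> ⊗ << ab'.2 >>))) r r.

Definition r12r23 (r : g2) : g3 :=
  bilin_ext (fun ab ab' =>
    << ab.1 >> ⊗ (phi << (ab.2, ab'.1) >> ⊗ << ab'.2 >>)) r r.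

Definition r13r23 (r : g2) : g3 :=
  bilin_ext (fun ab ab' => ksign (p ab'.1) (p ab.2) *:
    (<< ab.1 >> ⊗ (<< ab'.1 >> ⊗ phi << (ab.2, ab'.2) >>))) r r.

Definition cybe (r : g2) : g3 := r12r13 r + r12r23 r + r13r23 r.

(* Delta = Delta_r, where Delta_r is [inner p adiag e r] and e = [r]. *)
Definition coboundary_by (Delta : {linear g -> g2}) (e : bool) (r : g2) :
    Prop :=
  [/\ homog (par2 p p) e r, im_1Btwist r
    & forall x, Delta x = inner p adiag e r x].

Definition coboundary_triangular (Delta : {linear g -> g2}) : Prop :=
  exists e r, coboundary_by Delta e r /\ cybe r = 0.

End Bracket.
End Bialgebra.
End Super.

(* Basis of the twisted N=2 superconformal algebra, with integer indices:
     BL n = L_n,   BT k = T_(k + 1/2),   BG a = G_(a / 2),   Bc = c. *)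
Inductive tw_basis := BL of int | BT of int | BG of int | Bc.

Definition tw_code (b : tw_basis) : option (int + int + int) :=
  match b with
  | BL n => Some (inl (inl n)) | BT k => Some (inl (inr k))
  | BG a => Some (inr a) | Bc => None
  end.

Definition tw_decode (s : option (int + int + int)) : tw_basis :=
  match s with
  | Some (inl (inl n)) => BL n | Some (inl (inr k)) => BT k
  | Some (inr a) => BG a | None => Bc
  end.

Lemma tw_codeK : cancel tw_code tw_decode.
Proof. by case. Qed.

HB.instance Definition _ := Equality.copy tw_basis (can_type tw_codeK).
HB.instance Definition _ := Choice.copy tw_basis (can_type tw_codeK).

Definition tw_par (b : tw_basis) : bool := if b is BG _ then true else false.

Section TwistedN2.
Variable K : fieldType.

(* The actual index of BT k, resp. BG a, as a scalar. *)
Let tidx (k : int) : K := k%:~R + 2^-1.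
Let gidx (a : int) : K := a%:~R / 2.
Let delta0 (n : int) : K := (n == 0)%:R.
Let LT (m k : int) : {malg K[tw_basis]} := (- tidx k) *: << BT (k + m) >>.
Let LG (m a : int) : {malg K[tw_basis]} :=
  (m%:~R / 2 - gidx a) *: << BG (a + 2 * m) >>.
Let TG (k a : int) : {malg K[tw_basis]} := << BG (a + (2 * k + 1)) >>.

(* (-1)^{2p} is (-1)^a for G_p = BG a; p + q is an integer iff 2 divides a + b,
   and otherwise T_(p + q) = BT ((a + b - 1) / 2). *)
Definition tw_br (x y : tw_basis) : {malg K[tw_basis]} :=
  match x, y with
  | BL m, BL n => (m - n)%:~R *: << BL (m + n) >>
      + ((m%:~R ^+ 3 - m%:~R) / 12 * delta0 (m + n)) *: << Bc >>
  | BL m, BT k => LT m k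
  | BT k, BL m => - LT m k
  | BT k, BT l => (tidx k / 3 * delta0 (k + l + 1)) *: << Bc >>
  | BL m, BG a => LG m a
  | BG a, BL m => - LG m a
  | BT k, BG a => TG k a
  | BG a, BT k => - TG k a
  | BG a, BG b =>
      if (2 %| a + b)%Z then
        (-1) ^ a *: (2 *: << BL ((a + b) %/ 2)%Z >>
          + (3^-1 * (gidx a ^+ 2 - 4^-1) * delta0 (a + b)) *: << Bc >>)
      else
        ((-1) ^ (a + 1) * (gidx a - gidx b)) *: << BT ((a + b - 1) %/ 2)%Z >>
  | Bc, _ | _, Bc => 0
  end.

Definition tw_phi : {malg K[(tw_basis * tw_basis)%type]} -> {malg K[tw_basis]} :=
  lin_ext (fun xy => tw_br xy.1 xy.2).

HB.instance Definition _ := GRing.Linear.on tw_phi.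

End TwistedN2.
Arguments tw_phi K _ : clear implicits.

(* Main.v *)
From HB Require Import structures.
Require Import Defs.
From mathcomp Require Import all_boot all_order all_algebra.
From mathcomp Require Import finmap.
From mathcomp Require Import monalg reals complex.
From mathcomp Require Import ring lra zify.

(** Superderivations of the algebra with values in its tensor square are shown
    to be inner by comparing coordinates in the basis of tensors of basis
    elements, the odd and the even ones separately.  Write G
    for the span of the G_p, E for the even part, and e_k for L_(k/2) or
    T_(k/2) according to the parity of k, so that [e_k, -] shifts the index a
    of [BG a] = G_(a/2) by k, up to a scalar [kap a k] that vanishes only for
    k = 2a.

    Odd superderivations ([odd_inner]).  On G (x) E + E (x) G the element
    T_(1/2) acts bijectively: it shifts the index of G, up to the nilpotent
    operator that lowers E along L, T, c.  So an inner superderivation can be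
    subtracted to reach d(T_(1/2)) = 0.  Then T_(1/2) . d(x) = d([T_(1/2), x])
    successively gives d(c) = 0, d(T_r) = 0 and d(L_n) = 0, and d(G_(p+r)) is
    T_r . d(G_p).  The component of d(G_p) in E (x) E vanishes because T_(1/2) is
    nilpotent there, and the one in G (x) G because it satisfies a three-term
    recurrence that no nonzero family of finite support satisfies.

    Even superderivations ([even_inner]).  First, the cokernel of T_(1/2) on
    G (x) G is given by alternating sums along the antidiagonals, and the
    relation between L_m and T_r makes those of d(T_r) vanish.  So one may
    assume that d(T_(1/2)), and with it d of the whole even part, has no
    component in G (x) G.  Next, taking the component in G (x) G of
    d([G_p, G_q]) gives a difference equation between the components in
    G (x) E and E (x) G of d(G_p) and d(G_q).  Because supports are finite, it
    says that the coordinates of d(G_p), divided by the structure constants, do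
    not depend on p.  The common values are the coordinates of a primitive.
    The component in G (x) c is then reached from the relations with L_0 and
    T_(1/2) and from [G_(1/2), G_(-1/2)] = -2 L_0, and the one in c (x) G by
    applying the super-twist.  What is left vanishes on the G_p, which
    generate.

    A Lie super-bialgebra structure Delta is an even superderivation, hence
    Delta(x) = x . r with r even, and r may be made skew because the values of
    Delta are.  For such an r the co-Jacobi expression of Delta at an even x is
    x . c(r) ([cojacobi_cybe]), so that c(r) is killed by all the L_m.  An
    L_m with m large moves a given non-central basis element far out without
    killing it, so only multiples of c (x) c (x) c are killed
    ([L_invariants]).  Finally the coordinate of c(r) at c (x) c (x) c is zero,
    since exchanging the two copies of r changes its sign ([cybe_coef]). *)

Set Implicit Arguments.
Unset Strict Implicit.
Unset Printing Implicit Defensive.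

Import Order.TTheory GRing.Theory Num.Theory.
Local Open Scope ring_scope.

(** * Free modules and their tensor products *)

Section FreeModule.
Variable K : fieldType.

Lemma malg_ind_supp (I : choiceType) (P : {malg K[I]} -> Prop) x :
    P 0 -> (forall i, i \in msupp x -> P << i >>) ->
    (forall a u v, P u -> P v -> P (a *: u + v)) ->
  P x.
Proof.
move=> P0 PU PD; rewrite (monalgE x) big_seq.
elim/big_ind: _ => // [u v Pu Pv|i ix]; first by rewrite -[u]scale1r; exact: PD.
have -> : << x@_i *g i >> = x@_i *: << i >> + 0 :> {malg K[I]}.
  by apply/malgP => j; rewrite addr0 mcoeffZ !mcoeffU mulr_natr.
by apply: PD => //; exact: PU.
Qed.

Lemma malg_ind (I : choiceType) (P : {malg K[I]} -> Prop) :
    P 0 -> (forall i, P << i >>) ->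
    (forall a u v, P u -> P v -> P (a *: u + v)) ->
  forall x, P x.
Proof. by move=> P0 PU PD x; apply: malg_ind_supp. Qed.

Lemma linear_eq (I : choiceType) (V : lmodType K)
    (f g : {linear {malg K[I]} -> V}) x :
  (forall i, i \in msupp x -> f << i >> = g << i >>) -> f x = g x.
Proof.
move=> fg; apply: (@malg_ind_supp _ (fun x => f x = g x)) => //.
  by rewrite !linear0.
by move=> a u v fu fv; rewrite !linearP fu fv.
Qed.

Section Coefficients.
Variables (I : choiceType) (i : I).
Implicit Types (x y : {malg K[I]}) (a b c : K).

Lemma coef_add x y a b : x@_i = a -> y@_i = b -> (x + y)@_i = a + b.
Proof. by move=> <- <-; exact: mcoeffD. Qed.
Lemma coef_opp x a : x@_i = a -> (- x)@_i = - a.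
Proof. by move=> <-; exact: mcoeffN. Qed.
Lemma coef_scale c x a : x@_i = a -> (c *: x)@_i = c * a.
Proof. by move=> <-; exact: mcoeffZ. Qed.
Lemma coef_zero : (0 : {malg K[I]})@_i = 0.
Proof. exact: mcoeff0. Qed.
Lemma coefU j : (<< j >> : {malg K[I]})@_i = (j == i)%:R.
Proof. exact: mcoeffU. Qed.
Lemma coef_eq x y a b : x@_i = a -> y@_i = b -> a = b -> x@_i = y@_i.
Proof. by move=> -> ->. Qed.

End Coefficients.

Lemma eq_lin_ext (I : choiceType) (V : lmodType K) (f g : I -> V) x :
  (forall i, i \in msupp x -> f i = g i) -> lin_ext f x = lin_ext g x.
Proof. by move=> fg; apply: linear_eq => i ix /=; rewrite !lin_extU fg. Qed.

Lemma lin_extD (I : choiceType) (V : lmodType K) (f g : I -> V) x :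
  lin_ext (fun i => f i + g i) x = lin_ext f x + lin_ext g x.
Proof.
by rewrite /lin_ext -big_split /=; apply: eq_bigr => i _; rewrite scalerDr.
Qed.

Lemma lin_extB (I : choiceType) (V : lmodType K) (f g : I -> V) x :
  lin_ext (fun i => f i - g i) x = lin_ext f x - lin_ext g x.
Proof.
by rewrite /lin_ext -sumrB /=; apply: eq_bigr => i _; rewrite scalerBr.
Qed.

Lemma lin_extN (I : choiceType) (V : lmodType K) (f : I -> V) x :
  lin_ext (fun i => - f i) x = - lin_ext f x.
Proof.
by rewrite /lin_ext -sumrN /=; apply: eq_bigr => i _; rewrite scalerN.
Qed.

Lemma lin_ext_comp (I : choiceType) (V W : lmodType K) (f : I -> V)
    (h : {linear V -> W}) x :
  h (lin_ext f x) = lin_ext (h \o f) x.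
Proof.
by rewrite /lin_ext linear_sum; apply: eq_bigr => i _; rewrite linearZ.
Qed.

Lemma lin_ext_scale (I : choiceType) (V : lmodType K) (f : I -> V) a x :
  lin_ext (fun i => a *: f i) x = a *: lin_ext f x.
Proof.
by rewrite /lin_ext scaler_sumr; apply: eq_bigr => i _; rewrite !scalerA mulrC.
Qed.

Lemma lin_ext_linf (I : choiceType) (V : lmodType K) (f h : I -> V) a x :
  lin_ext (fun i => a *: f i + h i) x = a *: lin_ext f x + lin_ext h x.
Proof.
rewrite /lin_ext scaler_sumr -big_split /=; apply: eq_bigr => i _.
by rewrite scalerDr !scalerA mulrC.
Qed.

Lemma lin_ext_eq0 (I : choiceType) (V : lmodType K) (f : I -> V) x :
  (forall i, i \in msupp x -> f i = 0) -> lin_ext f x = 0.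
Proof.
by move=> f0; rewrite /lin_ext big_seq big1 // => i /f0 ->; rewrite scaler0.
Qed.

Lemma lin_ext_id (I : choiceType) x :
  lin_ext (fun i : I => << i >> : {malg K[I]}) x = x.
Proof.
apply: (@malg_ind _ (fun x => lin_ext _ x = x)) => [|i|a u v Hu Hv].
- exact: linear0.
- by rewrite lin_extU.
- by rewrite linearP; congr (_ *: _ + _).
Qed.

Lemma mcoeff_tens (I J : choiceType) (x : {malg K[I]}) (y : {malg K[J]}) i j :
  (x ⊗ y)@_(i, j) = x@_i * y@_j.
Proof.
rewrite /tens /bilin_ext.
move: x; apply: malg_ind => [|i'|a u v Hu Hv].
- by rewrite linear0 !mcoeff0 mul0r.
- rewrite lin_extU; move: y; apply: malg_ind => [|j'|a u v Hu Hv].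
  + by rewrite linear0 !mcoeff0 mulr0.
  + rewrite lin_extU !mcoeffU xpair_eqE.
    by case: eqP; case: eqP; rewrite /= ?mulr1n ?mulr0n ?(mulr0, mul0r, mulr1).
  + by rewrite linearP !(mcoeffD, mcoeffZ) Hu Hv; ring.
- by rewrite linearP !(mcoeffD, mcoeffZ) Hu Hv; ring.
Qed.

Lemma tensUU (I J : choiceType) (i : I) (j : J) :
  << i >> ⊗ << j >> = << (i, j) >> :> {malg K[(I * J)%type]}.
Proof. by rewrite /tens /bilin_ext !lin_extU. Qed.

Lemma coef_tens (I J : choiceType) (x : {malg K[I]}) (y : {malg K[J]}) i j a b :
  x@_i = a -> y@_j = b -> (x ⊗ y)@_(i, j) = a * b.
Proof. by move=> <- <-; exact: mcoeff_tens. Qed.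

Section TensLinear.
Variables (I J : choiceType).
Implicit Types (x : {malg K[I]}) (y : {malg K[J]}).

Lemma tensDl x x' y : (x + x') ⊗ y = x ⊗ y + x' ⊗ y.
Proof. by apply/malgP=> -[i j]; rewrite mcoeffD !mcoeff_tens mcoeffD mulrDl. Qed.
Lemma tensDr x y y' : x ⊗ (y + y') = x ⊗ y + x ⊗ y'.
Proof. by apply/malgP=> -[i j]; rewrite mcoeffD !mcoeff_tens mcoeffD mulrDr. Qed.
Lemma tensZl a x y : (a *: x) ⊗ y = a *: (x ⊗ y).
Proof. by apply/malgP=> -[i j]; rewrite mcoeffZ !mcoeff_tens mcoeffZ mulrA. Qed.
Lemma tensZr a x y : x ⊗ (a *: y) = a *: (x ⊗ y).
Proof. by apply/malgP=> -[i j]; rewrite mcoeffZ !mcoeff_tens mcoeffZ mulrCA. Qed.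
Lemma tens0l y : (0 : {malg K[I]}) ⊗ y = 0.
Proof. by rewrite -(scale0r (0 : {malg K[I]})) tensZl scale0r. Qed.
Lemma tens0r x : x ⊗ (0 : {malg K[J]}) = 0.
Proof. by rewrite -(scale0r (0 : {malg K[J]})) tensZr scale0r. Qed.

Lemma tens_linr x : linear (fun y => x ⊗ y).
Proof. by move=> a u v; rewrite tensDr tensZr. Qed.
HB.instance Definition _ x :=
  GRing.isLinear.Build K {malg K[J]} {malg K[(I * J)%type]} _ (tens x)
    (tens_linr x).

End TensLinear.

Section Homogeneous.
Variables (I : choiceType) (p : I -> bool) (e : bool).
Implicit Types (x y : {malg K[I]}).

Lemma homog0 : homog p e (0 : {malg K[I]}).
Proof. by move=> i; rewrite msupp0. Qed.

Lemma homogU i : p i = e -> homog p e (<< i >> : {malg K[I]}).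
Proof. by move=> pi j /(fsubsetP msuppU_le); rewrite inE => /eqP ->. Qed.

Lemma homogP x a y : homog p e x -> homog p e y -> homog p e (a *: x + y).
Proof.
move=> hx hy i /(fsubsetP (msuppD_le _ _)); rewrite inE => /orP[|]; last exact: hy.
by move/(fsubsetP (msuppZ_le _ _)); exact: hx.
Qed.

Lemma homogZ a x : homog p e x -> homog p e (a *: x).
Proof.
move=> hx; rewrite -[a *: x]addr0.
by apply: homogP => //; exact: homog0.
Qed.

Lemma homogD x y : homog p e x -> homog p e y -> homog p e (x + y).
Proof. by move=> hx hy; rewrite -[x]scale1r; exact: homogP. Qed.

Lemma homogN x : homog p e x -> homog p e (- x).
Proof. by move=> hx; rewrite -scaleN1r; exact: homogZ. Qed.

Lemma homog_coef x i : homog p e x -> p i != e -> x@_i = 0.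
Proof.
move=> hx pi; apply: mcoeff_outdom; apply: contra pi => ix.
by rewrite (hx _ ix).
Qed.

End Homogeneous.

Lemma homog_tens (I J : choiceType) (p : I -> bool) (q : J -> bool) e f
    (x : {malg K[I]}) (y : {malg K[J]}) :
  homog p e x -> homog q f y -> homog (par2 p q) (e (+) f) (x ⊗ y).
Proof.
move=> hx hy [i j]; rewrite -mcoeff_neq0 mcoeff_tens mulf_eq0 negb_or.
by rewrite !mcoeff_neq0 => /andP[/hx ei /hy fj]; rewrite /par2 /= ei fj.
Qed.

Lemma ksign_sym a b : ksign K a b = ksign K b a.
Proof. by rewrite /ksign andbC. Qed.

Lemma ksignFl b : ksign K false b = 1. Proof. by []. Qed.
Lemma ksignFr b : ksign K b false = 1. Proof. by rewrite ksign_sym. Qed.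
Lemma ksignTT : ksign K true true = -1. Proof. exact: expr1. Qed.

End FreeModule.

Definition ksE := (ksignFl, ksignFr, ksignTT).

Ltac coef_compute :=
  lazymatch goal with
  | |- mcoeff _ ?t = _ =>
    lazymatch t with
    | @Algebra.add _ _ _ => refine (coef_add _ _); coef_compute
    | @Algebra.opp _ _ => refine (coef_opp _); coef_compute
    | @GRing.scale _ _ _ _ => refine (coef_scale _ _); coef_compute
    | @Algebra.zero _ => refine (coef_zero _ _)
    | @tens _ _ _ _ _ => refine (coef_tens _ _); coef_compute
    | @mkmalgU _ _ _ _ => first [refine (coefU _ _ _) | reflexivity]
    | _ => reflexivity
    end
  end.
Ltac coef_simpl :=
  repeat match goal with
  | |- context [@mcoeff ?I ?G ?k ?t] =>
    lazymatch t with
    | @Algebra.add _ _ _ => idtac | @Algebra.opp _ _ => idtac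
    | @GRing.scale _ _ _ _ => idtac | @Algebra.zero _ => idtac
    | @tens _ _ _ _ _ => idtac | @mkmalgU _ _ _ _ => idtac
    end;
    let E := fresh "E" in
    eassert (E : @mcoeff I G k t = _) by coef_compute;
    pattern (@mcoeff I G k t);
    match goal with |- ?P _ => refine (@eq_ind_r _ _ P _ _ E) end;
    cbv beta; clear E
  end.

(* An identity between combinations of given elements of a free module is a
   polynomial identity in their coordinates. *)
Ltac coef_generalize :=
  cbv beta delta [reverse_coercion];
  repeat match goal with
  | |- context [@mcoeff ?I ?G ?k ?t] => generalize (@mcoeff I G k t); intro
  end.
Ltac split_index k :=
  let T := type of k in
  lazymatch eval hnf in T with
  | prod _ _ => let a := fresh "a" in let b := fresh "b" in
    case: k => a b; split_index a; split_index b
  | _ => idtac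
  end.
Ltac malg_expand :=
  refine (proj1 (malgP _ _) _);
  let k := fresh "k" in intro k; split_index k;
  refine (coef_eq _ _ _); [coef_compute | coef_compute | coef_generalize].
Ltac malg_ring := malg_expand; ring.

(** * The diagonal action of a Lie superalgebra on its tensor square *)

Local Opaque mkmalgU.
Section LieAction.
Variables (K : fieldType) (I : choiceType) (p : I -> bool).
Variable phi : {linear {malg K[(I * I)%type]} -> {malg K[I]}}.
Local Notation g := {malg K[I]}.
Local Notation g2 := {malg K[(I * I)%type]}.
Local Notation ks := (ksign K).

Definition br (x y : g) : g := phi (x ⊗ y).

Lemma br_linr (x : g) a (u v : g) : br x (a *: u + v) = a *: br x u + br x v.
Proof. by rewrite /br tensDr tensZr linearP. Qed.
Lemma br_linl (x : g) a (u v : g) : br (a *: u + v) x = a *: br u x + br v x.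
Proof. by rewrite /br tensDl tensZl linearP. Qed.
Lemma br0r x : br x 0 = 0.
Proof. by rewrite /br tens0r linear0. Qed.
Lemma br0l x : br 0 x = 0.
Proof. by rewrite /br tens0l linear0. Qed.
Lemma brZr (x : g) a (u : g) : br x (a *: u) = a *: br x u.
Proof. by rewrite -[a *: u]addr0 br_linr br0r addr0. Qed.
Lemma brZl (x : g) a (u : g) : br (a *: u) x = a *: br u x.
Proof. by rewrite -[a *: u]addr0 br_linl br0l addr0. Qed.
Lemma brNr (x u : g) : br x (- u) = - br x u.
Proof. by rewrite -scaleN1r brZr scaleN1r. Qed.
Lemma brNl (x u : g) : br (- u) x = - br u x.
Proof. by rewrite -scaleN1r brZl scaleN1r. Qed.
Lemma brDr (x u v : g) : br x (u + v) = br x u + br x v.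
Proof. by rewrite -[u]scale1r br_linr !scale1r. Qed.
Lemma brDl (x u v : g) : br (u + v) x = br u x + br v x.
Proof. by rewrite -[u]scale1r br_linl !scale1r. Qed.

Lemma br_linear x : linear (br x).
Proof. by move=> a u v; exact: br_linr. Qed.
HB.instance Definition _ x := GRing.isLinear.Build K g g _ (br x) (br_linear x).

Lemma brUU i j : br << i >> << j >> = phi << (i, j) >>.
Proof. by rewrite /br tensUU. Qed.

Lemma br_lin_ext y x : br y x = lin_ext (fun k => br << k >> x) y.
Proof.
pattern y; apply: malg_ind => [|i|a u v Hu Hv].
- by rewrite br0l linear0.
- by rewrite lin_extU.
- by rewrite linearP br_linl Hu Hv.
Qed.

(** All the axioms are multilinear, so it suffices to check them on basis
    elements. *)
Lemma lie_superalgebra_basis :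
    (forall i j, homog p (p i (+) p j) (br << i >> << j >>)) ->
    (forall i j, br << i >> << j >> =
       - (ks (p i) (p j) *: br << j >> << i >>)) ->
    (forall i j k, br << i >> (br << j >> << k >>) =
       br (br << i >> << j >>) << k >>
       + ks (p i) (p j) *: br << j >> (br << i >> << k >>)) ->
  lie_superalgebra p phi.
Proof.
move=> Hpar Hskew Hjac; split.
- move=> i j x y hx hy; change (homog p (i (+) j) (br x y)).
  pattern x; apply: malg_ind_supp => [|i' ix|a u v Hu Hv].
  + by rewrite br0l; exact: homog0.
  + pattern y; apply: malg_ind_supp => [|j' jy|a u v Hu Hv].
    * by rewrite br0r; exact: homog0.
    * by rewrite -(hx _ ix) -(hy _ jy).
    * by rewrite br_linr; exact: homogP.
  + by rewrite br_linl; exact: homogP.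
- move=> i j x y hx hy; change (br x y = - (ks i j *: br y x)).
  pattern x; apply: malg_ind_supp => [|i' ix|a u v Hu Hv].
  + by rewrite br0l br0r scaler0 oppr0.
  + pattern y; apply: malg_ind_supp => [|j' jy|a u v Hu Hv].
    * by rewrite br0l br0r scaler0 oppr0.
    * by rewrite -(hx _ ix) -(hy _ jy).
    * by rewrite br_linr br_linl Hu Hv; malg_ring.
  + by rewrite br_linr br_linl Hu Hv; malg_ring.
- move=> i j k x y z hx hy hz.
  change (br x (br y z) = br (br x y) z + ks i j *: br y (br x z)).
  pattern x; apply: malg_ind_supp => [|i' ix|a u v Hu Hv].
  + by rewrite !(br0l, br0r) scaler0 addr0.
  + pattern y; apply: malg_ind_supp => [|j' jy|a u v Hu Hv].
    * by rewrite !(br0l, br0r) scaler0 addr0.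
    * pattern z; apply: malg_ind_supp => [|k' kz|a u v Hu Hv].
      - by rewrite !br0r scaler0 addr0.
      - by rewrite -(hx _ ix) -(hy _ jy).
      - by rewrite 5!br_linr Hu Hv; malg_ring.
    * by rewrite !br_linr !br_linl br_linr Hu Hv; malg_ring.
  + by rewrite !br_linl br_linr Hu Hv; malg_ring.
Qed.

Definition act i : g2 -> g2 := lin_ext (fun ab =>
  phi << (i, ab.1) >> ⊗ << ab.2 >>
  + ks (p i) (p ab.1) *: (<< ab.1 >> ⊗ phi << (i, ab.2) >>)).
HB.instance Definition _ i := GRing.Linear.on (act i).

Lemma act_lin i a (u v : g2) : act i (a *: u + v) = a *: act i u + act i v.
Proof. exact: linearP. Qed.
Lemma act0 i : act i 0 = 0.
Proof. exact: linear0. Qed.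
Lemma actU i a b : act i << (a, b) >> = br << i >> << a >> ⊗ << b >>
  + ks (p i) (p a) *: (<< a >> ⊗ br << i >> << b >>).
Proof. by rewrite !brUU; exact: lin_extU. Qed.
Lemma actD i (u v : g2) : act i (u + v) = act i u + act i v.
Proof. exact: linearD. Qed.
Lemma actB i (u v : g2) : act i (u - v) = act i u - act i v.
Proof. exact: linearB. Qed.
Lemma actZ i a (u : g2) : act i (a *: u) = a *: act i u.
Proof. exact: linearZ. Qed.

Lemma adiagE x u : adiag p phi x u = lin_ext (fun i => act i u) x.
Proof. by []. Qed.

Lemma adiagU i u : adiag p phi << i >> u = act i u.
Proof. by rewrite adiagE lin_extU. Qed.

(** The fibres of an element of g (x) g over a basis vector of one of the
    factors: they reduce coordinates of the diagonal action to coordinates of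
    the adjoint action. *)
Definition sl1 j : g2 -> g :=
  lin_ext (fun ab => (if ab.2 == j then << ab.1 >> else 0) : g).
Definition sl2 i : g2 -> g :=
  lin_ext (fun ab => (if ab.1 == i then << ab.2 >> else 0) : g).

Lemma sl1_lin j a (u v : g2) : sl1 j (a *: u + v) = a *: sl1 j u + sl1 j v.
Proof. exact: linearP. Qed.
Lemma sl2_lin i a (u v : g2) : sl2 i (a *: u + v) = a *: sl2 i u + sl2 i v.
Proof. exact: linearP. Qed.

Lemma sl10 j : sl1 j 0 = 0. Proof. exact: linear0. Qed.
Lemma sl20 i : sl2 i 0 = 0. Proof. exact: linear0. Qed.
Lemma sl1U j a b : sl1 j << (a, b) >> = if b == j then << a >> else 0.
Proof. exact: lin_extU. Qed.
Lemma sl2U i a b : sl2 i << (a, b) >> = if a == i then << b >> else 0.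
Proof. exact: lin_extU. Qed.

Lemma sl1_coef j u i : (sl1 j u)@_i = u@_(i, j).
Proof.
pattern u; apply: malg_ind => [|[a b]|a v w Hv Hw].
- by rewrite /sl1 linear0 !mcoeff0.
- rewrite /sl1 lin_extU !mcoeffU xpair_eqE /= andbC.
  by case: eqP => //= _; rewrite ?mcoeff0 ?mcoeffU.
- by rewrite sl1_lin !(mcoeffD, mcoeffZ) Hv Hw.
Qed.

Lemma sl2_coef i u j : (sl2 i u)@_j = u@_(i, j).
Proof.
pattern u; apply: malg_ind => [|[a b]|a v w Hv Hw].
- by rewrite /sl2 linear0 !mcoeff0.
- rewrite /sl2 lin_extU !mcoeffU xpair_eqE /=.
  by case: eqP => //= _; rewrite ?mcoeff0 ?mcoeffU.
- by rewrite sl2_lin !(mcoeffD, mcoeffZ) Hv Hw.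
Qed.

Local Opaque lin_ext br act sl1 sl2.
Lemma act_coef i u a b : (act i u)@_(a, b) =
  (br << i >> (sl1 b u))@_a + ks (p i) (p a) * (br << i >> (sl2 a u))@_b.
Proof.
pattern u; apply: malg_ind => [|[a' b']|c v w Hv Hw].
- by rewrite act0 sl10 sl20 br0r !mcoeff0 mulr0 addr0.
- rewrite actU sl1U sl2U; coef_simpl.
  case: (b' =P b) => [->|_]; case: (a' =P a) => [->|_];
    rewrite /= ?br0r; coef_simpl; coef_generalize; ring.
- rewrite act_lin sl1_lin sl2_lin 2!br_linr; coef_simpl; rewrite Hv Hw.
  by coef_generalize; ring.
Qed.

Lemma act_tens i q x y : homog p q x ->
  act i (x ⊗ y) = br << i >> x ⊗ y + ks (p i) q *: (x ⊗ br << i >> y).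
Proof.
move=> hx; pattern x; apply: malg_ind_supp => [|a ax|c v w Hv Hw].
- by rewrite br0r !tens0l act0 scaler0 addr0.
- pattern y; apply: malg_ind => [|b|c v w Hv Hw].
  + by rewrite br0r !tens0r act0 scaler0 addr0.
  + by rewrite tensUU actU (hx _ ax).
  + by rewrite br_linr 3!tensDr 3!tensZr act_lin Hv Hw; malg_ring.
- by rewrite br_linr !tensDl !tensZl act_lin Hv Hw; malg_ring.
Qed.

Hypothesis gL : lie_superalgebra p phi.

Lemma homog_br q r x y :
  homog p q x -> homog p r y -> homog p (q (+) r) (br x y).
Proof. exact: (lsa_par gL). Qed.

Lemma homog_brU i j : homog p (p i (+) p j) (br << i >> << j >>).
Proof. by apply: homog_br; exact: homogU. Qed.

Lemma homog_act i q u :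
  homog (par2 p p) q u -> homog (par2 p p) (p i (+) q) (act i u).
Proof.
move=> hu; pattern u; apply: malg_ind_supp => [|[a b] /hu /= <-|c v w Hv Hw].
- by rewrite act0; exact: homog0.
- rewrite actU; apply: homogD.
    rewrite /par2 /= addbA; apply: homog_tens; last exact: homogU.
    exact: homog_brU.
  apply: homogZ; rewrite /par2 /= addbCA; apply: homog_tens.
    exact: homogU.
  exact: homog_brU.
- by rewrite act_lin; exact: homogP.
Qed.

Lemma br_jacobi i j x : br << i >> (br << j >> x) =
  br (br << i >> << j >>) x + ks (p i) (p j) *: br << j >> (br << i >> x).
Proof.
pattern x; apply: malg_ind => [|k|c v w Hv Hw].
- by rewrite !br0r scaler0 addr0.
- apply: (lsa_jacobi gL) (homogU _) (homogU _) (homogU _) => //; exact: erefl.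
- by rewrite 5!br_linr Hv Hw; malg_ring.
Qed.

(** The module axiom: the Jacobi identity in each factor; the mixed terms, with
    i and j acting on different factors, cancel. *)
Lemma act_bracket i j u :
  lin_ext (fun k => act k u) (br << i >> << j >>) =
  act i (act j u) - ks (p i) (p j) *: act j (act i u).
Proof.
pattern u; apply: malg_ind => [|[a b]|c v w Hv Hw].
- rewrite !act0 scaler0 subr0.
  by apply: lin_ext_eq0 => k _; exact: act0.
- have hU c : homog p (p c) << c >> by move=> F; exact: homogU.
  have actU k : act k << (a, b) >> = br << k >> << a >> ⊗ << b >>
      + ks (p k) (p a) *: (<< a >> ⊗ br << k >> << b >>).
    by rewrite -tensUU (act_tens _ _ (hU K a)).
  have -> : lin_ext (fun k => act k << (a, b) >>) (br << i >> << j >>) =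
      br (br << i >> << j >>) << a >> ⊗ << b >>
      + ks (p i (+) p j) (p a) *:
        (<< a >> ⊗ br (br << i >> << j >>) << b >>).
    pattern (br << i >> << j >>); apply: malg_ind_supp => [|k hk|c v w Hv Hw].
    + by rewrite !br0l tens0l tens0r linear0 scaler0 addr0.
    + by rewrite lin_extU actU (homog_brU hk).
    + rewrite linearP /= Hv Hw !br_linl tensDl tensDr tensZl tensZr.
      malg_ring.
  rewrite 2!actU 2!actD 2!actZ 2!(act_tens _ _ (hU K a)).
  rewrite !(act_tens _ _ (homog_br (hU K _) (hU K a))).
  rewrite (br_jacobi i j) (br_jacobi i j << b >>) !tensDl !tensDr !tensZl !tensZr.
  rewrite /ksign; case: (p i); case: (p j); case: (p a);
    rewrite /= ?expr0 ?expr1; malg_ring.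
- rewrite (eq_lin_ext (fun k _ => act_lin k c v w)) lin_ext_linf Hv Hw.
  by rewrite 4!act_lin; malg_ring.
Qed.

Lemma twistU a b : twist p << (a, b) >> = ks (p a) (p b) *: << (b, a) >> :> g2.
Proof. exact: lin_extU. Qed.
Lemma twist_lin a (u v : g2) : twist p (a *: u + v) = a *: twist p u + twist p v.
Proof. exact: linearP. Qed.
Lemma twist0 : twist p (0 : g2) = 0.
Proof. exact: linear0. Qed.
Local Opaque twist.

Lemma twist_coef (u : g2) a b :
  (twist p u)@_(a, b) = ks (p a) (p b) * u@_(b, a).
Proof.
pattern u; apply: malg_ind => [|[a' b']|c v w Hv Hw].
- by rewrite twist0 !mcoeff0 mulr0.
- rewrite twistU; coef_simpl; rewrite !xpair_eqE andbC ksign_sym.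
  case: (b' =P a) => [->|_]; case: (a' =P b) => [->|_] //=;
    by rewrite ?mulr1n ?mulr0n ?mulr0.
- by rewrite twist_lin; coef_simpl; rewrite Hv Hw; coef_generalize; ring.
Qed.

Lemma ksign_sqr a b : ks a b * ks a b = 1.
Proof. by rewrite /ksign; case: (a && b); rewrite ?expr0 ?expr1; ring. Qed.

Lemma twistK (u : g2) : twist p (twist p u) = u.
Proof.
apply/malgP => -[a b].
by rewrite !twist_coef (ksign_sym _ (p b)) mulrA ksign_sqr mul1r.
Qed.

Lemma twistB (u v : g2) : twist p (u - v) = twist p u - twist p v.
Proof. by rewrite -scaleN1r addrC twist_lin scaleN1r addrC. Qed.

Lemma twistZ a (u : g2) : twist p (a *: u) = a *: twist p u.
Proof. by rewrite -[a *: u]addr0 twist_lin twist0 !addr0. Qed.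

Lemma homog_twist q (u : g2) :
  homog (par2 p p) q u -> homog (par2 p p) q (twist p u).
Proof.
move=> hu [a b]; rewrite -mcoeff_neq0 twist_coef mulf_eq0 negb_or mcoeff_neq0.
by case/andP => _ /hu <-; rewrite /par2 /= addbC.
Qed.

Lemma twist_tens q r (x y : g) : homog p q x -> homog p r y ->
  twist p (x ⊗ y) = ks q r *: (y ⊗ x).
Proof.
move=> hx hy; apply/malgP => -[a b].
rewrite twist_coef mcoeffZ !mcoeff_tens.
have [bx|bx] := boolP (b \in msupp x); last first.
  by rewrite (mcoeff_outdom bx) !(mul0r, mulr0).
have [ay|ay] := boolP (a \in msupp y); last first.
  by rewrite (mcoeff_outdom ay) !(mul0r, mulr0).
by rewrite (hx _ bx) (hy _ ay) ksign_sym; congr (_ * _); rewrite mulrC.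
Qed.

Lemma twist_act i (u : g2) : twist p (act i u) = act i (twist p u).
Proof.
pattern u; apply: malg_ind => [|[a b]|c v w Hv Hw].
- by rewrite act0 twist0 act0.
- rewrite actU twistU actZ actU [in LHS]addrC twist_lin.
  have hU c : homog p (p c) << c >> by move=> F; exact: homogU.
  rewrite (twist_tens (hU K a) (@homog_brU i b)).
  rewrite (twist_tens (@homog_brU i a) (hU K b)).
  rewrite /ksign; case: (p i); case: (p a); case: (p b);
    rewrite /= ?expr0 ?expr1; malg_ring.
- by rewrite act_lin twist_lin Hv Hw twist_lin act_lin.
Qed.

End LieAction.

Local Opaque lin_ext br act sl1 sl2 twist mkmalgU tens.

(** * The co-Jacobi expression of a coboundary and the Yang-Baxter expression *)

Ltac subst_by H := match type of H with ?l = _ =>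
  pattern l; refine (@eq_ind_r _ _ _ _ _ H); cbv beta end.

Section QuadraticForms.
Variables (K : fieldType) (I : choiceType) (p : I -> bool).
Local Notation g2 := {malg K[(I * I)%type]}.
Local Notation ks := (ksign K).

Variable r : g2.
Hypothesis hr : homog (par2 p p) false r.
Hypothesis skew_r : twist p r = - r.
Variable V : lmodType K.
Implicit Types (G : I -> I -> I -> I -> V).

(** The value at (r, r) of the bilinear extension of a function on pairs of
    basis tensors a (x) b and a' (x) b'. *)
Definition quad G : V :=
  lin_ext (fun t => lin_ext (fun t' => G t.1 t.2 t'.1 t'.2) r) r.

Lemma support_par a b : (a, b) \in msupp r -> p a = p b.
Proof. by move/hr; rewrite /par2 /=; case: (p a); case: (p b). Qed.

Lemma quad_eq G H :
    (forall a b a' b', p a = p b -> p a' = p b' -> G a b a' b' = H a b a' b') ->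
  quad G = quad H.
Proof.
move=> GH; apply: eq_lin_ext => -[a b] hab; apply: eq_lin_ext => -[a' b'] hab'.
by apply: GH; exact: support_par.
Qed.

Lemma quadD G H :
  quad (fun a b a' b' => G a b a' b' + H a b a' b') = quad G + quad H.
Proof.
rewrite /quad -lin_extD; apply: eq_lin_ext => t _; exact: lin_extD.
Qed.

(** Skew-symmetry of r lets one exchange the legs of either copy of r in a
    quadratic expression, and the two copies can be exchanged with each other.
    These moves are all that is needed to compare the co-Jacobi and the
    Yang-Baxter expressions. *)
Lemma skew_lin_ext (f : I * I -> V) :
  lin_ext f r = lin_ext (fun t => - (ks (p t.1) (p t.2) *: f (t.2, t.1))) r.
Proof.
rewrite lin_extN -[r in LHS]opprK -skew_r linearN; congr (- _).
rewrite -[twist p r]/(lin_ext _ r) (lin_ext_comp _ (lin_ext f)).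
by apply: eq_lin_ext => t _ /=; rewrite linearZ /= lin_extU.
Qed.

Lemma quad_flipl G : quad G =
  quad (fun a b a' b' => - (ks (p a) (p b) *: G b a a' b')).
Proof.
rewrite /quad skew_lin_ext; apply: eq_lin_ext => t _ /=.
by rewrite lin_extN lin_ext_scale.
Qed.

Lemma quad_flipr G : quad G =
  quad (fun a b a' b' => - (ks (p a') (p b') *: G a b b' a')).
Proof. by apply: eq_lin_ext => t _; rewrite skew_lin_ext. Qed.

Local Transparent lin_ext.
Lemma quad_swap G : quad G = quad (fun a b a' b' => G a' b' a b).
Proof.
rewrite /quad /lin_ext.
under eq_bigr do rewrite scaler_sumr.
rewrite exchange_big /=; apply: eq_bigr => t' _.
rewrite scaler_sumr; apply: eq_bigr => t _.
by rewrite !scalerA mulrC.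
Qed.
Local Opaque lin_ext.

End QuadraticForms.

Lemma quad_linear (K : fieldType) (I : choiceType) (r : {malg K[(I * I)%type]})
    (V W : lmodType K) (h : {linear V -> W}) (G : I -> I -> I -> I -> V) :
  h (quad r G) = quad r (fun a b a' b' => h (G a b a' b')).
Proof.
rewrite /quad lin_ext_comp; apply: eq_lin_ext => t _; exact: lin_ext_comp.
Qed.

Section YangBaxter.
Variables (K : fieldType) (I : choiceType) (p : I -> bool).
Variable phi : {linear {malg K[(I * I)%type]} -> {malg K[I]}}.
Hypothesis gL : lie_superalgebra p phi.
Local Notation g := {malg K[I]}.
Local Notation g2 := {malg K[(I * I)%type]}.
Local Notation g3 := {malg K[(I * (I * I))%type]}.
Local Notation ks := (ksign K).
Local Notation B := (br phi).
Local Notation act := (act p phi).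

Lemma br_skew q s (x y : g) : homog p q x -> homog p s y ->
  B x y = - (ks q s *: B y x).
Proof. exact: (lsa_skew gL). Qed.

Lemma homogE a : homog p (p a) (<< a >> : g).
Proof. exact: homogU. Qed.

(** The diagonal action on the triple tensor product.  It has no signs, and is
    meant for even x only. *)
Definition act3 x : g3 -> g3 := lin_ext (fun abc =>
  B << x >> << abc.1 >> ⊗ (<< abc.2.1 >> ⊗ << abc.2.2 >>)
  + << abc.1 >> ⊗ (B << x >> << abc.2.1 >> ⊗ << abc.2.2 >>)
  + << abc.1 >> ⊗ (<< abc.2.1 >> ⊗ B << x >> << abc.2.2 >>)).
HB.instance Definition _ x := GRing.Linear.on (act3 x).

Lemma act3_lin x c (u v : g3) : act3 x (c *: u + v) = c *: act3 x u + act3 x v.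
Proof. exact: linearP. Qed.
Lemma act30 x : act3 x 0 = 0.
Proof. exact: linear0. Qed.
Lemma act3Z x c (u : g3) : act3 x (c *: u) = c *: act3 x u.
Proof. exact: linearZ. Qed.
Lemma act3U x a b c : act3 x << (a, (b, c)) >> =
  B << x >> << a >> ⊗ (<< b >> ⊗ << c >>)
  + << a >> ⊗ (B << x >> << b >> ⊗ << c >>)
  + << a >> ⊗ (<< b >> ⊗ B << x >> << c >>).
Proof. exact: lin_extU. Qed.
Local Opaque act3.

Lemma act3_tens x (u v w : g) : act3 x (u ⊗ (v ⊗ w)) =
  B << x >> u ⊗ (v ⊗ w) + u ⊗ (B << x >> v ⊗ w) + u ⊗ (v ⊗ B << x >> w).
Proof.
pattern u; apply: malg_ind => [|a|c u1 u2 H1 H2].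
- rewrite br0r; refine (etrans (congr1 _ (tens0l _ _)) (etrans (act30 x) _)).
  refine (esym (etrans (congr2 +%R (congr2 +%R (tens0l _ _) (tens0l _ _))
    (tens0l _ _)) _)).
  by rewrite 2!addr0.
- pattern v; apply: malg_ind => [|b|c v1 v2 H1 H2].
  + by rewrite br0r !tens0l !tens0r act30 !addr0.
  + pattern w; apply: malg_ind => [|c|k w1 w2 H1 H2].
    * by rewrite br0r !tens0r act30 !addr0.
    * by rewrite !tensUU act3U !tensUU.
    * rewrite br_linr; transitivity (act3 x (k *: (<< a >> ⊗ (<< b >> ⊗ w1))
        + << a >> ⊗ (<< b >> ⊗ w2))); first by congr (act3 x _); malg_ring.
      rewrite act3_lin; refine (etrans (congr2 (fun s t => k *: s + t) H1 H2) _).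
      by malg_ring.
  + rewrite br_linr; transitivity (act3 x (c *: (<< a >> ⊗ (v1 ⊗ w))
      + << a >> ⊗ (v2 ⊗ w))); first by congr (act3 x _); malg_ring.
    rewrite act3_lin; refine (etrans (congr2 (fun s t => c *: s + t) H1 H2) _).
    by malg_ring.
- rewrite br_linr; transitivity (act3 x (c *: (u1 ⊗ (v ⊗ w)) + u2 ⊗ (v ⊗ w)));
    first by congr (act3 x _); malg_ring.
  rewrite act3_lin; refine (etrans (congr2 (fun s t => c *: s + t) H1 H2) _).
  by malg_ring.
Qed.

Lemma supercyc_lin c (u v : g3) :
  supercyc p (c *: u + v) = c *: supercyc p u + supercyc p v.
Proof. exact: linearP. Qed.
Lemma supercyc0 : supercyc p (0 : g3) = 0.
Proof. exact: linear0. Qed.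
Lemma supercycZ c (u : g3) : supercyc p (c *: u) = c *: supercyc p u.
Proof. by rewrite -[c *: u]addr0 supercyc_lin supercyc0 !addr0. Qed.
Lemma supercycU a b c : supercyc p << (a, (b, c)) >> =
  ks (p a) (p b (+) p c) *: << (b, (c, a)) >> :> g3.
Proof. exact: lin_extU. Qed.

Lemma supercyc_coef (u : g3) a b c : (supercyc p u)@_(a, (b, c)) =
  ks (p c) (p a (+) p b) * u@_(c, (a, b)).
Proof.
pattern u; apply: malg_ind => [|[a' [b' c']]|k v w Hv Hw].
- by rewrite supercyc0 !mcoeff0 mulr0.
- rewrite supercycU; coef_simpl.
  rewrite (_ : ((a', (b', c')) == (c, (a, b))) = ((b', (c', a')) == (a, (b, c)))).
    by case: eqP => [[-> -> ->]|_]; rewrite ?mulr0.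
  by rewrite !xpair_eqE andbC andbA.
- by rewrite supercyc_lin; coef_simpl; rewrite Hv Hw; coef_generalize; ring.
Qed.

Lemma supercyc_tens q1 q2 q3 (u v w : g) :
    homog p q1 u -> homog p q2 v -> homog p q3 w ->
  supercyc p (u ⊗ (v ⊗ w)) = ks q1 (q2 (+) q3) *: (v ⊗ (w ⊗ u)).
Proof.
move=> hu hv hw; apply/malgP => -[b [c a]].
rewrite supercyc_coef; coef_simpl.
have [au|au] := boolP (a \in msupp u); last first.
  by rewrite (mcoeff_outdom au) !(mul0r, mulr0).
have [bv|bv] := boolP (b \in msupp v); last first.
  by rewrite (mcoeff_outdom bv) !(mul0r, mulr0).
have [cw|cw] := boolP (c \in msupp w); last first.
  by rewrite (mcoeff_outdom cw) !(mul0r, mulr0).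
by rewrite (hu _ au) (hv _ bv) (hw _ cw); coef_generalize; ring.
Qed.

Variable r : g2.
Hypothesis hr : homog (par2 p p) false r.
Hypothesis skew_r : twist p r = - r.
Local Notation quad := (quad r).

Local Notation e i := (<< i >> : g).
Local Notation c1 := (fun a b a' b' =>
  ks (p a') (p b) *: (B (e a) (e a') ⊗ (e b ⊗ e b'))).
Local Notation c2 := (fun a b a' b' => e a ⊗ (B (e b) (e a') ⊗ e b')).
Local Notation c3 := (fun a b a' b' =>
  ks (p a') (p b) *: (e a ⊗ (e a' ⊗ B (e b) (e b')))).

Lemma cybe_quad : cybe p phi r = quad c1 + quad c2 + quad c3.
Proof.
rewrite /cybe /r12r13 /r12r23 /r13r23 /bilin_ext /quad.
refine (congr2 +%R (congr2 +%R _ _) _);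
  apply: eq_lin_ext => t _; apply: eq_lin_ext => t' _; by rewrite brUU.
Qed.

(** The cyclic map on a quadratic expression: the sign only depends on the
    parities of the three factors. *)
Lemma supercyc_quad (s : I -> I -> I -> I -> K)
    (q1 q2 q3 : I -> I -> I -> I -> bool)
    (X Y Z : I -> I -> I -> I -> g) :
    (forall a b a' b', homog p (q1 a b a' b') (X a b a' b')) ->
    (forall a b a' b', homog p (q2 a b a' b') (Y a b a' b')) ->
    (forall a b a' b', homog p (q3 a b a' b') (Z a b a' b')) ->
  supercyc p (quad (fun a b a' b' =>
    s a b a' b' *: (X a b a' b' ⊗ (Y a b a' b' ⊗ Z a b a' b')))) =
  quad (fun a b a' b' =>
    (s a b a' b' * ks (q1 a b a' b') (q2 a b a' b' (+) q3 a b a' b'))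
      *: (Y a b a' b' ⊗ (Z a b a' b' ⊗ X a b a' b'))).
Proof.
move=> hX hY hZ; refine (etrans (quad_linear r (lin_ext _) _) _).
apply: (quad_eq hr) => a b a' b' _ _.
refine (etrans (supercycZ _ _) _).
refine (etrans (congr1 _ (supercyc_tens (hX _ _ _ _) (hY _ _ _ _) (hZ _ _ _ _))) _).
exact: scalerA.
Qed.

Lemma skewU a b : B (e a) (e b) = - (ks (p a) (p b) *: B (e b) (e a)).
Proof. exact: (br_skew (@homogE a) (@homogE b)). Qed.
Lemma quadN (G : I -> I -> I -> I -> K^o) :
  quad (fun a b a' b' => - G a b a' b') = - quad G.
Proof. by rewrite /quad -lin_extN; apply: eq_lin_ext => t _; exact: lin_extN. Qed.

Lemma quad_antisym (G : I -> I -> I -> I -> K^o) : 2 != 0 :> K ->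
  quad G = - quad G -> quad G = 0.
Proof.
move=> two /eqP; rewrite -addr_eq0 -mulr2n -mulr_natl mulf_eq0 (negbTE two).
by move/eqP.
Qed.

(** The coordinate map has to be linear over K, not merely additive, hence the
    regular module K^o. *)
Definition coord3 z (u : g3) : K^o := u@_z.
Lemma coord3_linear z : linear (coord3 z).
Proof. by move=> a u v; rewrite /coord3 mcoeffD mcoeffZ. Qed.
HB.instance Definition _ z :=
  GRing.isLinear.Build K g3 K^o _ (coord3 z) (coord3_linear z).

Lemma quad_coef (G : I -> I -> I -> I -> g3) z :
  (quad G)@_z = quad (fun a b a' b' => (G a b a' b')@_z : K^o).
Proof. exact: (quad_linear r (coord3 z)). Qed.

(** Exchanging the two copies of r, and their legs as needed, turns each of the
    three coordinates at z (x) z (x) z into its opposite, because the bracket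
    is skew-symmetric; the legs equal to z are even, so no other sign appears. *)
Lemma cybe_coef z : 2 != 0 :> K -> p z = false ->
  (cybe p phi r)@_(z, (z, z)) = 0.
Proof.
move=> two pz; rewrite cybe_quad.
refine (etrans (coef_add (coef_add (quad_coef _ _) (quad_coef _ _))
  (quad_coef _ _)) _).
have q1 : quad (fun a b a' b' => (c1 a b a' b')@_(z, (z, z)) : K^o) = 0.
  apply: quad_antisym => //; refine (etrans _ (quadN _)).
  refine (etrans (quad_swap r _) _); apply: (quad_eq hr) => a b a' b' pb pb'.
  subst_by (skewU a' a); coef_simpl; rewrite pb pb'.
  case: (b =P z) => [->|_]; case: (b' =P z) => [->|_];
    rewrite ?pz /ksign /= ?expr0; coef_generalize; ring.
have q2 : quad (fun a b a' b' => (c2 a b a' b')@_(z, (z, z)) : K^o) = 0.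
  apply: quad_antisym => //; refine (etrans _ (quadN _)).
  refine (etrans (quad_swap r _) _); refine (etrans (quad_flipl skew_r _) _).
  refine (etrans (quad_flipr skew_r _) _).
  apply: (quad_eq hr) => a b a' b' pb pb'.
  subst_by (skewU a' b); coef_simpl; rewrite -pb pb'.
  case: (a =P z) => [->|_]; case: (b' =P z) => [->|_];
    rewrite ?pz /ksign /GRing.scale /= ?andbF ?expr0; coef_generalize; ring.
have q3 : quad (fun a b a' b' => (c3 a b a' b')@_(z, (z, z)) : K^o) = 0.
  apply: quad_antisym => //; refine (etrans _ (quadN _)).
  refine (etrans (quad_swap r _) _); apply: (quad_eq hr) => a b a' b' pb pb'.
  subst_by (skewU b' b); coef_simpl; rewrite -pb -pb'.
  case: (a =P z) => [->|_]; case: (a' =P z) => [->|_];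
    rewrite ?pz /ksign /= ?andbF ?expr0; coef_generalize; ring.
by refine (etrans (congr2 +%R (congr2 +%R q1 q2) q3) _); rewrite !addr0.
Qed.

Variable x : I.
Hypothesis px : p x = false.

Lemma homog_Bx q (y : g) : homog p q y -> homog p q (B (e x) y).
Proof.
move=> hy; have -> : q = p x (+) q by rewrite px.
by apply: (homog_br gL) => //; exact: homogE.
Qed.

Section Cobracket.
Variable Delta : {linear g -> g2}.
Hypothesis DeltaE : forall k, Delta << k >> = act k r.

Lemma Delta_homog q (z : g) : homog p q z ->
  Delta z = lin_ext (fun t => B z (e t.1) ⊗ e t.2
    + ks q (p t.1) *: (e t.1 ⊗ B z (e t.2))) r.
Proof.
move=> hz; pattern z; apply: malg_ind_supp => [|k kz|c v w Hv Hw].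
- rewrite linear0; apply/esym/lin_ext_eq0 => t _.
  by rewrite !br0l tens0l tens0r scaler0 addr0.
- rewrite DeltaE -[r in LHS]lin_ext_id.
  rewrite (lin_ext_comp _ (act k)); apply: eq_lin_ext => -[a b] _ /=.
  by rewrite actU (hz _ kz).
- rewrite linearP.
  refine (etrans (congr2 (fun s t => c *: s + t) Hv Hw) _).
  rewrite -lin_ext_linf; apply: eq_lin_ext => t _.
  by rewrite 2!br_linl; malg_ring.
Qed.

Lemma id_tens_lin_ext (J : choiceType) (f : J -> g2) u :
  id_tens Delta (lin_ext f u) = lin_ext (fun t => id_tens Delta (f t)) u.
Proof. exact: (lin_ext_comp f (lin_ext _)). Qed.

Lemma id_tensD (u v : g2) :
  id_tens Delta (u + v) = id_tens Delta u + id_tens Delta v.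
Proof. exact: (linearD (lin_ext _)). Qed.

Lemma id_tens_lin c (u v : g2) :
  id_tens Delta (c *: u + v) = c *: id_tens Delta u + id_tens Delta v.
Proof. exact: (linearP (lin_ext _)). Qed.

Lemma tens_lin_ext (J : choiceType) (f : J -> g2) (y : g) u :
  y ⊗ lin_ext f u = lin_ext (fun t => y ⊗ f t) u.
Proof. exact: (lin_ext_comp f (tens y)). Qed.

Lemma id_tens_tens (y z : g) : id_tens Delta (y ⊗ z) = y ⊗ Delta z.
Proof.
pattern y; apply: malg_ind => [|a|c y1 y2 H1 H2].
- by rewrite !tens0l /id_tens linear0.
- pattern z; apply: malg_ind => [|b|c z1 z2 H1 H2].
  + by rewrite tens0r linear0 tens0r /id_tens linear0.
  + by rewrite tensUU /id_tens lin_extU.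
  + rewrite tensDr tensZr id_tens_lin.
    refine (etrans (congr2 (fun s t => c *: s + t) H1 H2) _).
    by rewrite linearP; malg_ring.
- rewrite tensDl tensZl id_tens_lin.
  refine (etrans (congr2 (fun s t => c *: s + t) H1 H2) _).
  by malg_ring.
Qed.

(* The factor 1 in u1 and u3 gives the four sums the common shape
   s *: (_ (x) (_ (x) _)). *)
Local Notation u1 := (fun a b a' b' =>
  1 *: (B (e x) (e a) ⊗ (B (e b) (e a') ⊗ e b'))).
Local Notation u2 := (fun a b a' b' => ks (p b) (p a') *:
  (B (e x) (e a) ⊗ (e a' ⊗ B (e b) (e b')))).
Local Notation u3 := (fun a b a' b' =>
  1 *: (e a ⊗ (B (B (e x) (e b)) (e a') ⊗ e b'))).
Local Notation u4 := (fun a b a' b' => ks (p b) (p a') *: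
  (e a ⊗ (e a' ⊗ B (B (e x) (e b)) (e b')))).

(** Delta applied to x . r and then to the second leg: x acts on the first leg
    (u1, u2) or on the second one, inside the outer action (u3, u4). *)
Lemma id_tens_Delta :
  id_tens Delta (Delta (e x)) = quad u1 + quad u2 + (quad u3 + quad u4).
Proof.
transitivity (quad (fun a b a' b' =>
  (u1 a b a' b' + u2 a b a' b') + (u3 a b a' b' + u4 a b a' b'))); last first.
  refine (etrans (quadD _ _ _) (congr2 +%R (quadD _ _ _) (quadD _ _ _))).
refine (etrans (congr1 _ (Delta_homog (@homogE x))) _).
refine (etrans (id_tens_lin_ext _ _) _).
apply: eq_lin_ext => -[a b] _.
refine (etrans (id_tensD _ _) _); rewrite /= px ksE scale1r.
refine (etrans (congr2 +%R (id_tens_tens _ _) (id_tens_tens _ _)) _).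
refine (etrans (congr2 (fun s t => _ ⊗ s + _ ⊗ t)
  (Delta_homog (@homogE b)) (Delta_homog (homog_Bx (@homogE b)))) _).
refine (etrans (congr2 +%R (tens_lin_ext _ _ _) (tens_lin_ext _ _ _)) _).
refine (etrans (esym (lin_extD _ _ _)) _).
apply: eq_lin_ext => -[a' b'] _ /=.
by malg_ring.
Qed.

Let h1 (a : I) : homog p (p a) (e a) := @homogE a.
Let hx a : homog p (p a) (B (e x) (e a)) := homog_Bx (@homogE a).
Let h2 a b : homog p (p a (+) p b) (B (e a) (e b)) :=
  homog_br gL (@homogE a) (@homogE b).
Let hx2 a b : homog p (p a (+) p b) (B (B (e x) (e a)) (e b)) :=
  homog_br gL (@hx a) (@homogE b).

Lemma supercyc_u1 : supercyc p (quad u1) = quad (fun a b a' b' =>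
  (1 * ks (p a) ((p b (+) p a') (+) (p b'))) *:
    (B (e b) (e a') ⊗ (e b' ⊗ B (e x) (e a)))).
Proof.
exact: (supercyc_quad (fun a b a' b' => 1)
  (fun a b a' b' => @hx a) (fun a b a' b' => @h2 b a') (fun a b a' b' => @h1 b')).
Qed.

Lemma supercyc2_u1 : supercyc p (supercyc p (quad u1)) =
  quad (fun a b a' b' =>
    ((1 * ks (p a) ((p b (+) p a') (+) (p b')))
      * ks (p b (+) p a') ((p b') (+) (p a))) *:
    (e b' ⊗ (B (e x) (e a) ⊗ B (e b) (e a')))).
Proof.
rewrite supercyc_u1.
exact: (supercyc_quad (fun a b a' b' => 1 * ks (p a) ((p b (+) p a') (+) (p b')))
  (fun a b a' b' => @h2 b a') (fun a b a' b' => @h1 b') (fun a b a' b' => @hx a)).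
Qed.

Lemma supercyc_u2 : supercyc p (quad u2) = quad (fun a b a' b' =>
  (ks (p b) (p a') * ks (p a) ((p a') (+) (p b (+) p b'))) *:
    (e a' ⊗ (B (e b) (e b') ⊗ B (e x) (e a)))).
Proof.
exact: (supercyc_quad (fun a b a' b' => ks (p b) (p a'))
  (fun a b a' b' => @hx a) (fun a b a' b' => @h1 a') (fun a b a' b' => @h2 b b')).
Qed.

Lemma supercyc2_u2 : supercyc p (supercyc p (quad u2)) =
  quad (fun a b a' b' =>
    ((ks (p b) (p a') * ks (p a) ((p a') (+) (p b (+) p b')))
      * ks (p a') ((p b (+) p b') (+) (p a))) *:
    (B (e b) (e b') ⊗ (B (e x) (e a) ⊗ e a'))).
Proof.
rewrite supercyc_u2.
exact: (supercyc_quad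
  (fun a b a' b' => ks (p b) (p a') * ks (p a) ((p a') (+) (p b (+) p b')))
  (fun a b a' b' => @h1 a') (fun a b a' b' => @h2 b b') (fun a b a' b' => @hx a)).
Qed.

Lemma supercyc_u3 : supercyc p (quad u3) = quad (fun a b a' b' =>
  (1 * ks (p a) ((p b (+) p a') (+) (p b'))) *:
    (B (B (e x) (e b)) (e a') ⊗ (e b' ⊗ e a))).
Proof.
exact: (supercyc_quad (fun a b a' b' => 1)
  (fun a b a' b' => @h1 a) (fun a b a' b' => @hx2 b a') (fun a b a' b' => @h1 b')).
Qed.

Lemma supercyc2_u3 : supercyc p (supercyc p (quad u3)) =
  quad (fun a b a' b' =>
    ((1 * ks (p a) ((p b (+) p a') (+) (p b')))
      * ks (p b (+) p a') ((p b') (+) (p a))) *: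
    (e b' ⊗ (e a ⊗ B (B (e x) (e b)) (e a')))).
Proof.
rewrite supercyc_u3.
exact: (supercyc_quad (fun a b a' b' => 1 * ks (p a) ((p b (+) p a') (+) (p b')))
  (fun a b a' b' => @hx2 b a') (fun a b a' b' => @h1 b') (fun a b a' b' => @h1 a)).
Qed.

Lemma supercyc_u4 : supercyc p (quad u4) = quad (fun a b a' b' =>
  (ks (p b) (p a') * ks (p a) ((p a') (+) (p b (+) p b'))) *:
    (e a' ⊗ (B (B (e x) (e b)) (e b') ⊗ e a))).
Proof.
exact: (supercyc_quad (fun a b a' b' => ks (p b) (p a'))
  (fun a b a' b' => @h1 a) (fun a b a' b' => @h1 a') (fun a b a' b' => @hx2 b b')).
Qed.

Lemma supercyc2_u4 : supercyc p (supercyc p (quad u4)) =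
  quad (fun a b a' b' =>
    ((ks (p b) (p a') * ks (p a) ((p a') (+) (p b (+) p b')))
      * ks (p a') ((p b (+) p b') (+) (p a))) *:
    (B (B (e x) (e b)) (e b') ⊗ (e a ⊗ e a'))).
Proof.
rewrite supercyc_u4.
exact: (supercyc_quad
  (fun a b a' b' => ks (p b) (p a') * ks (p a) ((p a') (+) (p b (+) p b')))
  (fun a b a' b' => @h1 a') (fun a b a' b' => @hx2 b b') (fun a b a' b' => @h1 a)).
Qed.

Lemma skewxU a b : B (B (e x) (e a)) (e b) =
  - (ks (p a) (p b) *: B (e b) (B (e x) (e a))).
Proof. exact: (br_skew (@hx a) (@h1 b)). Qed.
Lemma jacobiU a b : B (e x) (B (e a) (e b)) =
  B (B (e x) (e a)) (e b) + B (e a) (B (e x) (e b)).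
Proof. by rewrite (br_jacobi gL x a) px ksE scale1r. Qed.

Ltac signs := rewrite /ksign; case: (p _); case: (p _);
  rewrite /= ?expr0 ?expr1; malg_ring.

(** In slotij the action of x on the j-th factor of the i-th summand of c(r) is
    found among the rotations of u1, ..., u4.  For i = j two of them are needed,
    and are joined by the Jacobi identity. *)
Lemma slot21 : quad u1 = quad (fun a b a' b' =>
  B (e x) (e a) ⊗ (B (e b) (e a') ⊗ e b')).
Proof. by apply: (quad_eq hr) => a b a' b' _ _; exact: scale1r. Qed.

Lemma slot31 : quad u2 = quad (fun a b a' b' =>
  ks (p a') (p b) *: (B (e x) (e a) ⊗ (e a' ⊗ B (e b) (e b')))).
Proof. by apply: (quad_eq hr) => a b a' b' _ _; rewrite ksign_sym. Qed.

Lemma slot13 : supercyc p (quad u1) = quad (fun a b a' b' =>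
  ks (p a') (p b) *: (B (e a) (e a') ⊗ (e b ⊗ B (e x) (e b')))).
Proof.
refine (etrans supercyc_u1 _); refine (etrans (quad_swap r _) _).
refine (etrans (quad_flipr skew_r _) _).
apply: (quad_eq hr) => a b a' b' pb pb'; rewrite -pb -pb'.
subst_by (skewU a' a); signs.
Qed.

Lemma slot32 : supercyc p (supercyc p (quad u1)) = quad (fun a b a' b' =>
  ks (p a') (p b) *: (e a ⊗ (B (e x) (e a') ⊗ B (e b) (e b')))).
Proof.
refine (etrans supercyc2_u1 _); refine (etrans (quad_swap r _) _).
refine (etrans (quad_flipl skew_r _) _).
apply: (quad_eq hr) => a b a' b' pb pb'.
subst_by (skewU b' b); rewrite -pb -pb'; signs.
Qed.

Lemma slot23 : supercyc p (quad u2) = quad (fun a b a' b' =>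
  e a ⊗ (B (e b) (e a') ⊗ B (e x) (e b'))).
Proof.
refine (etrans supercyc_u2 _); refine (etrans (quad_swap r _) _).
refine (etrans (quad_flipr skew_r _) _).
apply: (quad_eq hr) => a b a' b' pb pb'.
subst_by (skewU a' b); rewrite -pb -pb'; signs.
Qed.

Lemma slot12 : supercyc p (supercyc p (quad u2)) = quad (fun a b a' b' =>
  ks (p a') (p b) *: (B (e a) (e a') ⊗ (B (e x) (e b) ⊗ e b'))).
Proof.
refine (etrans supercyc2_u2 _); refine (etrans (quad_flipl skew_r _) _).
refine (etrans (quad_flipr skew_r _) _).
apply: (quad_eq hr) => a b a' b' pb pb'; rewrite -pb -pb'; signs.
Qed.

Lemma slot22 : quad u3 + supercyc p (quad u4) = quad (fun a b a' b' =>
  e a ⊗ (B (e x) (B (e b) (e a')) ⊗ e b')).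
Proof.
refine (etrans (congr1 _ (etrans supercyc_u4 (etrans (quad_swap r _)
  (quad_flipr skew_r _)))) _).
refine (etrans (esym (quadD _ _ _)) _).
apply: (quad_eq hr) => a b a' b' pb pb'.
subst_by (skewxU a' b); subst_by (jacobiU b a'); rewrite -pb -pb'; signs.
Qed.

Lemma slot11 : supercyc p (quad u3) + supercyc p (supercyc p (quad u4)) =
  quad (fun a b a' b' =>
  ks (p a') (p b) *: (B (e x) (B (e a) (e a')) ⊗ (e b ⊗ e b'))).
Proof.
refine (etrans (congr2 +%R (etrans supercyc_u3 (etrans (quad_flipl skew_r _)
    (quad_swap r _)))
  (etrans supercyc2_u4 (etrans (quad_flipl skew_r _)
    (quad_flipr skew_r _)))) _).
refine (etrans (esym (quadD _ _ _)) _).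
apply: (quad_eq hr) => a b a' b' pb pb'.
subst_by (skewxU a' a); subst_by (jacobiU a a'); rewrite -pb -pb'; signs.
Qed.

Lemma slot33 : supercyc p (supercyc p (quad u3)) + quad u4 =
  quad (fun a b a' b' =>
  ks (p a') (p b) *: (e a ⊗ (e a' ⊗ B (e x) (B (e b) (e b'))))).
Proof.
refine (etrans (congr1 (fun t => t + _) (etrans supercyc2_u3
  (etrans (quad_swap r _) (quad_flipl skew_r _)))) _).
refine (etrans (esym (quadD _ _ _)) _).
apply: (quad_eq hr) => a b a' b' pb pb'.
subst_by (skewxU b' b); subst_by (jacobiU b b'); rewrite -pb -pb'; signs.
Qed.

Lemma supercycD (u v : g3) : supercyc p (u + v) = supercyc p u + supercyc p v.
Proof. exact: (linearD (lin_ext _)). Qed.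

Lemma act3_quad G : act3 x (quad G) = quad (fun a b a' b' => act3 x (G a b a' b')).
Proof. exact: quad_linear. Qed.

Lemma quadD3 (F G H : I -> I -> I -> I -> g3) :
  quad (fun a b a' b' => F a b a' b' + G a b a' b' + H a b a' b') =
  quad F + quad G + quad H.
Proof. exact: (etrans (quadD _ _ _) (congr1 (fun t => t + _) (quadD _ _ _))). Qed.

Lemma act3_c1 : act3 x (quad c1) =
  quad (fun a b a' b' =>
    ks (p a') (p b) *: (B (e x) (B (e a) (e a')) ⊗ (e b ⊗ e b')))
  + quad (fun a b a' b' =>
    ks (p a') (p b) *: (B (e a) (e a') ⊗ (B (e x) (e b) ⊗ e b')))
  + quad (fun a b a' b' =>
    ks (p a') (p b) *: (B (e a) (e a') ⊗ (e b ⊗ B (e x) (e b')))).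
Proof.
refine (etrans (act3_quad _) (etrans _ (quadD3 _ _ _))).
apply: (quad_eq hr) => a b a' b' _ _.
refine (etrans (act3Z _ _ _) _); refine (etrans (congr1 _ (act3_tens _ _ _ _)) _).
by malg_ring.
Qed.

Lemma act3_c2 : act3 x (quad c2) =
  quad (fun a b a' b' => B (e x) (e a) ⊗ (B (e b) (e a') ⊗ e b'))
  + quad (fun a b a' b' => e a ⊗ (B (e x) (B (e b) (e a')) ⊗ e b'))
  + quad (fun a b a' b' => e a ⊗ (B (e b) (e a') ⊗ B (e x) (e b'))).
Proof.
refine (etrans (act3_quad _) (etrans _ (quadD3 _ _ _))).
apply: (quad_eq hr) => a b a' b' _ _; exact: act3_tens.
Qed.

Lemma act3_c3 : act3 x (quad c3) =
  quad (fun a b a' b' =>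
    ks (p a') (p b) *: (B (e x) (e a) ⊗ (e a' ⊗ B (e b) (e b'))))
  + quad (fun a b a' b' =>
    ks (p a') (p b) *: (e a ⊗ (B (e x) (e a') ⊗ B (e b) (e b'))))
  + quad (fun a b a' b' =>
    ks (p a') (p b) *: (e a ⊗ (e a' ⊗ B (e x) (B (e b) (e b'))))).
Proof.
refine (etrans (act3_quad _) (etrans _ (quadD3 _ _ _))).
apply: (quad_eq hr) => a b a' b' _ _.
refine (etrans (act3Z _ _ _) _); refine (etrans (congr1 _ (act3_tens _ _ _ _)) _).
by malg_ring.
Qed.

Lemma regroup (v1 v2 v3 v4 w1 w2 w3 w4 z1 z2 z3 z4 : g3) :
  v1 + v2 + (v3 + v4) + (w1 + w2 + (w3 + w4)) + (z1 + z2 + (z3 + z4)) =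
  (w3 + z4 + z2 + w1) + (v1 + (v3 + w4) + w2) + (v2 + z1 + (z3 + v4)).
Proof. by malg_ring. Qed.

Lemma cojacobi_cybe : let u := id_tens Delta (Delta (e x)) in
  u + supercyc p u + supercyc p (supercyc p u) = act3 x (cybe p phi r).
Proof.
rewrite /= cybe_quad id_tens_Delta.
transitivity (act3 x (quad c1) + act3 x (quad c2) + act3 x (quad c3)); last first.
  refine (esym (etrans (linearD _ _ _) (congr1 (fun t => t + _) (linearD _ _ _)))).
refine (etrans _ (esym (congr2 +%R (congr2 +%R act3_c1 act3_c2) act3_c3))).
refine (etrans _ (congr2 +%R (congr2 +%R
  (congr2 +%R (congr2 +%R slot11 slot12) slot13)
  (congr2 +%R (congr2 +%R slot21 slot22) slot23))
  (congr2 +%R (congr2 +%R slot31 slot32) slot33))).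
have D : forall u v w t : g3,
    supercyc p (u + v + (w + t)) = supercyc p u + supercyc p v
      + (supercyc p w + supercyc p t).
  move=> u v w t.
  exact: (etrans (supercycD _ _) (congr2 +%R (supercycD _ _) (supercycD _ _))).
refine (etrans (congr2 (fun s t => _ + s + t) (D _ _ _ _)
  (etrans (congr1 _ (D _ _ _ _)) (D _ _ _ _))) _).
exact: regroup.
Qed.

End Cobracket.

End YangBaxter.

(** * The twisted N=2 superconformal algebra is a Lie superalgebra *)

Local Opaque bilin_ext act3.

Section Brackets.
Variable K : numFieldType.
(* K as a field, by a fixed path of structures: the different paths give
   convertible but not syntactically equal terms. *)
Local Notation F := (Num.NumField.Exports.Num_NumField__to__GRing_Field K).
Local Notation g := {malg F[tw_basis]}.
Local Notation B := (br (tw_phi F)).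
Local Notation ks := (ksign F).

Lemma brE x y : B << x >> << y >> = tw_br F x y.
Proof. by rewrite brUU; exact: lin_extU. Qed.

Lemma br_LL m n : B << BL m >> << BL n >> = (m - n)%:~R *: << BL (m + n) >>
  + ((m%:~R ^+ 3 - m%:~R) / 12 * (m + n == 0)%:R) *: << Bc >>.
Proof. exact: brE. Qed.
Lemma br_LT m k : B << BL m >> << BT k >> = - (k%:~R + 2^-1) *: << BT (k + m) >>.
Proof. exact: brE. Qed.
Lemma br_TL m k : B << BT k >> << BL m >> = (k%:~R + 2^-1) *: << BT (k + m) >>.
Proof. by rewrite brE /= scaleNr opprK. Qed.
Lemma br_TT k l : B << BT k >> << BT l >> =
  ((k%:~R + 2^-1) / 3 * (k + l + 1 == 0)%:R) *: << Bc >>.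
Proof. exact: brE. Qed.
Lemma br_LG m a : B << BL m >> << BG a >> =
  (m%:~R / 2 - a%:~R / 2) *: << BG (a + 2 * m) >>.
Proof. exact: brE. Qed.
Lemma br_GL m a : B << BG a >> << BL m >> =
  - (m%:~R / 2 - a%:~R / 2) *: << BG (a + 2 * m) >>.
Proof. by rewrite brE /= scaleNr. Qed.
Lemma br_TG k a : B << BT k >> << BG a >> = << BG (a + (2 * k + 1)) >>.
Proof. exact: brE. Qed.
Lemma br_GT k a : B << BG a >> << BT k >> = - << BG (a + (2 * k + 1)) >>.
Proof. exact: brE. Qed.
Lemma br_GG_even a b n : a + b = 2 * n -> B << BG a >> << BG b >> =
  (-1) ^ a *: (2 *: << BL n >>
    + (3^-1 * ((a%:~R / 2) ^+ 2 - 4^-1) * (a + b == 0)%:R) *: << Bc >>).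
Proof.
move=> abn; rewrite brE /=.
have -> : (2 %| a + b)%Z by rewrite abn dvdz_mulr.
by have -> : ((a + b) %/ 2)%Z = n by lia.
Qed.
Lemma br_GG_odd a b n : a + b = 2 * n + 1 -> B << BG a >> << BG b >> =
  ((-1) ^ (a + 1) * (a%:~R / 2 - b%:~R / 2)) *: << BT n >>.
Proof.
move=> abn; rewrite brE /=.
have /negbTE -> : ~~ (2 %| a + b)%Z by lia.
by have -> : ((a + b - 1) %/ 2)%Z = n by lia.
Qed.
Lemma br_cl x : B << Bc >> x = 0.
Proof.
by rewrite (linear_eq (f := B << Bc >>) (g := \0)) //= => i _; rewrite brE.
Qed.
Lemma br_cr x : B x << Bc >> = 0.
Proof.
by rewrite br_lin_ext; apply: lin_ext_eq0 => -[m|k|a|] _; rewrite brE.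
Qed.

Lemma parity_cases (a : int) : exists n, a = 2 * n \/ a = 2 * n + 1.
Proof. by exists (a %/ 2)%Z; lia. Qed.

Lemma signz_even n : (-1) ^ (2 * n) = 1:> F.
Proof. by rewrite -exprz_exp -exprnP sqrrN expr1n exp1rz. Qed.

Lemma signzD a b : (-1) ^ (a + b) = (-1) ^ a * (-1) ^ b:> F.
Proof. by rewrite expfzDr // oppr_eq0 oner_eq0. Qed.

Lemma tw_br_par x y : homog tw_par (tw_par x (+) tw_par y) (B << x >> << y >>).
Proof.
case: x y => [m|k|a|] [n|l|b|]; rewrite ?br_cl ?br_cr;
  try exact: homog0.
- by rewrite br_LL; apply: homogP; [exact: homogU | apply: homogZ; exact: homogU].
- by rewrite br_LT; apply: homogZ; exact: homogU.
- by rewrite br_LG; apply: homogZ; exact: homogU.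
- by rewrite br_TL; apply: homogZ; exact: homogU.
- by rewrite br_TT; apply: homogZ; exact: homogU.
- by rewrite br_TG; exact: homogU.
- by rewrite br_GL; apply: homogZ; exact: homogU.
- by rewrite br_GT; apply: homogN; exact: homogU.
- have [n [abn|abn]] := parity_cases (a + b).
    rewrite (br_GG_even abn); apply: homogZ.
    by apply: homogP; [exact: homogU | apply: homogZ; exact: homogU].
  by rewrite (br_GG_odd abn); apply: homogZ; exact: homogU.
Qed.

(** Where a central term is present, its delta gives the relation between the
    indices that makes the two sides agree. *)
Lemma tw_br_skew x y : B << x >> << y >> =
  - (ks (tw_par x) (tw_par y) *: B << y >> << x >>).
Proof.
case: x y => [m|k|a|] [n|l|b|]; rewrite ?br_cl ?br_cr ?scaler0 ?oppr0 //=
  ?ksE.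
- rewrite !br_LL (addrC n m); case: eqP => [mn|_] /=; last by malg_ring.
  have -> : n = - m by lia.
  by malg_ring.
- by rewrite br_LT br_TL; malg_ring.
- by rewrite br_LG br_GL; malg_ring.
- by rewrite br_LT br_TL; malg_ring.
- rewrite !br_TT (addrC l k); case: eqP => [kl|_] /=; last by malg_ring.
  have -> : l = - k - 1 by lia.
  by malg_expand; field.
- by rewrite br_TG br_GT; malg_ring.
- by rewrite br_LG br_GL; malg_ring.
- by rewrite br_TG br_GT; malg_ring.
- have [n [abn|abn]] := parity_cases (a + b); have ban := abn; rewrite addrC in ban.
    rewrite (br_GG_even abn) (br_GG_even ban) (addrC b a).
    have -> : (-1) ^ b = (-1) ^ a:> F.
      by rewrite (_ : b = 2 * (n - a) + a) ?signzD ?signz_even ?mul1r //; lia.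
    case: eqP => [ab|_] /=; last by malg_ring.
    have -> : b = - a by lia.
    by malg_ring.
  rewrite (br_GG_odd abn) (br_GG_odd ban) !signzD.
  have -> : (-1) ^ b = - (-1) ^ a:> F.
    rewrite (_ : b = 2 * (n - a) + 1 + a); last by lia.
    by rewrite !signzD signz_even expr1z; ring.
  by rewrite expr1z; malg_ring.
Qed.

Local Notation jacobi x y z := (B << x >> (B << y >> << z >>) =
  B (B << x >> << y >>) << z >>
  + ks (tw_par x) (tw_par y) *: B << y >> (B << x >> << z >>)).

Lemma br_skewU i (u : g) y : homog tw_par i u ->
  B u << y >> = - (ks i (tw_par y) *: B << y >> u).
Proof.
move=> hu; pattern u; apply: malg_ind_supp => [|x ix|a v w Hv Hw].
- by rewrite br0l br0r scaler0 oppr0.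
- by rewrite tw_br_skew (hu _ ix).
- by rewrite br_linl br_linr Hv Hw; malg_ring.
Qed.

(** The Jacobi identity is invariant under permutations of its arguments, so
    only the triples sorted by [tw_rank] have to be checked. *)
Lemma jacobi_swap12 x y z : jacobi x y z -> jacobi y x z.
Proof.
move=> J; rewrite J (tw_br_skew y x) brNl brZl.
rewrite (ksign_sym _ (tw_par y)) /ksign.
by case: (_ && _); rewrite ?expr0 ?expr1; malg_ring.
Qed.

Lemma jacobi_swap23 x y z : jacobi x y z -> jacobi x z y.
Proof.
have hB i j := @tw_br_par i j; move=> J.
rewrite (tw_br_skew z y) (br_skewU y (@tw_br_par x z)) !brNr !brZr J.
rewrite (br_skewU z (@tw_br_par x y)).
rewrite /ksign; case: (tw_par x); case: (tw_par y); case: (tw_par z);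
  by rewrite /= ?expr0 ?expr1; malg_ring.
Qed.

Definition tw_rank (x : tw_basis) : nat :=
  match x with Bc => 0 | BL _ => 1 | BT _ => 2 | BG _ => 3 end.

Lemma jacobi_sorted x y z :
    (forall x y z, (tw_rank x <= tw_rank y)%N -> (tw_rank y <= tw_rank z)%N ->
      jacobi x y z) ->
  jacobi x y z.
Proof.
move=> J; have [xy|/ltnW yx] := leqP (tw_rank x) (tw_rank y).
  have [yz|/ltnW zy] := leqP (tw_rank y) (tw_rank z); first exact: J.
  have [xz|/ltnW zx] := leqP (tw_rank x) (tw_rank z).
    by apply: jacobi_swap23; exact: J.
  by apply: jacobi_swap23; apply: jacobi_swap12; exact: J.
have [xz|/ltnW zx] := leqP (tw_rank x) (tw_rank z).
  by apply: jacobi_swap12; exact: J.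
have [yz|/ltnW zy] := leqP (tw_rank y) (tw_rank z).
  by apply: jacobi_swap12; apply: jacobi_swap23; exact: J.
by apply: jacobi_swap12; apply: jacobi_swap23; apply: jacobi_swap12; exact: J.
Qed.

Lemma jacobi_LLL m n k : jacobi (BL m) (BL n) (BL k).
Proof.
rewrite !br_LL !(brDr, brDl) !(brZr, brZl) !(br_cr, br_cl) !br_LL /=.
rewrite ksE addrA (addrCA n) addrA; case: eqP => [mnk|_] /=.
  have -> : k = - m - n by lia.
  by malg_expand; field.
by malg_ring.
Qed.

Lemma jacobi_LLT m n k : jacobi (BL m) (BL n) (BT k).
Proof.
rewrite !br_LL !br_LT !(brDr, brDl) !(brZr, brZl) !(br_cr, br_cl) !br_LT /= ksE.
rewrite -!addrA (addrC n m).
by malg_ring.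
Qed.

Lemma jacobi_LLG m n a : jacobi (BL m) (BL n) (BG a).
Proof.
rewrite !br_LL !br_LG !(brDr, brDl) !(brZr, brZl) !(br_cr, br_cl) !br_LG /= ksE.
have -> : a + 2 * n + 2 * m = a + 2 * (m + n) by ring.
have -> : a + 2 * m + 2 * n = a + 2 * (m + n) by ring.
by malg_expand; field.
Qed.

Lemma jacobi_LTT m k l : jacobi (BL m) (BT k) (BT l).
Proof.
rewrite !br_TT !br_LT !(brZr, brZl) br_cr scaler0 !br_TT /= ksE.
have -> : k + (l + m) = k + m + l by ring.
case: eqP => [e|_] /=; last by malg_ring.
have -> : l = - k - m - 1 by lia.
by malg_expand; field.
Qed.

Lemma jacobi_LTG m k a : jacobi (BL m) (BT k) (BG a).
Proof.
rewrite !br_TG !br_LT !br_LG !(brZr, brZl) !br_TG /= ksE.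
have -> : a + (2 * k + 1) + 2 * m = a + (2 * (k + m) + 1) by ring.
have -> : a + 2 * m + (2 * k + 1) = a + (2 * (k + m) + 1) by ring.
by malg_expand; field.
Qed.

Lemma jacobi_TTT k l n : jacobi (BT k) (BT l) (BT n).
Proof.
by rewrite !br_TT !(brZr, brZl) !(br_cr, br_cl) !scaler0 addr0.
Qed.

Lemma jacobi_TTG k l a : jacobi (BT k) (BT l) (BG a).
Proof.
rewrite !br_TG !br_TT !brZl br_cl /= ksE.
have -> : a + (2 * k + 1) + (2 * l + 1) = a + (2 * l + 1) + (2 * k + 1) by ring.
by malg_ring.
Qed.

Lemma jacobi_LGG m a b : jacobi (BL m) (BG a) (BG b).
Proof.
have [n [abn|abn]] := parity_cases (a + b).
  have e1 : a + 2 * m + b = 2 * (m + n) by lia.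
  have e2 : a + (b + 2 * m) = 2 * (m + n) by lia.
  rewrite (br_GG_even abn) !br_LG !(brZr, brZl) (br_GG_even e1) (br_GG_even e2).
  rewrite brDr !brZr br_LL br_cr signzD signz_even /= ksE e1 e2 abn.
  have -> : b = 2 * n - a by lia.
  have -> : (2 * (m + n) == 0) = (m + n == 0) by lia.
  case: eqP => [mn|_] /=; last by malg_expand; field.
  have -> : n = - m by lia.
  by malg_expand; field.
have e1 : a + 2 * m + b = 2 * (n + m) + 1 by lia.
have e2 : a + (b + 2 * m) = 2 * (n + m) + 1 by lia.
rewrite (br_GG_odd abn) !br_LG !(brZr, brZl) (br_GG_odd e1) (br_GG_odd e2).
rewrite br_LT !signzD signz_even /= ksE.
have -> : b = 2 * n + 1 - a by lia.
by malg_expand; field.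
Qed.

Lemma jacobi_TGG k a b : jacobi (BT k) (BG a) (BG b).
Proof.
have [n [abn|abn]] := parity_cases (a + b).
  have e1 : a + (2 * k + 1) + b = 2 * (n + k) + 1 by lia.
  have e2 : a + (b + (2 * k + 1)) = 2 * (n + k) + 1 by lia.
  rewrite (br_GG_even abn) !br_TG (br_GG_odd e1) (br_GG_odd e2).
  rewrite !(brDr, brZr) br_TL br_cr !signzD signz_even expr1z /= ksE (addrC n k).
  have -> : b = 2 * n - a by lia.
  by malg_expand; field.
have e1 : a + (2 * k + 1) + b = 2 * (n + k + 1) by lia.
have e2 : a + (b + (2 * k + 1)) = 2 * (n + k + 1) by lia.
rewrite (br_GG_odd abn) !br_TG (br_GG_even e1) (br_GG_even e2) e1 e2.
rewrite brZr br_TT !signzD signz_even expr1z /= ksE (addrC k n).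
have -> : (2 * (n + k + 1) == 0) = (n + k + 1 == 0) by lia.
have -> : b = 2 * n + 1 - a by lia.
case: eqP => [nk|_] /=; last by malg_expand; field.
have -> : n = - k - 1 by lia.
by malg_expand; field.
Qed.

(** Whatever the parities, [G_a, [G_b, G_c]] is a multiple of a single G: the
    central term disappears. *)
Lemma br_G_GG_even a b c n : b + c = 2 * n ->
  B << BG a >> (B << BG b >> << BG c >>) =
  ((-1) ^ b * (a%:~R - n%:~R)) *: << BG (a + b + c) >>.
Proof.
move=> bcn; rewrite (br_GG_even bcn) brZr brDr !brZr br_GL br_cr.
have -> : a + 2 * n = a + b + c by lia.
by malg_expand; field.
Qed.

Lemma br_G_GG_odd a b c n : b + c = 2 * n + 1 ->
  B << BG a >> (B << BG b >> << BG c >>) =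
  ((-1) ^ b * (b%:~R - c%:~R) / 2) *: << BG (a + b + c) >>.
Proof.
move=> bcn; rewrite (br_GG_odd bcn) brZr br_GT.
have -> : a + (2 * n + 1) = a + b + c by lia.
by rewrite signzD expr1z; malg_expand; field.
Qed.

Lemma signz_subr n a : (-1) ^ (2 * n - a) = (-1) ^ a:> F.
Proof.
by rewrite (_ : 2 * n - a = 2 * (n - a) + a) ?signzD ?signz_even ?mul1r //; lia.
Qed.

Lemma signz_subr1 n a : (-1) ^ (2 * n + 1 - a) = - (-1) ^ a:> F.
Proof.
rewrite (_ : 2 * n + 1 - a = 2 * (n - a) + 1 + a); last by lia.
by rewrite !signzD signz_even expr1z; ring.
Qed.

Lemma eq_combination (x x' y y' z z' : g) (s t : F) :
  x = x' -> y = y' -> z = z' -> x' = - (s *: z') + t *: y' ->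
  x = - (s *: z) + t *: y.
Proof. by move=> -> -> ->. Qed.

Lemma jacobi_GGG a b c : jacobi (BG a) (BG b) (BG c).
Proof.
rewrite [B (B _ _) _](br_skewU _ (@tw_br_par _ _)) /= !ksE.
have [n [ab|ab]] := parity_cases (a + b); rewrite addrC in ab;
  have [l [bc|bc]] := parity_cases (b + c).
- have ca : a + c = 2 * (l - n + a) by lia.
  have ba : a + b = 2 * n by lia.
  apply: (eq_combination (br_G_GG_even _ bc) (br_G_GG_even _ ca) (br_G_GG_even _ ba)).
  rewrite (addrC b a) -(addrA c) (addrC c).
  have -> : c = 2 * l - b by lia.
  have -> : b = 2 * n - a by lia.
  by rewrite !signz_subr; malg_expand; field.
- have ca : a + c = 2 * (l - n + a) + 1 by lia.
  have ba : a + b = 2 * n by lia.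
  apply: (eq_combination (br_G_GG_odd _ bc) (br_G_GG_odd _ ca) (br_G_GG_even _ ba)).
  rewrite (addrC b a) -(addrA c) (addrC c).
  have -> : c = 2 * l + 1 - b by lia.
  have -> : b = 2 * n - a by lia.
  by rewrite !signz_subr; malg_expand; field.
- have ca : a + c = 2 * (l - n + a - 1) + 1 by lia.
  have ba : a + b = 2 * n + 1 by lia.
  apply: (eq_combination (br_G_GG_even _ bc) (br_G_GG_odd _ ca) (br_G_GG_odd _ ba)).
  rewrite (addrC b a) -(addrA c) (addrC c).
  have -> : c = 2 * l - b by lia.
  have -> : b = 2 * n + 1 - a by lia.
  by rewrite !signz_subr1; malg_expand; field.
- have ca : a + c = 2 * (l - n + a) by lia.
  have ba : a + b = 2 * n + 1 by lia.
  apply: (eq_combination (br_G_GG_odd _ bc) (br_G_GG_even _ ca) (br_G_GG_odd _ ba)).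
  rewrite (addrC b a) -(addrA c) (addrC c).
  have -> : c = 2 * l + 1 - b by lia.
  have -> : b = 2 * n + 1 - a by lia.
  by rewrite !signz_subr1; malg_expand; field.
Qed.

Theorem tw_lie_superalgebra : lie_superalgebra tw_par (tw_phi F).
Proof.
apply: lie_superalgebra_basis; [exact: tw_br_par | exact: tw_br_skew |].
move=> x y z; apply: jacobi_sorted => {x y z} x y z.
case: x => [m|k|a|]; last by rewrite !br_cl br0l br0r scaler0 addr0.
- case: y => [n|l|b|] // _; case: z => [p|q|c|] // _;
    [exact: jacobi_LLL | exact: jacobi_LLT | exact: jacobi_LLG
    | exact: jacobi_LTT | exact: jacobi_LTG | exact: jacobi_LGG].
- case: y => [n|l|b|] // _; case: z => [p|q|c|] // _;
    [exact: jacobi_TTT | exact: jacobi_TTG | exact: jacobi_TGG].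
- case: y => [n|l|b|] // _; case: z => [p|q|c|] // _; exact: jacobi_GGG.
Qed.

End Brackets.

(** * Coordinates of the adjoint action *)

Section Coordinates.
Variable K : numFieldType.
Local Notation F := (Num.NumField.Exports.Num_NumField__to__GRing_Field K).
Local Notation g := {malg F[tw_basis]}.
Local Notation g2 := {malg F[(tw_basis * tw_basis)%type]}.
Local Notation B := (br (tw_phi F)).
Local Notation ks := (ksign F).
Local Notation act := (act tw_par (tw_phi F)).

(** The even basis elements other than the central one, in a single family:
    L_n has index 2n and T_r has index 2r, so that e_k shifts the index of
    G by k. *)
Definition eb (k : int) : tw_basis :=
  if (2 %| k)%Z then BL (k %/ 2)%Z else BT ((k - 1) %/ 2)%Z.

Lemma eb_even n : eb (2 * n) = BL n.
Proof. by rewrite /eb dvdz_mulr //; congr BL; lia. Qed.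
Lemma eb_odd n : eb (2 * n + 1) = BT n.
Proof.
rewrite /eb; have /negbTE -> : ~~ (2 %| 2 * n + 1)%Z by lia.
by congr BT; lia.
Qed.

Lemma par_eb k : tw_par (eb k) = false.
Proof. by rewrite /eb; case: ifP. Qed.

Lemma eb_inj : injective eb.
Proof.
move=> k l.
have [m [-> | ->]] := parity_cases k; have [n [-> | ->]] := parity_cases l;
  by rewrite ?eb_even ?eb_odd => // -[->].
Qed.

Variant tw_spec : tw_basis -> Type :=
  | TwE k : tw_spec (eb k) | TwG a : tw_spec (BG a) | TwC : tw_spec Bc.

Lemma twP x : tw_spec x.
Proof.
by case: x => [n|k|a|]; rewrite -?eb_even -?eb_odd; constructor.
Qed.

(** The structure constants of the action of E on G, see [br_EG]. *)
Definition kap (a k : int) : F :=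
  if (2 %| k)%Z then (k%:~R - 2 * a%:~R) / 4 else 1.

Lemma kap_even a n : kap a (2 * n) = (n%:~R - a%:~R) / 2.
Proof. by rewrite /kap dvdz_mulr // intrM; field. Qed.
Lemma kap_odd a n : kap a (2 * n + 1) = 1.
Proof. by rewrite /kap; have /negbTE -> : ~~ (2 %| 2 * n + 1)%Z by lia. Qed.

Lemma kap_eq0 a k : (kap a k == 0) = (k == 2 * a).
Proof.
have [n [->| ->]] := parity_cases k; last by rewrite kap_odd oner_eq0; lia.
rewrite kap_even mulf_eq0 invr_eq0 pnatr_eq0 orbF -intrB intr_eq0.
by apply/eqP/eqP; lia.
Qed.

Lemma br_EG k a : B << eb k >> << BG a >> = kap a k *: << BG (a + k) >>.
Proof.
have [n [->| ->]] := parity_cases k.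
  by rewrite eb_even kap_even br_LG mulrBl.
by rewrite eb_odd kap_odd br_TG scale1r.
Qed.

Lemma br_GE k a : B << BG a >> << eb k >> = - kap a k *: << BG (a + k) >>.
Proof. by rewrite tw_br_skew br_EG /= par_eb ksE scale1r scaleNr. Qed.

(** In this algebra most coordinates of [x, y] involve one coordinate of y
    only; it is then enough to look at basis elements y. *)
Lemma br_coef x i w c (y : g) :
    (forall z, (B << x >> << z >>)@_i = c * (z == w)%:R) ->
  (B << x >> y)@_i = c * y@_w.
Proof.
move=> H; pattern y; apply: malg_ind => [|z|a u v Hu Hv].
- by rewrite br0r !mcoeff0 mulr0.
- by rewrite H coefU.
- rewrite br_linr; refine (etrans (coef_add (coef_scale a Hu) Hv) _).
  by coef_simpl; coef_generalize; ring.
Qed.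

Lemma br_coef0 x i (y : g) :
    (forall z, (B << x >> << z >>)@_i = 0) -> (B << x >> y)@_i = 0.
Proof. by move=> H; rewrite (@br_coef _ _ i 0) ?mul0r // => z; rewrite H mul0r. Qed.

Lemma eq_bool (b c : bool) : (b <-> c) -> b%:R = c%:R:> F.
Proof. by case: b; case: c => // -[bc cb]; [have := bc isT | have := cb isT]. Qed.

Ltac coef_basis :=
  coef_simpl; rewrite ?(mul0r, mulr0, addr0, add0r, oppr0, mul1r) //;
  try (congr (_ * _) || congr (- _) || idtac);
  try (apply: eq_bool; split => /eqP => [[?] | [?]]; apply/eqP; f_equal; lia).

Lemma coef_TG k (y : g) i :
  (B << BT k >> y)@_(BG i) = y@_(BG (i - (2 * k + 1))).
Proof.
rewrite (@br_coef _ _ (BG (i - (2 * k + 1))) 1) ?mul1r // => -[n|l|a|];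
  rewrite ?br_TL ?br_TT ?br_TG ?br_cr; coef_basis.
Qed.

Lemma coef_TL k (y : g) n : (B << BT k >> y)@_(BL n) = 0.
Proof.
by apply: br_coef0 => -[m|l|a|]; rewrite ?br_TL ?br_TT ?br_TG ?br_cr; coef_basis.
Qed.

Lemma coef_TT k (y : g) l :
  (B << BT k >> y)@_(BT l) = (k%:~R + 2^-1) * y@_(BL (l - k)).
Proof.
apply: br_coef => -[m|n|a|]; rewrite ?br_TL ?br_TT ?br_TG ?br_cr; coef_basis.
Qed.

Lemma coef_Tc k (y : g) :
  (B << BT k >> y)@_Bc = (k%:~R + 2^-1) / 3 * y@_(BT (- k - 1)).
Proof.
apply: br_coef => -[m|n|a|]; rewrite ?br_TL ?br_TG ?br_cr; try by coef_basis.
rewrite br_TT; coef_simpl; rewrite eqxx mulr1; congr (_ * _).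
by apply: eq_bool; split => /eqP => [?|[?]]; apply/eqP; [congr BT|]; lia.
Qed.

Lemma coef_LG m (y : g) i :
  (B << BL m >> y)@_(BG i) = ((m - (i - 2 * m))%:~R / 2) * y@_(BG (i - 2 * m)).
Proof.
apply: br_coef => -[n|k|a|]; rewrite ?br_LL ?br_LT ?br_cr;
  try by coef_simpl; rewrite !(mulr0, addr0).
rewrite br_LG; coef_simpl.
case: (boolP (a == i - 2 * m)) => [/eqP ->|ne].
  by rewrite eqxx (_ : i - 2 * m + 2 * m = i) ?eqxx ?intrB; [field | ring].
rewrite (_ : (BG a == _) = false); last first.
  by apply/eqP => -[e]; case/eqP: ne.
rewrite (_ : (BG _ == _) = false) ?mulr0 //.
by apply/eqP => -[e]; case/eqP: ne; lia.
Qed.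

Lemma coef_L0c (y : g) : (B << BL 0 >> y)@_Bc = 0.
Proof.
apply: br_coef0 => -[n|k|a|]; rewrite ?br_LT ?br_LG ?br_cr;
  try by coef_simpl; rewrite ?mulr0.
by rewrite br_LL; coef_simpl; rewrite mulr0 add0r expr0n subrr !mul0r.
Qed.

Lemma coef_GG a (y : g) i :
  (B << BG a >> y)@_(BG i) = - kap a (i - a) * y@_(eb (i - a)).
Proof.
apply: br_coef => z; case: (twP z) => [k|b|].
- rewrite br_GE; coef_simpl; case: (boolP (k == i - a)) => [/eqP ->|ne].
    by rewrite eqxx (_ : a + (i - a) = i) ?eqxx //; ring.
  rewrite (inj_eq eb_inj) (negbTE ne); case: eqP => [[e]|_]; last by rewrite !mulr0.
  by case/eqP: ne; lia.
- rewrite (_ : (BG b == _) = false); last first.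
    by apply/eqP; rewrite /eb; case: ifP.
  have [n [e|e]] := parity_cases (a + b).
    by rewrite (br_GG_even _ e); coef_simpl; rewrite !(mulr0, addr0).
  by rewrite (br_GG_odd _ e); coef_simpl; rewrite !mulr0.
- rewrite br_cr; coef_simpl; rewrite (_ : (Bc == _) = false) ?mulr0 //.
  by apply/eqP; rewrite /eb; case: ifP.
Qed.

End Coordinates.

(** * Superderivations into the tensor square *)

Section Derivations.
Variable K : numFieldType.
Local Notation F := (Num.NumField.Exports.Num_NumField__to__GRing_Field K).
Local Notation g := {malg F[tw_basis]}.
Local Notation g2 := {malg F[(tw_basis * tw_basis)%type]}.
Local Notation B := (br (tw_phi F)).
Local Notation ks := (ksign F).
Local Notation act := (act tw_par (tw_phi F)).
Local Notation hom2 := (homog (par2 tw_par tw_par)).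

(** A superderivation of parity e, given by its values on the basis. *)
Definition der (e : bool) (f : tw_basis -> g2) : Prop := forall x y,
  lin_ext f (B << x >> << y >>) =
  ks e (tw_par x) *: act x (f y) - ks (tw_par y) (e (+) tw_par x) *: act y (f x).

Definition inn (e : bool) (v : g2) (x : tw_basis) : g2 :=
  ks e (tw_par x) *: act x v.

Lemma innE v x : inn false v x = act x v :> g2.
Proof. by rewrite /inn ksE scale1r. Qed.

Lemma der_inn e v : der e (inn e v).
Proof.
move=> x y.
rewrite (eq_lin_ext (g := fun k => ks e (tw_par x (+) tw_par y) *: act k v)).
  rewrite lin_ext_scale.
  rewrite (act_bracket (tw_lie_superalgebra K)) /inn !actZ.
  rewrite /ksign; case: e; case: (tw_par x); case: (tw_par y);
    by rewrite /= ?expr0 ?expr1; malg_ring.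
by move=> k /(@tw_br_par K x y) pk; rewrite /inn pk.
Qed.

Lemma der_sub e f v : der e f -> der e (fun x => f x - inn e v x).
Proof.
by move=> df x y; rewrite lin_extB df der_inn !actB; malg_ring.
Qed.

(** Twice the absolute value of the index. *)
Definition tw_size (x : tw_basis) : nat :=
  match x with
  | BL n => absz (2 * n) | BT k => absz (2 * k + 1) | BG a => absz a | Bc => 0%N
  end.

Lemma support_bound (u : g2) : exists N, forall x y,
  (N < tw_size x)%N || (N < tw_size y)%N -> u@_(x, y) = 0.
Proof.
pattern u; apply: malg_ind => [|[x y]|a v w [M HM] [N HN]].
- by exists 0%N => x y _; rewrite mcoeff0.
- exists (maxn (tw_size x) (tw_size y)) => x' y' H; rewrite coefU.
  case: eqP => // -[ex ey]; move: H; rewrite -ex -ey !gtn_max !ltnn /=.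
  by rewrite andbF.
- exists (maxn M N) => x y; rewrite !gtn_max => H; coef_simpl.
  rewrite HM ?HN ?mulr0 ?addr0 //;
    by case/orP: H => /andP[H1 H2]; rewrite ?H1 ?H2 ?orbT.
Qed.

Section TAction.
Variables (k : int) (u : g2).

Lemma act_T_GG x y : (act (BT k) u)@_(BG x, BG y) =
  u@_(BG (x - (2 * k + 1)), BG y) + u@_(BG x, BG (y - (2 * k + 1))).
Proof. by rewrite act_coef /= ksE mul1r !coef_TG sl1_coef sl2_coef. Qed.

Lemma act_T_GL x n :
  (act (BT k) u)@_(BG x, BL n) = u@_(BG (x - (2 * k + 1)), BL n).
Proof. by rewrite act_coef /= ksE mul1r coef_TG coef_TL addr0 sl1_coef. Qed.

Lemma act_T_LG x n :
  (act (BT k) u)@_(BL n, BG x) = u@_(BL n, BG (x - (2 * k + 1))).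
Proof. by rewrite act_coef /= ksE mul1r coef_TG coef_TL add0r sl2_coef. Qed.

Lemma act_T_GT x l : (act (BT k) u)@_(BG x, BT l) =
  u@_(BG (x - (2 * k + 1)), BT l) + (k%:~R + 2^-1) * u@_(BG x, BL (l - k)).
Proof. by rewrite act_coef /= ksE mul1r coef_TG coef_TT sl1_coef sl2_coef. Qed.

Lemma act_T_TG x l : (act (BT k) u)@_(BT l, BG x) =
  (k%:~R + 2^-1) * u@_(BL (l - k), BG x) + u@_(BT l, BG (x - (2 * k + 1))).
Proof. by rewrite act_coef /= ksE mul1r coef_TG coef_TT sl1_coef sl2_coef. Qed.

Lemma act_T_Gc x : (act (BT k) u)@_(BG x, Bc) =
  u@_(BG (x - (2 * k + 1)), Bc)
  + (k%:~R + 2^-1) / 3 * u@_(BG x, BT (- k - 1)).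
Proof. by rewrite act_coef /= ksE mul1r coef_TG coef_Tc sl1_coef sl2_coef. Qed.

Lemma act_T_cG x : (act (BT k) u)@_(Bc, BG x) =
  (k%:~R + 2^-1) / 3 * u@_(BT (- k - 1), BG x)
  + u@_(Bc, BG (x - (2 * k + 1))).
Proof. by rewrite act_coef /= ksE mul1r coef_TG coef_Tc sl1_coef sl2_coef. Qed.

Lemma act_T_cc : (act (BT k) u)@_(Bc, Bc) =
  (k%:~R + 2^-1) / 3 * u@_(BT (- k - 1), Bc)
  + (k%:~R + 2^-1) / 3 * u@_(Bc, BT (- k - 1)).
Proof.
rewrite act_coef /= ksE mul1r; congr (_ + _); first by rewrite coef_Tc sl1_coef.
by rewrite coef_Tc sl2_coef.
Qed.

End TAction.

(** On G (x) E and E (x) G the element T_(1/2) acts by an invertible shift of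
    the index of G, up to an operator that lowers E from L to T to c.  So the
    coordinates are determined in this order. *)
Lemma act_T_inj_odd (u : g2) : hom2 true u -> act (BT 0) u = 0 -> u = 0.
Proof.
move=> hu u0.
have E x y : (act (BT 0) u)@_(x, y) = 0 by rewrite u0 mcoeff0.
have GL x n : u@_(BG x, BL n) = 0.
  by have := E (BG (x + 1)) (BL n); rewrite act_T_GL addrK.
have LG x n : u@_(BL n, BG x) = 0.
  by have := E (BL n) (BG (x + 1)); rewrite act_T_LG addrK.
have GT x l : u@_(BG x, BT l) = 0.
  by have := E (BG (x + 1)) (BT l); rewrite act_T_GT addrK GL mulr0 addr0.
have TG x l : u@_(BT l, BG x) = 0.
  by have := E (BT l) (BG (x + 1)); rewrite act_T_TG addrK LG mulr0 add0r.
have Gc x : u@_(BG x, Bc) = 0.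
  by have := E (BG (x + 1)) Bc; rewrite act_T_Gc addrK GT mulr0 addr0.
have cG x : u@_(Bc, BG x) = 0.
  by have := E Bc (BG (x + 1)); rewrite act_T_cG addrK TG mulr0 add0r.
by apply/malgP => -[x y]; rewrite mcoeff0;
  case: x => [n|k|a|]; case: y => [m|l|b|] //; apply: (homog_coef hu).
Qed.

(** For the same reason preimages are found first for the tensors with c, then
    for those with T, and last for those with L. *)
Lemma act_T_surj_odd (u : g2) : hom2 true u ->
  exists2 v, hom2 true v & act (BT 0) v = u.
Proof.
pose P (u : g2) := exists2 v, hom2 true v & act (BT 0) v = u.
have P0 : P 0 by exists 0; [exact: homog0 | exact: act0].
have PD a u1 u2 : P u1 -> P u2 -> P (a *: u1 + u2).
  move=> [v1 h1 <-] [v2 h2 <-]; exists (a *: v1 + v2); first exact: homogP.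
  exact: act_lin.
have PZ a u1 : P u1 -> P (a *: u1).
  by move=> H; rewrite -[a *: u1]addr0; exact: PD.
have PU x y : tw_par x (+) tw_par y = true -> P (act (BT 0) << (x, y) >>).
  by move=> h; exists << (x, y) >> => //; exact: homogU.
(* P passes from the image of a basis element to its leading term. *)
have Psub (u1 u2 : g2) : P (u1 + u2) -> P u2 -> P u1.
  move=> H12 H2; rewrite -[u1](addrK u2) addrC -scaleN1r.
  exact: PD.
move=> hu; change (P u); pattern u; apply: malg_ind_supp => [//|[x y]|a u1 u2];
  last exact: PD.
move=> /hu; rewrite /par2 /= => h.
have Gc a : P << (BG a, Bc) >>.
  have := @PU (BG (a - 1)) Bc isT; rewrite actU br_TG br_cr tens0r scaler0 addr0.
  by rewrite subrK tensUU.
have cG a : P << (Bc, BG a) >>.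
  have := @PU Bc (BG (a - 1)) isT; rewrite actU br_TG br_cr tens0l add0r /= ksE.
  by rewrite scale1r subrK tensUU.
have GT a l : P << (BG a, BT l) >>.
  have := @PU (BG (a - 1)) (BT l) isT; rewrite actU br_TG br_TT subrK !tensUU.
  by move/Psub; apply; apply: (PZ); rewrite tensZr tensUU; exact: PZ.
have TG a l : P << (BT l, BG a) >>.
  have := @PU (BT l) (BG (a - 1)) isT.
  rewrite actU br_TG br_TT subrK /= ksE scale1r tensUU tensZl tensUU addrC.
  by move/Psub; apply; exact: PZ.
have GL a n : P << (BG a, BL n) >>.
  have := @PU (BG (a - 1)) (BL n) isT; rewrite actU br_TG br_TL subrK !tensUU.
  by move/Psub; apply; apply: (PZ); rewrite tensZr tensUU; exact: PZ.
have LG a n : P << (BL n, BG a) >>.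
  have := @PU (BL n) (BG (a - 1)) isT.
  rewrite actU br_TG br_TL subrK /= ksE scale1r tensUU tensZl tensUU addrC.
  by move/Psub; apply; exact: PZ.
by case: x h => [n|k|a|]; case: y => [m|l|b|].
Qed.

End Derivations.

(** * Odd superderivations are inner *)

Section OddDerivations.
Variable K : numFieldType.
Local Notation F := (Num.NumField.Exports.Num_NumField__to__GRing_Field K).
Local Notation g := {malg F[tw_basis]}.
Local Notation g2 := {malg F[(tw_basis * tw_basis)%type]}.
Local Notation B := (br (tw_phi F)).
Local Notation ks := (ksign F).
Local Notation act := (act tw_par (tw_phi F)).
Local Notation hom2 := (homog (par2 tw_par tw_par)).

Variable f : tw_basis -> g2.
Hypothesis df : der true f.
Hypothesis hf : forall x, hom2 (tw_par x (+) true) (f x).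

Section Normalized.
Hypothesis fT0 : f (BT 0) = 0.

(** As f(T_(1/2)) = 0, T_(1/2) . f(x) is f([T_(1/2), x]); and T_(1/2) is
    injective on the odd part. *)
Lemma odd_vanish_even x : tw_par x = false ->
  (exists y, B << BT 0 >> << x >> = y /\ lin_ext f y = 0) -> f x = 0.
Proof.
move=> px [y [Ey fy]]; apply: act_T_inj_odd;
  first by have := hf (x := x); rewrite px.
have := df (BT 0) x.
by rewrite Ey fy /= px fT0 act0 !ksE scaler0 subr0 scale1r => <-.
Qed.

Lemma odd_fc : f Bc = 0.
Proof.
by apply: odd_vanish_even => //; exists 0; rewrite br_cr linear0.
Qed.

Lemma odd_fT k : f (BT k) = 0.
Proof.
apply: odd_vanish_even => //; eexists; split; first exact: br_TT.
by rewrite linearZ /= lin_extU odd_fc scaler0.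
Qed.

Lemma odd_fL m : f (BL m) = 0.
Proof.
apply: odd_vanish_even => //; eexists; split; first exact: br_TL.
by rewrite linearZ /= lin_extU odd_fT scaler0.
Qed.

Lemma odd_shift k a : f (BG (a + (2 * k + 1))) = act (BT k) (f (BG a)).
Proof.
have := df (BT k) (BG a).
by rewrite br_TG lin_extU /= odd_fT act0 ksE scaler0 subr0 scale1r.
Qed.

Lemma odd_G_T0 a : f (BG a) = act (BT 0) (f (BG (a - 1))).
Proof. by rewrite -odd_shift subrK. Qed.

Lemma sum3_eq0 (x b c : F) : x = x + b + (c + x) -> c = - x - b.
Proof.
move=> E; have E0 : x + b + c = 0 by apply: (addrI x); rewrite addr0 [RHS]E; ring.
by apply/eqP; rewrite -subr_eq0 -E0; apply/eqP; ring.
Qed.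

(** T_(-1/2) T_(1/2) fixes f (BG a), and acts on G (x) G as s/t + t/s + 2 does
    on Laurent polynomials in s and t.  So on each antidiagonal the coordinates
    satisfy a three-term recurrence, and vanish as they do so far out. *)
Lemma odd_GG a x y : (f (BG a))@_(BG x, BG y) = 0.
Proof.
set u := f (BG a).
have rec x' y' : u@_(BG (x' - 1), BG (y' + 1)) =
    - u@_(BG x', BG y') - u@_(BG (x' + 1), BG (y' - 1)).
  have := odd_shift (- 1) (a + (2 * 0 + 1)); rewrite (odd_shift 0 a).
  rewrite (_ : a + (2 * 0 + 1) + (2 * - 1 + 1) = a); last by ring.
  rewrite -/u => /(congr1 (mcoeff (BG x', BG y'))); rewrite !act_T_GG.
  have e0 (z : int) : z - (2 * - 1 + 1) - (2 * 0 + 1) = z by ring.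
  have e1 (z : int) : z - (2 * - 1 + 1) = z + 1 by ring.
  have e2 (z : int) : z - (2 * 0 + 1) = z - 1 by ring.
  by rewrite !e0 !e1 !e2; exact: sum3_eq0.
have [N HN] := support_bound u.
have vanish n : u@_(BG (N%:Z + 1 - n%:Z), BG (x + y - (N%:Z + 1 - n%:Z))) = 0
    /\ u@_(BG (N%:Z + 2 - n%:Z), BG (x + y - (N%:Z + 2 - n%:Z))) = 0.
  elim: n => [|n [IH1 IH2]].
    by split; apply: HN => /=; apply/orP; left; lia.
  have := rec (N%:Z + 1 - n%:Z) (x + y - (N%:Z + 1 - n%:Z)).
  rewrite IH1 (_ : N%:Z + 1 - n%:Z + 1 = N%:Z + 2 - n%:Z); last by ring.
  rewrite (_ : x + y - (N%:Z + 1 - n%:Z) - 1 = x + y - (N%:Z + 2 - n%:Z));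
    last by ring.
  rewrite IH2 oppr0 addr0 => E; split.
    by rewrite -[RHS]E; congr (_@_(BG _, BG _)); lia.
  by rewrite -[RHS]IH1; congr (_@_(BG _, BG _)); lia.
have [big|small] := ltP N%:Z x.
  by apply: HN => /=; apply/orP; left; lia.
have [E _] := vanish (absz (N%:Z + 1 - x)%R).
by rewrite -[RHS]E; congr (_@_(BG _, BG _)); lia.
Qed.

(** On E (x) E the element T_(1/2) is nilpotent, while f (BG a) is obtained from
    f (BG (a - 1)) by applying it. *)
Lemma odd_fG a : f (BG a) = 0.
Proof.
have LL b m n : (f (BG b))@_(BL m, BL n) = 0.
  by rewrite odd_G_T0 act_coef /= !coef_TL mulr0 addr0.
have LT b m l : (f (BG b))@_(BL m, BT l) = 0.
  by rewrite odd_G_T0 act_coef /= coef_TL coef_TT sl2_coef LL !mulr0 addr0.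
have TL b m l : (f (BG b))@_(BT l, BL m) = 0.
  by rewrite odd_G_T0 act_coef /= coef_TL coef_TT sl1_coef LL !mulr0 addr0.
have Lc b m : (f (BG b))@_(BL m, Bc) = 0.
  by rewrite odd_G_T0 act_coef /= coef_TL coef_Tc sl2_coef LT !mulr0 addr0.
have cL b m : (f (BG b))@_(Bc, BL m) = 0.
  by rewrite odd_G_T0 act_coef /= coef_TL coef_Tc sl1_coef TL !mulr0 addr0.
have TT b k l : (f (BG b))@_(BT k, BT l) = 0.
  rewrite odd_G_T0 act_coef /= !coef_TT sl1_coef sl2_coef LT TL.
  by rewrite !mulr0 addr0.
have Tc b k : (f (BG b))@_(BT k, Bc) = 0.
  rewrite odd_G_T0 act_coef /= coef_TT coef_Tc sl1_coef sl2_coef Lc TT.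
  by rewrite !mulr0 addr0.
have cT b k : (f (BG b))@_(Bc, BT k) = 0.
  rewrite odd_G_T0 act_coef /= coef_TT coef_Tc sl1_coef sl2_coef cL TT.
  by rewrite !mulr0 addr0.
have cc b : (f (BG b))@_(Bc, Bc) = 0.
  by rewrite odd_G_T0 act_T_cc cT Tc !mulr0 addr0.
apply/malgP => -[x y]; rewrite mcoeff0.
case: x => [m|k|b|]; case: y => [n|l|c|] //; try exact: odd_GG;
  exact: (homog_coef (hf (x := BG a))).
Qed.

End Normalized.

End OddDerivations.

Section OddInner.
Variable K : numFieldType.
Local Notation F := (Num.NumField.Exports.Num_NumField__to__GRing_Field K).
Local Notation g2 := {malg F[(tw_basis * tw_basis)%type]}.
Local Notation hom2 := (homog (par2 tw_par tw_par)).

Lemma odd_inner (f : tw_basis -> g2) :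
    der true f -> (forall x, hom2 (tw_par x (+) true) (f x)) ->
  exists2 v, hom2 true v & forall x, f x = inn true v x.
Proof.
move=> df hf; have [v hv Ev] := act_T_surj_odd (hf (BT 0)).
exists v => // x; apply/eqP; rewrite -subr_eq0; apply/eqP.
pose f' x := f x - inn true v x.
have df' : der true f' by exact: der_sub.
have hf' y : hom2 (tw_par y (+) true) (f' y).
  apply: homogD; first exact: hf.
  apply: homogN; apply: homogZ.
  exact: (homog_act (tw_lie_superalgebra K)).
have f'T : f' (BT 0) = 0 by rewrite /f' /inn /= Ev ksE scale1r subrr.
rewrite -/(f' x); case: x => [m|k|a|].
- exact: odd_fL.
- exact: odd_fT.
- exact: odd_fG.
- exact: odd_fc.
Qed.

End OddInner.

(** * Even superderivations: the component in G (x) G on the even part *)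

Lemma tensPr (K : fieldType) (I J : choiceType) (x : {malg K[I]}) a
    (u v : {malg K[J]}) : x ⊗ (a *: u + v) = a *: (x ⊗ u) + x ⊗ v.
Proof. by rewrite tensDr tensZr. Qed.
Lemma tensPl (K : fieldType) (I J : choiceType) a (u v : {malg K[I]})
    (y : {malg K[J]}) : (a *: u + v) ⊗ y = a *: (u ⊗ y) + v ⊗ y.
Proof. by rewrite tensDl tensZl. Qed.

Section AlternatingSum.
Variable K : numFieldType.
Local Notation F := (Num.NumField.Exports.Num_NumField__to__GRing_Field K).
Local Notation g := {malg F[tw_basis]}.
Local Notation g2 := {malg F[(tw_basis * tw_basis)%type]}.
Local Notation B := (br (tw_phi F)).
Local Notation ks := (ksign F).
Local Notation act := (act tw_par (tw_phi F)).
Local Notation hom2 := (homog (par2 tw_par tw_par)).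

(** These functionals, one for each total index s, detect the cokernel of
    T_(1/2) on G (x) G: see [alt_T] and [alt_normal_form]. *)
Definition altsum (s : int) (u : g2) : F :=
  lin_ext (fun t => match t with
    | (BG x, BG y) => if x + y == s then (-1) ^ x else 0
    | _ => 0 end : F^o) u.

Lemma alt_lin s a (u v : g2) :
  altsum s (a *: u + v) = a * altsum s u + altsum s v.
Proof. by rewrite /altsum linearP. Qed.
Lemma alt0 s : altsum s 0 = 0.
Proof. by rewrite /altsum linear0. Qed.
Lemma altZ s a (u : g2) : altsum s (a *: u) = a * altsum s u.
Proof. by rewrite /altsum linearZ. Qed.
Lemma altD s (u v : g2) : altsum s (u + v) = altsum s u + altsum s v.
Proof. by rewrite /altsum linearD. Qed.
Lemma altB s (u v : g2) : altsum s (u - v) = altsum s u - altsum s v.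
Proof. by rewrite /altsum linearB. Qed.
Lemma alt_GG s x y :
  altsum s << (BG x, BG y) >> = if x + y == s then (-1) ^ x else 0.
Proof. by rewrite /altsum lin_extU. Qed.

Lemma altU0 s x y : ~~ (tw_par x && tw_par y) -> altsum s << (x, y) >> = 0.
Proof.
by rewrite /altsum lin_extU; case: x => [n|k|a|]; case: y => [m|l|b|].
Qed.

Local Opaque altsum.

Lemma lincomb0 (c x y : F) : x = 0 -> y = 0 -> c * x + y = 0.
Proof. by move=> -> ->; rewrite mulr0 addr0. Qed.

Lemma alt_tens_evenl s (x y : g) : homog tw_par false x -> altsum s (x ⊗ y) = 0.
Proof.
move=> hx; pattern x; apply: malg_ind_supp => [|a ax|c v w Hv Hw].
- by rewrite tens0l alt0.
- pattern y; apply: malg_ind => [|b|c v w Hv Hw].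
  + by rewrite tens0r alt0.
  + by rewrite tensUU altU0 // (hx _ ax).
  + by rewrite tensPr alt_lin; exact: lincomb0.
- by rewrite tensPl alt_lin; exact: lincomb0.
Qed.

Lemma alt_tens_evenr s (x y : g) : homog tw_par false y -> altsum s (x ⊗ y) = 0.
Proof.
move=> hy; pattern y; apply: malg_ind_supp => [|a ay|c v w Hv Hw].
- by rewrite tens0r alt0.
- pattern x; apply: malg_ind => [|b|c v w Hv Hw].
  + by rewrite tens0l alt0.
  + by rewrite tensUU altU0 // (hy _ ay) andbF.
  + by rewrite tensPl alt_lin; exact: lincomb0.
- by rewrite tensPr alt_lin; exact: lincomb0.
Qed.

(** Even elements preserve parity in each factor, so only G (x) G is mapped to
    G (x) G. *)
Lemma alt_act_even s z x y : tw_par z = false -> ~~ (tw_par x && tw_par y) ->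
  altsum s (act z << (x, y) >>) = 0.
Proof.
move=> pz; rewrite actU altD altZ negb_and addrC => /orP[px|py].
  apply: lincomb0; apply: alt_tens_evenl.
    by apply: homogU; apply/negbTE.
  by have := @tw_br_par K z x; rewrite pz (negbTE px).
apply: lincomb0; apply: alt_tens_evenr.
  by have := @tw_br_par K z y; rewrite pz (negbTE py).
by apply: homogU; apply/negbTE.
Qed.

Lemma act_even_GG_U k x y : act (BT k) << (BG x, BG y) >> =
  << (BG (x + (2 * k + 1)), BG y) >> + << (BG x, BG (y + (2 * k + 1))) >>.
Proof. by rewrite actU !br_TG /= ksE scale1r !tensUU. Qed.

Lemma act_L_GG_U m x y : act (BL m) << (BG x, BG y) >> =
  (m%:~R / 2 - x%:~R / 2) *: << (BG (x + 2 * m), BG y) >>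
  + (m%:~R / 2 - y%:~R / 2) *: << (BG x, BG (y + 2 * m)) >>.
Proof.
rewrite actU (br_LG K m x) (br_LG K m y) /= ksE scale1r.
by rewrite tensZl tensZr (tensUU _ (BG (x + 2 * m))) (tensUU _ (BG x)).
Qed.

Lemma alt_T k s (u : g2) : altsum s (act (BT k) u) = 0.
Proof.
pattern u; apply: malg_ind => [|[x y]|a v w Hv Hw].
- by rewrite act0 alt0.
- have [pxy|pxy] := boolP (tw_par x && tw_par y); last exact: alt_act_even.
  case: x y pxy => [n|l|x|] [m|j|y|] // _.
  rewrite act_even_GG_U altD !alt_GG.
  rewrite (_ : x + (2 * k + 1) + y = x + (y + (2 * k + 1))); last by ring.
  case: eqP => _; last by rewrite addr0.
  by rewrite !signzD signz_even expr1z; ring.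
- by rewrite act_lin alt_lin; exact: lincomb0.
Qed.

Lemma alt_L m s (u : g2) :
  altsum s (act (BL m) u) = (4 * m - s)%:~R / 2 * altsum (s - 2 * m) u.
Proof.
pattern u; apply: malg_ind => [|[x y]|a v w Hv Hw].
- by rewrite act0 !alt0 mulr0.
- have [pxy|pxy] := boolP (tw_par x && tw_par y); last first.
    by rewrite altU0 // mulr0; exact: alt_act_even.
  case: x y pxy => [n|l|x|] [n'|j|y|] // _.
  rewrite act_L_GG_U alt_lin altZ 3!alt_GG.
  rewrite (_ : x + 2 * m + y = x + (y + 2 * m)); last by ring.
  rewrite (_ : (x + (y + 2 * m) == s) = (x + y == s - 2 * m)); last by lia.
  case: eqP => e; last by rewrite !mulr0 addr0.
  rewrite (_ : s = x + y + 2 * m); last by lia.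
  by rewrite signzD signz_even; field.
- by rewrite act_lin !alt_lin Hv Hw; ring.
Qed.

(** Modulo the image of T_(1/2), the index of a tensor of two G can be moved
    from one factor to the other at the price of a sign, until the first factor
    is G_0; the coordinates that result are the alternating sums. *)
Lemma alt_normal_form (u : g2) : exists2 v, hom2 false v & forall x y,
  (u - act (BT 0) v)@_(BG x, BG y) = if x == 0 then altsum y u else 0.
Proof.
pose P (u : g2) := exists2 v, hom2 false v & forall x y,
  (u - act (BT 0) v)@_(BG x, BG y) = if x == 0 then altsum y u else 0.
have PT w : hom2 false w -> P (act (BT 0) w).
  by move=> hw; exists w => // x y; rewrite subrr mcoeff0 alt_T if_same.
have PD a u1 u2 : P u1 -> P u2 -> P (a *: u1 + u2).
  move=> [v1 h1 E1] [v2 h2 E2]; exists (a *: v1 + v2); first exact: homogP.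
  move=> x y; have := E1 x y; have := E2 x y; rewrite act_lin alt_lin.
  coef_simpl => e2 e1; transitivity
    (a * (u1@_(BG x, BG y) - (act (BT 0) v1)@_(BG x, BG y))
     + (u2@_(BG x, BG y) - (act (BT 0) v2)@_(BG x, BG y))).
    by coef_generalize; ring.
  by rewrite e1 e2; case: eqP => _ //; rewrite mulr0 addr0.
have PB u1 u2 : P u1 -> P u2 -> P (u1 - u2).
  by move=> H1 H2; rewrite -scaleN1r addrC; exact: PD.
change (P u); pattern u; apply: malg_ind => [|[x y]|a u1 u2].
- by have := PT 0; rewrite act0; apply; exact: homog0.
- have [pxy|pxy] := boolP (tw_par x && tw_par y); last first.
    exists 0; first exact: homog0.
    move=> x' y'; rewrite act0 subr0 coefU altU0 // if_same.
    by case: eqP => // -[ex ey]; move: pxy; rewrite ex ey.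
  case: x y pxy => [n|l|x|] [m|j|y|] // _.
  have hGG a b : hom2 false (<< (BG a, BG b) >> : g2) by exact: homogU.
  have P0 b : P << (BG 0, BG b) >>.
    exists 0; first exact: homog0.
    move=> x' y'; rewrite act0 subr0 coefU alt_GG add0r expr0z xpair_eqE.
    case: (x' =P 0) => [->|nx]; last first.
      by rewrite (_ : BG 0 == BG x' = false) //; apply/eqP => -[e]; apply: nx.
    rewrite eqxx; case: (b =P y') => [->|ny]; first by rewrite eqxx.
    by rewrite (_ : BG b == BG y' = false) //; apply/eqP => -[e]; apply: ny.
  have up n b : P << (BG n%:Z, BG b) >>.
    elim: n b => [|n IH] b; first exact: P0.
    have := PB _ _ (PT _ (hGG n%:Z b)) (IH (b + 1)).
    rewrite act_even_GG_U mulr0 !add0r addrK.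
    by rewrite (_ : n%:Z + 1 = n.+1%:Z) //; lia.
  have down n b : P << (BG (- n%:Z), BG b) >>.
    elim: n b => [|n IH] b; first exact: P0.
    have := PB _ _ (PT _ (hGG (- n.+1%:Z) (b - 1))) (IH (b - 1)).
    rewrite act_even_GG_U mulr0 !add0r subrK.
    rewrite (_ : - n.+1%:Z + 1 = - n%:Z); last by lia.
    by rewrite [X in X - _]addrC addrK.
  by case: x => n; [exact: up | rewrite NegzE; exact: down].
- exact: PD.
Qed.

End AlternatingSum.

Local Opaque altsum.

Section EvenDerivationsGG.
Variable K : numFieldType.
Local Notation F := (Num.NumField.Exports.Num_NumField__to__GRing_Field K).
Local Notation g := {malg F[tw_basis]}.
Local Notation g2 := {malg F[(tw_basis * tw_basis)%type]}.
Local Notation B := (br (tw_phi F)).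
Local Notation ks := (ksign F).
Local Notation act := (act tw_par (tw_phi F)).
Local Notation hom2 := (homog (par2 tw_par tw_par)).

Definition GGfree (u : g2) : Prop := forall x y, u@_(BG x, BG y) = 0.

Lemma GGfree_lin a (u v : g2) : GGfree u -> GGfree v -> GGfree (a *: u + v).
Proof.
by move=> hu hv x y; coef_simpl; rewrite hu hv mulr0 addr0.
Qed.

Lemma GGfree0 : GGfree 0.
Proof. by move=> x y; rewrite mcoeff0. Qed.

Lemma GGfreeZ a (u : g2) : GGfree u -> GGfree (a *: u).
Proof. by move=> hu x y; rewrite mcoeffZ hu mulr0. Qed.

Lemma GGfreeD (u v : g2) : GGfree u -> GGfree v -> GGfree (u + v).
Proof. by move=> hu hv x y; rewrite mcoeffD hu hv addr0. Qed.

Lemma act_L_GG m (u : g2) x y : (act (BL m) u)@_(BG x, BG y) =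
  (m - (x - 2 * m))%:~R / 2 * u@_(BG (x - 2 * m), BG y) +
  (m - (y - 2 * m))%:~R / 2 * u@_(BG x, BG (y - 2 * m)).
Proof. by rewrite act_coef /= ksE mul1r !coef_LG sl1_coef sl2_coef. Qed.

Lemma act_c (u : g2) : act Bc u = 0.
Proof.
pattern u; apply: malg_ind => [|[x y]|a v w Hv Hw]; first exact: act0.
  by rewrite actU !br_cl tens0l tens0r scaler0 addr0.
by rewrite act_lin Hv Hw scaler0 addr0.
Qed.

Lemma GGfree_act_even x (u : g2) :
  tw_par x = false -> GGfree u -> GGfree (act x u).
Proof.
case: x => [m|k|a|] // _ hu y z.
- by rewrite act_L_GG !hu !mulr0 addr0.
- by rewrite act_T_GG !hu addr0.
- by rewrite act_c mcoeff0.
Qed.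

(** On G (x) G, T_(1/2) u = 0 makes the coordinates alternate in sign along the
    antidiagonals, which finite support forbids unless they are all 0. *)
Lemma GGfree_act_T (u : g2) : GGfree (act (BT 0) u) -> GGfree u.
Proof.
move=> hu; have [N HN] := support_bound u.
have rec x y : u@_(BG x, BG y) = - u@_(BG (x + 1), BG (y - 1)).
  have := hu (x + 1) y; rewrite act_T_GG.
  rewrite (_ : x + 1 - (2 * 0 + 1) = x); last by ring.
  rewrite (_ : y - (2 * 0 + 1) = y - 1); last by ring.
  by move/eqP; rewrite addr_eq0 => /eqP.
have van n : forall x y, (N < absz (x + n%:Z)%R)%N -> u@_(BG x, BG y) = 0.
  elim: n => [|n IH] x y hx.
    by apply: HN => /=; apply/orP; left; move: hx; rewrite addr0.
  rewrite rec IH ?oppr0 //; move: hx; congr (_ < absz _)%N; lia.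
move=> x y; apply: (van (N + absz x + 1)%N); lia.
Qed.

Section EvenGG.
Variable f : tw_basis -> g2.
Hypothesis df : der false f.

Lemma der_even x y : lin_ext f (B << x >> << y >>) =
  act x (f y) - ks (tw_par y) (tw_par x) *: act y (f x).
Proof. by rewrite df ksE scale1r. Qed.

(** Applying the relation between L_m and T_r with m and then with -m returns
    to the same alternating sum, with a factor that is a quadratic polynomial
    in m with leading coefficient 8.  Its second difference, 16, is not 0. *)
Lemma alt_f_T k s : altsum s (f (BT k)) = 0.
Proof.
have E m k' s' : - (k'%:~R + 2^-1) * altsum s' (f (BT (k' + m))) =
    (4 * m - s')%:~R / 2 * altsum (s' - 2 * m) (f (BT k')).
  have := der_even (BL m) (BT k'); rewrite br_LT linearZ /= lin_extU ksE scale1r.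
  move=> E; apply: etrans (esym (altZ _ _ _)) _; rewrite E.
  apply: etrans (altB _ _ _) _.
  exact: etrans (congr2 (fun a b => a - b) (alt_L _ _ _) (alt_T _ _ _)) (subr0 _).
have Q m : (4 * (k%:~R + 2^-1) * (k%:~R + 2^-1 + m%:~R)
    + (4 * m%:~R + s%:~R) * (2 * m%:~R - s%:~R)) * altsum s (f (BT k)) = 0.
  have := E m k (s + 2 * m); rewrite addrK => E1.
  have := E (- m) (k + m) s; rewrite addrK (_ : s - 2 * - m = s + 2 * m);
    last by ring.
  move=> E2.
  have -> : (4 * (k%:~R + 2^-1) * (k%:~R + 2^-1 + m%:~R)
      + (4 * m%:~R + s%:~R) * (2 * m%:~R - s%:~R)) * altsum s (f (BT k)) =
     - 4 * (k%:~R + 2^-1) *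
       (- ((k + m)%:~R + 2^-1) * altsum s (f (BT k)))
     + (4 * m%:~R + s%:~R) * 2 *
       ((4 * m - (s + 2 * m))%:~R / 2 * altsum s (f (BT k))) :> F.
    by move: (altsum s (f (BT k))) => z; field.
  by rewrite E2 -E1; move: (altsum _ _) => z; field.
have := Q 0; have := Q 1; have := Q (- 1).
move: (altsum s (f (BT k))) => z Q1 Q2 Q3.
have : 16 * z = 0.
  transitivity (
   (4 * (k%:~R + 2^-1) * (k%:~R + 2^-1 + (- 1)%:~R)
    + (4 * (- 1)%:~R + s%:~R) * (2 * (- 1)%:~R - s%:~R)) * z +
   (4 * (k%:~R + 2^-1) * (k%:~R + 2^-1 + 1%:~R)
    + (4 * 1%:~R + s%:~R) * (2 * 1%:~R - s%:~R)) * z - 2 *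
   ((4 * (k%:~R + 2^-1) * (k%:~R + 2^-1 + 0%:~R)
    + (4 * 0%:~R + s%:~R) * (2 * 0%:~R - s%:~R)) * z) : F).
    by field.
  by rewrite Q1 Q2 Q3 mulr0 subr0 addr0.
by move/eqP; rewrite mulf_eq0 pnatr_eq0 /= => /eqP.
Qed.

Lemma GG_primitive : exists2 v, hom2 false v & GGfree (f (BT 0) - act (BT 0) v).
Proof.
have [v hv Ev] := alt_normal_form (f (BT 0)); exists v => // x y.
by rewrite Ev alt_f_T if_same.
Qed.

Hypothesis fT : GGfree (f (BT 0)).

Lemma GGfree_even x : tw_par x = false -> GGfree (f x).
Proof.
(* T_(1/2) is injective on G (x) G, so it suffices to see that the bracket
   with it has no G (x) G component. *)
have main z : tw_par z = false ->
    GGfree (lin_ext f (B << BT 0 >> << z >>)) -> GGfree (f z).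
  move=> pz H; apply: GGfree_act_T.
  have := der_even (BT 0) z; rewrite pz /= ksE scale1r => E.
  rewrite (_ : act _ _ = lin_ext f (B << BT 0 >> << z >>) + act z (f (BT 0))).
    by apply: GGfreeD => //; exact: GGfree_act_even.
  by rewrite E subrK.
have fc : GGfree (f Bc).
  by apply: main => //; rewrite br_cr linear0; exact: GGfree0.
have fTk k : GGfree (f (BT k)).
  by apply: main => //; rewrite br_TT linearZ /= lin_extU; exact: GGfreeZ.
case: x => [m|k|a|] // _.
by apply: main => //; rewrite br_TL linearZ /= lin_extU; exact: GGfreeZ.
Qed.

Lemma GGfree_lin_ext (x : g) : homog tw_par false x -> GGfree (lin_ext f x).
Proof.
move=> hx; pattern x; apply: malg_ind_supp => [|i ix|a u v Hu Hv].
- by rewrite linear0; exact: GGfree0.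
- by rewrite lin_extU; apply: GGfree_even; exact: hx.
- by rewrite (lin_ext_is_linear f a u v); exact: GGfree_lin.
Qed.

End EvenGG.
End EvenDerivationsGG.

(** * Even superderivations: the non-central components of the values on G *)

Section EvenDerivationsG.
Variable K : numFieldType.
Local Notation F := (Num.NumField.Exports.Num_NumField__to__GRing_Field K).
Local Notation g := {malg F[tw_basis]}.
Local Notation g2 := {malg F[(tw_basis * tw_basis)%type]}.
Local Notation B := (br (tw_phi F)).
Local Notation ks := (ksign F).
Local Notation act := (act tw_par (tw_phi F)).
Local Notation hom2 := (homog (par2 tw_par tw_par)).
Local Notation kap := (kap K).

Lemma act_G_GG a (u : g2) x y : (act (BG a) u)@_(BG x, BG y) =
  kap a (y - a) * u@_(BG x, eb (y - a)) - kap a (x - a) * u@_(eb (x - a), BG y).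
Proof.
rewrite act_coef /= ksE; apply: etrans (_ : _ = _).
  apply: (congr2 (fun s t => s + -1 * t)); exact: coef_GG.
by rewrite /= sl1_coef sl2_coef mulN1r !mulNr opprK addrC.
Qed.

Section Relations.
Variable f : tw_basis -> g2.
Hypothesis df : der false f.
Hypothesis fGG : forall x, tw_par x = false -> GGfree (f x).

Lemma GGfree_bracket a b : GGfree (lin_ext f (B << BG a >> << BG b >>)).
Proof.
by apply: (GGfree_lin_ext df); [exact: fGG | exact: (@tw_br_par K (BG a) (BG b))].
Qed.

(** Coordinates of f (BG a) in relative indices: for f = [inn false v] with v in
    E (x) E they are multiples of the coordinate of v at (eb x, eb y). *)
Definition coefGE a x y : F := (f (BG a))@_(BG (x + a), eb y).
Definition coefEG a x y : F := (f (BG a))@_(eb x, BG (y + a)).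
Local Notation W := coefGE.
Local Notation U := coefEG.

(** The component in G (x) G of f([G_a, G_b]), which is 0 because [G_a, G_b] is
    even.  Indices are taken relative to a and b, as those of an element on
    which G_a and G_b would act. *)
Lemma G_relation a b x y :
  kap a y * W b x y + kap b (y + a - b) * W a (x + b - a) (y + a - b) =
  kap a (x + b - a) * U b (x + b - a) (y + a - b) + kap b x * U a x y.
Proof.
have := GGfree_bracket a b (x + b) (y + a); rewrite (der_even df) /= ksE.
rewrite mcoeffB mcoeffZ mulN1r opprK.
move=> E.
have {E} := etrans (esym (congr2 +%R (act_G_GG a _ _ _) (act_G_GG b _ _ _))) E.
rewrite !addrK /coefGE /coefEG !subrK.
coef_generalize => E; apply/eqP; rewrite -subr_eq0 -E; apply/eqP; ring.
Qed.

Lemma G_relation_diag a x y : kap a y * W a x y = kap a x * U a x y.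
Proof.
have := G_relation a a x y; rewrite !addrK => E.
apply: (mulfI (x := 2)); first by rewrite pnatr_eq0.
by rewrite 2!mulr_natl !mulr2n.
Qed.

Lemma coefGE_bound a : exists N, forall x y, (N < absz x)%N -> W a x y = 0.
Proof.
have [N HN] := support_bound (f (BG a)); exists (N + absz a)%N => x y hx.
by apply: HN; apply/orP; left => /=; lia.
Qed.

(** The form of [G_relation] once the coordinates U are expressed by W. *)
Lemma G_relation_solve (ka kb ka1 kb1 la lb1 wa wb wa1 wb1 : F) :
    ka != 0 -> kb != 0 -> ka1 != 0 -> kb1 != 0 ->
    la * wb + lb1 * wa1 = ka1 * (lb1 / kb1 * wb1) + kb * (la / ka * wa) ->
  la * kb * (wb / kb - wa / ka) = ka1 * lb1 * (wb1 / kb1 - wa1 / ka1).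
Proof.
move=> a0 b0 a1 b1 E; apply/eqP; rewrite -subr_eq0; apply/eqP.
transitivity ((la * wb + lb1 * wa1)
  - (ka1 * (lb1 / kb1 * wb1) + kb * (la / ka * wa))); last by rewrite E subrr.
by field; rewrite a0 b0 a1 b1.
Qed.

(** On a line x + y = const, stepping by b - a, the relation transports the
    difference of W b / kap b and W a / kap a; as supports are finite, the two
    quotients agree unless the line meets a zero of the structure constants. *)
Lemma coefGE_compare a b x y : a != b ->
    (forall t : int, x + t * (b - a) != 2 * a) ->
    (forall t : int, y + t * (b - a) != 2 * a) ->
  W a x y / kap a x = W b x y / kap b x.
Proof.
move=> ab hx hy.
pose xt (t : int) := x + t * (b - a); pose yt (t : int) := y - t * (b - a).
have nax t : kap a (xt t) != 0 by rewrite kap_eq0; exact: hx.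
have nbx t : kap b (xt t) != 0.
  rewrite kap_eq0; apply: contra (hx (t - 2)) => /eqP e; apply/eqP.
  by move: e; rewrite /xt => e; rewrite mulrBl addrA e; ring.
have nay t : kap a (yt t) != 0.
  by rewrite kap_eq0; move: (hy (- t)); rewrite mulNr.
have nby t : kap b (yt t) != 0.
  rewrite kap_eq0; apply: contra (hy (- t - 2)) => /eqP e; apply/eqP.
  by move: e; rewrite /yt => e; rewrite mulrBl mulNr addrA e; ring.
pose z t := W b (xt t) (yt t) / kap b (xt t) - W a (xt t) (yt t) / kap a (xt t).
have xtS t : xt t + b - a = xt (t + 1) by rewrite /xt; ring.
have ytS t : yt t + a - b = yt (t + 1) by rewrite /yt; ring.
have step t : z (t + 1) = 0 -> z t = 0.
  move=> z1; have := G_relation a b (xt t) (yt t); rewrite xtS ytS.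
  have Ub : U b (xt (t + 1)) (yt (t + 1)) =
      kap b (yt (t + 1)) / kap b (xt (t + 1)) * W b (xt (t + 1)) (yt (t + 1)).
    apply: (mulfI (nbx (t + 1))); rewrite -G_relation_diag.
    by field; exact: nbx.
  have Ua : U a (xt t) (yt t) = kap a (yt t) / kap a (xt t) * W a (xt t) (yt t).
    by apply: (mulfI (nax t)); rewrite -G_relation_diag; field; exact: nax.
  rewrite Ub Ua => {Ub Ua} E.
  have E2 : kap a (yt t) * kap b (xt t) * z t =
      kap a (xt (t + 1)) * kap b (yt (t + 1)) * z (t + 1).
    exact: (G_relation_solve (nax t) (nbx t) (nax (t + 1)) (nbx (t + 1)) E).
  move: E2; rewrite z1 mulr0 => /eqP; rewrite !mulf_eq0.
  by rewrite (negbTE (nay t)) (negbTE (nbx t)) /= => /eqP.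
have [M HM] := coefGE_bound a; have [N HN] := coefGE_bound b.
have zbig (n : nat) : (M + N + absz x < n)%N -> z n%:Z = 0.
  move=> hn; have big : (M + N < absz (xt n%:Z))%N.
    have : (n <= absz (n%:Z * (b - a))%R)%N.
      rewrite abszM /= leq_pmulr // absz_gt0 subr_eq0 eq_sym //.
    by rewrite /xt; lia.
  by rewrite /z HM ?HN ?mul0r ?subrr //; lia.
have z0 : z 0 = 0.
  have [n hn] : exists n : nat, z n%:Z = 0.
    by exists (M + N + absz x).+1; exact: zbig.
  by elim: n hn => // n IH hn; apply: IH; apply: step; rewrite addrC -intS.
move: z0; rewrite /z /xt /yt mul0r !addr0 => /eqP.
by rewrite subr_eq0 => /eqP.
Qed.

Lemma no_multiple (h z t : int) : z != 0 -> (absz z < absz h)%N -> z + t * h != 0.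
Proof.
move=> z0 zh; apply/eqP => e; have {e} e : z = - t * h by lia.
move: zh z0; rewrite e abszM; case: (t =P 0) => [->|]; first by rewrite oppr0 mul0r.
move=> t0 zh _; have : (absz h <= absz (- t) * absz h)%N.
  by rewrite leq_pmull //; lia.
by lia.
Qed.

(** An auxiliary index c far away from everything can be compared with both a
    and b. *)
Lemma coefGE_indep a b x y : 2 * a != x -> 2 * a != y -> 2 * b != x ->
  2 * b != y -> W a x y / kap a x = W b x y / kap b x.
Proof.
move=> ax ay bx by_.
pose c := a + 1 + `|x| + `|y| + 4 * `|a| + 4 * `|b|.
have cmp d : 2 * d != x -> 2 * d != y -> c - d > `|x| + `|y| + 2 * `|d| ->
    W d x y / kap d x = W c x y / kap c x.
  move=> dx dy hc; apply: coefGE_compare.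
  - by lia.
  - move=> t; have : x - 2 * d + t * (c - d) != 0 by apply: no_multiple; lia.
    by apply: contra => /eqP e; apply/eqP; lia.
  - move=> t; have : y - 2 * d + t * (c - d) != 0 by apply: no_multiple; lia.
    by apply: contra => /eqP e; apply/eqP; lia.
by rewrite !cmp // /c; lia.
Qed.

End Relations.
End EvenDerivationsG.

Section EvenDerivationsGE.
Variable K : numFieldType.
Local Notation F := (Num.NumField.Exports.Num_NumField__to__GRing_Field K).
Local Notation g := {malg F[tw_basis]}.
Local Notation g2 := {malg F[(tw_basis * tw_basis)%type]}.
Local Notation B := (br (tw_phi F)).
Local Notation ks := (ksign F).
Local Notation act := (act tw_par (tw_phi F)).
Local Notation hom2 := (homog (par2 tw_par tw_par)).
Local Notation kap := (kap K).

Section Vanishing.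
Variable f : tw_basis -> g2.
Hypothesis df : der false f.
Hypothesis fGG : forall x, tw_par x = false -> GGfree (f x).
Local Notation W := (coefGE f).
Local Notation U := (coefEG f).
Hypothesis W0 : forall a x y, 2 * a != x -> 2 * a != y -> W a x y = 0.

Lemma coefGE_offdiag a x y : y != 2 * a -> W a x y = 0.
Proof.
move=> ya; case: (eqVneq x (2 * a)) => [xa|xa]; last first.
  by apply: W0; rewrite eq_sym.
have := G_relation_diag df fGG a x y.
have -> : kap a x = 0 by apply/eqP; rewrite kap_eq0 xa.
rewrite mul0r => /eqP; rewrite mulf_eq0 kap_eq0 (negbTE ya) /=.
by move/eqP.
Qed.

Lemma coefEG_offdiag a x y : x != 2 * a -> U a x y = 0.
Proof.
move=> xa; have := G_relation_diag df fGG a x y.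
have -> : kap a y * W a x y = 0.
  case: (eqVneq y (2 * a)) => [ya|/coefGE_offdiag ->]; last by rewrite mulr0.
  by apply/eqP; rewrite mulf_eq0 kap_eq0 ya eqxx.
by move/esym/eqP; rewrite mulf_eq0 kap_eq0 (negbTE xa) /= => /eqP.
Qed.

(** In the relation between a and b, for most a only one term is left. *)
Lemma coefGE_eq0 b x y : W b x y = 0.
Proof.
case: (eqVneq y (2 * b)) => [->|]; last exact: coefGE_offdiag.
pose a := 1 + `|x| + 4 * `|b|.
have := G_relation df fGG a b x (2 * b).
rewrite (@coefGE_offdiag a (x + b - a)) ?mulr0 ?addr0; last by rewrite /a; lia.
rewrite (@coefEG_offdiag b) ?mulr0 ?add0r; last by rewrite /a; lia.
rewrite (@coefEG_offdiag a) ?mulr0; last by rewrite /a; lia.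
move=> /eqP; rewrite mulf_eq0 kap_eq0 => /orP[|/eqP //].
by rewrite /a; lia.
Qed.

Lemma coefEG_eq0 b x y : U b x y = 0.
Proof.
case: (eqVneq x (2 * b)) => [->|]; last exact: coefEG_offdiag.
pose a := 1 + 4 * `|b|.
have := G_relation df fGG a b (b + a) (y + b - a).
rewrite !coefGE_eq0 !mulr0 addr0.
rewrite (_ : b + a + b - a = 2 * b); last by ring.
rewrite (_ : y + b - a + a - b = y); last by ring.
rewrite (@coefEG_offdiag a) ?mulr0 ?addr0; last by rewrite /a; lia.
move=> /esym/eqP; rewrite mulf_eq0 kap_eq0 => /orP[|/eqP //].
by rewrite /a; lia.
Qed.

End Vanishing.

(** Three values of a are enough for one of them to avoid 2a = x and 2a = y,
    the zeros of the structure constants. *)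
Definition good_index (x y : int) : int :=
  if (x != 0) && (y != 0) then 0 else if (x != 2) && (y != 2) then 1 else 2.

Lemma good_indexP x y :
  2 * good_index x y != x /\ 2 * good_index x y != y.
Proof. by rewrite /good_index; case: ifP; [|case: ifP]; lia. Qed.

Definition eb_index (x : tw_basis) : option int :=
  match x with
  | BL n => Some (2 * n) | BT k => Some (2 * k + 1) | _ => None
  end.

Lemma eb_indexK k : eb_index (eb k) = Some k.
Proof. by have [n [-> | ->]] := parity_cases k; rewrite ?eb_even ?eb_odd. Qed.

(** The part of a primitive of f that is read off f (BG a): the coordinates
    (x, y) for which a is the chosen good index. *)
Definition pull (a : int) : g2 -> g2 := lin_ext (fun t =>
  match t.1, eb_index t.2 with
  | BG x, Some y =>
      (if good_index (x - a) y == a then - (kap a (x - a))^-1 else 0)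
        *: << (eb (x - a), eb y) >>
  | _, _ => 0
  end).

Lemma pull_lin a c (u v : g2) : pull a (c *: u + v) = c *: pull a u + pull a v.
Proof. exact: linearP. Qed.
Lemma pull0 a : pull a 0 = 0.
Proof. exact: linear0. Qed.
Lemma pullU a x y : pull a << (x, y) >> =
  match x, eb_index y with
  | BG x, Some y =>
      (if good_index (x - a) y == a then - (kap a (x - a))^-1 else 0)
        *: << (eb (x - a), eb y) >>
  | _, _ => 0
  end.
Proof. exact: lin_extU. Qed.
Local Opaque pull.

Definition EEonly (v : g2) : Prop :=
  forall i z, v@_(BG i, z) = 0 /\ v@_(z, BG i) = 0.

Lemma EEonly_lin c (u v : g2) : EEonly u -> EEonly v -> EEonly (c *: u + v).
Proof.
move=> hu hv i z; have [u1 u2] := hu i z; have [v1 v2] := hv i z.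
by split; coef_simpl; rewrite ?u1 ?u2 ?v1 ?v2 mulr0 addr0.
Qed.
Lemma EEonlyD (u v : g2) : EEonly u -> EEonly v -> EEonly (u + v).
Proof. by move=> hu hv; rewrite -[u]scale1r; exact: EEonly_lin. Qed.
Lemma EEonly0 : EEonly 0.
Proof. by move=> i z; rewrite !mcoeff0. Qed.

Lemma EEonlyU x y : tw_par x = false -> tw_par y = false ->
  EEonly << (x, y) >>.
Proof.
move=> px py i z; split; rewrite coefU xpair_eqE.
  by case: eqP px => // ->.
by rewrite andbC; case: eqP py => // ->.
Qed.

Lemma EEonly_homog (v : g2) : EEonly v -> hom2 false v.
Proof.
move=> hv [x y]; rewrite -mcoeff_neq0.
have H1 i z : v@_(BG i, z) = 0 by exact: (hv i z).1.
have H2 i z : v@_(z, BG i) = 0 by exact: (hv i z).2.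
by case: x => [n|k|a|]; case: y => [m|l|b|] //; rewrite ?H1 ?H2 eqxx.
Qed.

Lemma EEonly_GGfree (v : g2) : EEonly v -> GGfree v.
Proof. by move=> hv x y; exact: (hv x (BG y)).1. Qed.

Lemma pull_EE a (u : g2) : EEonly (pull a u).
Proof.
pattern u; apply: malg_ind => [|[x y]|c v w Hv Hw].
- by rewrite pull0; exact: EEonly0.
- rewrite pullU; case: x => [n|k|x|]; try exact: EEonly0.
  case: (eb_index y) => [k|]; last exact: EEonly0.
  rewrite -[_ *: _]addr0; apply: EEonly_lin; last exact: EEonly0.
  by apply: EEonlyU; rewrite par_eb.
- by rewrite pull_lin; exact: EEonly_lin.
Qed.

Lemma pull_coef a (u : g2) x y : (pull a u)@_(eb x, eb y) =
  (if good_index x y == a then - (kap a x)^-1 else 0) * u@_(BG (x + a), eb y).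
Proof.
pattern u; apply: malg_ind => [|[x' y']|c v w Hv Hw].
- by rewrite pull0 !mcoeff0 mulr0.
- rewrite pullU coefU xpair_eqE.
  case: x' => [n|k|x'|]; try by rewrite mcoeff0 mulr0.
  case: (twP y') => [l|b|]; last 2 first.
  + rewrite mcoeff0 (_ : (BG b == _) = false) ?andbF ?mulr0 //.
    by apply/eqP => e; have := par_eb y; rewrite -e.
  + rewrite mcoeff0 (_ : (Bc == _) = false) ?andbF ?mulr0 //.
    by apply/eqP => e; have := eb_indexK y; rewrite -e.
  rewrite eb_indexK mcoeffZ coefU xpair_eqE !(inj_eq eb_inj).
  case: (l =P y) => [->|_]; last by rewrite !andbF !mulr0.
  case: (x' - a =P x) => [<-|nx]; first by rewrite subrK !eqxx.
  rewrite (_ : (BG x' == _) = false) ?mulr0 //.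
  by apply/eqP => -[e]; apply: nx; rewrite e addrK.
- rewrite pull_lin; refine (etrans (coef_add (coef_scale c Hv) Hw) _).
  by rewrite mcoeffD mcoeffZ mulrDr mulrCA.
Qed.

Lemma sl2_eq0 i (v : g2) : (forall z, v@_(i, z) = 0) -> sl2 i v = 0.
Proof. by move=> H; apply/malgP => z; rewrite sl2_coef mcoeff0. Qed.
Lemma sl1_eq0 j (v : g2) : (forall z, v@_(z, j) = 0) -> sl1 j v = 0.
Proof. by move=> H; apply/malgP => z; rewrite sl1_coef mcoeff0. Qed.

Lemma act_G_EE1 a (v : g2) i z : EEonly v ->
  (act (BG a) v)@_(BG i, z) = - kap a (i - a) * v@_(eb (i - a), z).
Proof.
move=> hv; rewrite act_coef (sl2_eq0 (fun z => (hv i z).1)) br0r mcoeff0.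
by rewrite mulr0 addr0 coef_GG sl1_coef.
Qed.

Lemma act_G_EE2 a (v : g2) i z : EEonly v -> tw_par z = false ->
  (act (BG a) v)@_(z, BG i) = - kap a (i - a) * v@_(z, eb (i - a)).
Proof.
move=> hv pz; rewrite act_coef (sl1_eq0 (fun z => (hv i z).2)) br0r mcoeff0.
by rewrite pz ksE mul1r add0r coef_GG sl2_coef.
Qed.

(** Independence of the index ([coefGE_indep]) makes the primitive read off at
    0, 1, 2 valid for all a, up to coordinates at the zeros of the structure
    constants; these vanish by [G_relation] with a far away index. *)
Lemma GE_primitive (f : tw_basis -> g2) : der false f ->
    (forall x, tw_par x = false -> GGfree (f x)) ->
  exists2 v, EEonly v & forall a i k,
    (f (BG a) - act (BG a) v)@_(BG i, eb k) = 0 /\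
    (f (BG a) - act (BG a) v)@_(eb k, BG i) = 0.
Proof.
move=> df fGG.
pose v := pull 0 (f (BG 0)) + pull 1 (f (BG 1)) + pull 2 (f (BG 2)).
have hv : EEonly v by apply: EEonlyD; [apply: EEonlyD|]; exact: pull_EE.
have vE x y : v@_(eb x, eb y) =
    - (coefGE f (good_index x y) x y / kap (good_index x y) x).
  refine (etrans (coef_add (coef_add (pull_coef _ _ _ _) (pull_coef _ _ _ _))
    (pull_coef _ _ _ _)) _); rewrite /coefGE.
  have [-> | [-> | ->]] : good_index x y = 0 \/ good_index x y = 1 \/
      good_index x y = 2.
    by rewrite /good_index;
      case: ifP => _; [left | case: ifP => _; right; [left | right]].
  + by rewrite /= !mul0r !addr0 mulNr mulrC.
  + by rewrite /= !mul0r add0r addr0 mulNr mulrC.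
  + by rewrite /= !mul0r !add0r mulNr mulrC.
exists v => //.
pose f' x := f x - inn false v x.
have df' : der false f' by exact: der_sub.
have f'GG x : tw_par x = false -> GGfree (f' x).
  move=> px; rewrite /f' innE -scaleN1r addrC; apply: GGfree_lin; last exact: fGG.
  by apply: GGfree_act_even => //; exact: EEonly_GGfree.
have W0 a x y : 2 * a != x -> 2 * a != y -> coefGE f' a x y = 0.
  move=> ax ay; have [gx gy] := good_indexP x y.
  rewrite /coefGE /f' innE mcoeffB (act_G_EE1 _ _ _ hv) addrK vE.
  rewrite -(coefGE_indep df fGG ax ay gx gy) -/(coefGE f a x y).
  have : kap a x != 0 by rewrite kap_eq0 eq_sym.
  by move: (coefGE _ _ _ _) (kap a x) => s t t0; field.
move=> a i k; split.
  have := coefGE_eq0 df' f'GG W0 a (i - a) k.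
  by rewrite /coefGE /f' innE subrK.
have := coefEG_eq0 df' f'GG W0 a k (i - a).
by rewrite /coefEG /f' innE subrK.
Qed.

End EvenDerivationsGE.

Local Opaque pull.

(** * Even superderivations: the central components of the values on G *)

Section EvenDerivationsC.
Variable K : numFieldType.
Local Notation F := (Num.NumField.Exports.Num_NumField__to__GRing_Field K).
Local Notation g := {malg F[tw_basis]}.
Local Notation g2 := {malg F[(tw_basis * tw_basis)%type]}.
Local Notation B := (br (tw_phi F)).
Local Notation ks := (ksign F).
Local Notation act := (act tw_par (tw_phi F)).
Local Notation hom2 := (homog (par2 tw_par tw_par)).
Local Notation kap := (kap K).

Lemma coef_G_L0 a (y : g) :
  (B << BG a >> y)@_(BL 0) = 2 * (-1) ^ a * y@_(BG (- a)).
Proof.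
apply: br_coef => -[n|k|b|].
- by rewrite br_GL; coef_simpl; rewrite !mulr0.
- by rewrite br_GT; coef_simpl; rewrite oppr0 mulr0.
- have [n [e|e]] := parity_cases (a + b).
    rewrite (br_GG_even _ e); coef_simpl; rewrite !mulr0 addr0.
    rewrite mulrA (mulrC _ 2); congr (_ * _); apply: eq_bool.
    by split => /eqP => [[?]|[?]]; apply/eqP; [congr BG | congr BL]; lia.
  rewrite (br_GG_odd _ e); coef_simpl; rewrite mulr0.
  by rewrite (_ : BG b == BG (- a) = false) ?mulr0 //; apply/eqP => -[?]; lia.
- by rewrite br_cr; coef_simpl; rewrite mulr0.
Qed.

Lemma coef_G_c a (y : g) : exists c, (B << BG a >> y)@_Bc = c * y@_(BG (- a)).
Proof.
exists ((-1) ^ a * (3^-1 * ((a%:~R / 2) ^+ 2 - 4^-1))).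
apply: br_coef => -[n|k|b|].
- by rewrite br_GL; coef_simpl; rewrite !mulr0.
- by rewrite br_GT; coef_simpl; rewrite oppr0 mulr0.
- have [n [e|e]] := parity_cases (a + b).
    rewrite (br_GG_even _ e); coef_simpl; rewrite eqxx mulr1 mulr0 add0r.
    rewrite [LHS]mulrA; congr (_ * _); apply: eq_bool.
    by split => /eqP => [?|[?]]; apply/eqP; [congr BG|]; lia.
  rewrite (br_GG_odd _ e); coef_simpl; rewrite mulr0.
  by rewrite (_ : BG b == BG (- a) = false) ?mulr0 //; apply/eqP => -[?]; lia.
- by rewrite br_cr; coef_simpl; rewrite mulr0.
Qed.

Lemma act_G_Gc a (u : g2) i : GGfree u ->
  (act (BG a) u)@_(BG i, Bc) = - kap a (i - a) * u@_(eb (i - a), Bc).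
Proof.
move=> hu; rewrite act_coef; have [c ->] := coef_G_c a (sl2 (BG i) u).
by rewrite sl2_coef hu !mulr0 addr0 coef_GG sl1_coef.
Qed.

Lemma act_G_L0c a (u : g2) : (forall i, u@_(BL 0, BG i) = 0) ->
  (act (BG a) u)@_(BL 0, Bc) = 2 * (-1) ^ a * u@_(BG (- a), Bc).
Proof.
move=> hu; rewrite act_coef; have [c ->] := coef_G_c a (sl2 (BL 0) u).
by rewrite sl2_coef hu !mulr0 addr0 coef_G_L0 sl1_coef.
Qed.

Lemma act_L0_Gc (u : g2) i :
  (act (BL 0) u)@_(BG i, Bc) = - (i%:~R / 2) * u@_(BG i, Bc).
Proof.
rewrite act_coef coef_L0c mulr0 addr0 coef_LG sl1_coef.
rewrite (_ : i - 2 * 0 = i); last by ring.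
by rewrite sub0r intrN !mulNr.
Qed.

(** The part of a primitive of f that is read off f (BL 0): on a coordinate of
    nonzero degree L_0 acts by a nonzero scalar. *)
Definition cpull : g2 -> g2 := lin_ext (fun t =>
  match eb_index t.1, t.2 with
  | Some k, Bc => (if k == 0 then 0 else - (2 / k%:~R)) *: << (eb k, Bc) >>
  | _, _ => 0
  end).

Lemma cpull_lin c (u v : g2) : cpull (c *: u + v) = c *: cpull u + cpull v.
Proof. exact: linearP. Qed.
Lemma cpull0 : cpull 0 = 0.
Proof. exact: linear0. Qed.
Lemma cpullU x y : cpull << (x, y) >> =
  match eb_index x, y with
  | Some k, Bc => (if k == 0 then 0 else - (2 / k%:~R)) *: << (eb k, Bc) >>
  | _, _ => 0
  end.
Proof. exact: lin_extU. Qed.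
Local Opaque cpull.

(** Together with the first condition, the second leaves the tensors
    e_k (x) c and c (x) c. *)
Definition Econly (v : g2) : Prop :=
  EEonly v /\ forall z k, v@_(z, eb k) = 0.

Lemma Econly_lin c (u v : g2) : Econly u -> Econly v -> Econly (c *: u + v).
Proof.
move=> [hu ku] [hv kv]; split; first exact: EEonly_lin.
by move=> z k; coef_simpl; rewrite ku kv mulr0 addr0.
Qed.
Lemma Econly0 : Econly 0.
Proof. by split; [exact: EEonly0 | move=> z k; rewrite mcoeff0]. Qed.
Lemma EconlyU k : Econly << (eb k, Bc) >>.
Proof.
split; first by apply: EEonlyU; rewrite // par_eb.
move=> z l; rewrite coefU xpair_eqE (_ : (Bc == _) = false) ?andbF //.
by apply/eqP => e; have := eb_indexK l; rewrite -e.
Qed.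

Lemma cpull_Ec (u : g2) : Econly (cpull u).
Proof.
pattern u; apply: malg_ind => [|[x y]|c v w Hv Hw].
- by rewrite cpull0; exact: Econly0.
- rewrite cpullU; case: (eb_index x) => [k|]; last exact: Econly0.
  case: y => [n|l|a|]; try exact: Econly0.
  rewrite -[_ *: _]addr0; apply: Econly_lin; last exact: Econly0.
  exact: EconlyU.
- by rewrite cpull_lin; exact: Econly_lin.
Qed.

Lemma cpull_coef (u : g2) k : (cpull u)@_(eb k, Bc) =
  (if k == 0 then 0 else - (2 / k%:~R)) * u@_(eb k, Bc).
Proof.
pattern u; apply: malg_ind => [|[x y]|c v w Hv Hw].
- by rewrite cpull0 !mcoeff0 mulr0.
- rewrite cpullU coefU xpair_eqE; case: (twP x) => [l|b|]; last 2 first.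
  + rewrite mcoeff0 (_ : (BG b == _) = false) ?mulr0 //.
    by apply/eqP => e; have := par_eb k; rewrite -e.
  + rewrite mcoeff0 (_ : (Bc == _) = false) ?mulr0 //.
    by apply/eqP => e; have := eb_indexK k; rewrite -e.
  rewrite eb_indexK (inj_eq eb_inj).
  case: y => [n|j|a|]; try by rewrite mcoeff0 andbF mulr0.
  rewrite mcoeffZ coefU xpair_eqE (inj_eq eb_inj) eqxx andbT.
  by case: (l =P k) => [->|_]; rewrite ?mulr0.
- rewrite cpull_lin; refine (etrans (coef_add (coef_scale c Hv) Hw) _).
  by rewrite mcoeffD mcoeffZ mulrDr mulrCA.
Qed.

Lemma coef_scale_sub c (A P Q : g2) k :
  c *: A = P - Q -> c * A@_k = P@_k - Q@_k.
Proof. by move/(congr1 (mcoeff k)); rewrite mcoeffZ mcoeffB. Qed.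

Lemma coef_scale_add c (A P Q : g2) k :
  c *: A = P + Q -> c * A@_k = P@_k + Q@_k.
Proof. by move/(congr1 (mcoeff k)); rewrite mcoeffZ mcoeffD. Qed.

Section CentralPart.
Variable f : tw_basis -> g2.
Hypothesis df : der false f.
Hypothesis fGG : forall x, tw_par x = false -> GGfree (f x).
Hypothesis fGE : forall a i k, (f (BG a))@_(BG i, eb k) = 0.
Hypothesis fEG : forall a i k, (f (BG a))@_(eb k, BG i) = 0.

Local Notation X a i := ((f (BG a))@_(BG i, Bc)).

Lemma L0_relation a i :
  (i - a)%:~R / 2 * X a i = kap a (i - a) * (f (BL 0))@_(eb (i - a), Bc).
Proof.
have := der_even df (BL 0) (BG a); rewrite br_LG linearZ /= lin_extU mulr0 addr0.
rewrite ksE scale1r => /(coef_scale_sub (BG i, Bc)) E.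
have {E} := etrans E (congr2 (fun s t => s - t) (act_L0_Gc _ _)
  (act_G_Gc _ _ (fGG (erefl : tw_par (BL 0) = false)))).
move: (X a i) (mcoeff _ (f (BL 0))) (kap _ _) => x y k E.
apply/eqP; rewrite -subr_eq0; apply/eqP.
transitivity ((0%:~R / 2 - a%:~R / 2) * x - (- (i%:~R / 2) * x - - k * y)).
  by field.
by rewrite E subrr.
Qed.

Lemma T0_relation a : X (a + 1) (a + 1) = X a a + (f (BT 0))@_(eb 1, Bc).
Proof.
have := der_even df (BT 0) (BG a); rewrite br_TG lin_extU /= ksE scale1r.
rewrite -[LHS]scale1r => /(coef_scale_sub (BG (a + 1), Bc)); rewrite mul1r => E.
have {E} := etrans E (congr2 (fun s t => s - t) (act_T_Gc _ _ _)
  (act_G_Gc _ _ (fGG (erefl : tw_par (BT 0) = false)))).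
rewrite (_ : a + (2 * 0 + 1) = a + 1); last by ring.
rewrite (_ : a + 1 - (2 * 0 + 1) = a); last by ring.
rewrite (_ : a + 1 - a = 1); last by ring.
have -> : (f (BG a))@_(BG (a + 1), BT (- 0 - 1)) = 0.
  by rewrite -(fGE a (a + 1) (2 * (- 0 - 1) + 1)) eb_odd.
have -> : kap a 1 = 1 by rewrite -(kap_odd K a 0).
by rewrite mulr0 addr0 mulN1r opprK.
Qed.

(** Bracketing with T_(1/2) makes the coordinates of degree 0 an arithmetic
    progression in a, as those of a multiple of L_0 (x) c are. *)
Lemma diag_linear a : X a a = X 0 0 + a%:~R * (f (BT 0))@_(eb 1, Bc).
Proof.
have up n : X n%:Z n%:Z = X 0 0 + n%:Z%:~R * (f (BT 0))@_(eb 1, Bc).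
  elim: n => [|n IH]; first by rewrite mul0r addr0.
  have := T0_relation n%:Z; rewrite IH (_ : n%:Z + 1 = n.+1%:Z); last by lia.
  move=> ->.
  by rewrite (_ : n.+1%:Z = n%:Z + 1) ?intrD; [coef_generalize; ring | lia].
have down n : X (- n%:Z) (- n%:Z) =
    X 0 0 + (- n%:Z)%:~R * (f (BT 0))@_(eb 1, Bc).
  elim: n => [|n IH]; first by rewrite oppr0 mul0r addr0.
  have := T0_relation (- n.+1%:Z).
  rewrite (_ : - n.+1%:Z + 1 = - n%:Z); last by lia.
  rewrite IH => E; apply: (addIr ((f (BT 0))@_(eb 1, Bc))); rewrite -E.
  by rewrite (_ : - n.+1%:Z = - n%:Z - 1) ?intrB; [coef_generalize; ring | lia].
by case: a => n; [exact: up | rewrite NegzE; exact: down].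
Qed.

Lemma L0_diag_eq0 : (f (BL 0))@_(BL 0, Bc) = 0.
Proof.
have := L0_relation 1 1; rewrite subrr mul0r mul0r => /esym/eqP.
rewrite mulf_eq0 kap_eq0 /= => /eqP.
by rewrite -[BL 0]/(BL (0 : int)) -eb_even mulr0.
Qed.

(** The bracket of G_(1/2) and G_(-1/2) is -2 L_0 without a central term, and
    f (BL 0) vanishes at L_0 (x) c: so the values of the progression at 1 and
    -1 add up to 0, and its constant term vanishes. *)
Lemma diag0_eq0 : X 0 0 = 0.
Proof.
have := der_even df (BG 1) (BG (- 1)).
have -> : lin_ext f (B << BG 1 >> << BG (- 1) >>) = (-1 * 2) *: f (BL 0).
  rewrite (@br_GG_even K 1 (- 1) 0) // linearZ linearD !linearZ /= !lin_extU.
  rewrite (_ : 3^-1 * ((1%:~R / 2) ^+ 2 - 4^-1) * _ = 0 :> F); last by field.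
  by rewrite scale0r addr0 scalerA expr1z.
rewrite /= ksE scaleN1r opprK.
move=> /(coef_scale_add (BL 0, Bc)); rewrite L0_diag_eq0 mulr0 => E.
have f0 a i : (f (BG a))@_(BL 0, BG i) = 0.
  by rewrite -(fEG a i (2 * 0)) eb_even.
have {E} := etrans E (congr2 +%R (act_G_L0c _ (f0 _)) (act_G_L0c _ (f0 _))).
rewrite opprK (diag_linear 1) (diag_linear (- 1)) expr1z.
move: (X 0 0) ((f (BT 0))@_(eb 1, Bc)) => x t E.
have : 4 * x = 0.
  transitivity (- (2 * -1 * (x + (- 1)%:~R * t)
    + 2 * (-1) ^ (- 1) * (x + 1%:~R * t)) : F).
    by rewrite exprN1 invrN invr1; ring.
  by rewrite -E oppr0.
by move/eqP; rewrite mulf_eq0 pnatr_eq0 /= => /eqP.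
Qed.

(** In nonzero degree the primitive comes from f (BL 0), in degree 0 from the
    slope of the progression [diag_linear]. *)
Lemma c_primitive : exists2 v, Econly v &
  forall a i, (f (BG a) - act (BG a) v)@_(BG i, Bc) = 0.
Proof.
pose t := (f (BT 0))@_(eb 1, Bc).
(* eb 0 is L_0, and [G_p, L_0] = p G_p where p is half the integer index. *)
exists ((2 * t) *: << (eb 0, Bc) >> + cpull (f (BL 0))).
  by apply: Econly_lin; [exact: EconlyU | exact: cpull_Ec].
move=> a i; rewrite mcoeffB act_G_Gc; last first.
  apply: EEonly_GGfree; apply: EEonly_lin; last exact: (cpull_Ec _).1.
  exact: (EconlyU 0).1.
rewrite mcoeffD mcoeffZ cpull_coef coefU xpair_eqE (inj_eq eb_inj) eqxx andbT.
case: (0 =P i - a) => [e|ne].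
  rewrite -e eqxx mul0r addr0 mulr1 (_ : i = a); last by lia.
  rewrite diag_linear diag0_eq0 add0r (_ : kap a 0 = - a%:~R / 2); last first.
    by rewrite -(mulr0 2) kap_even sub0r.
  by rewrite -/t; field.
rewrite mulr0 add0r; case: eqP => [/esym//|_].
have k0 : (i - a)%:~R != 0 :> F by rewrite intr_eq0; apply/eqP => /esym.
have := L0_relation a i.
move: (X a i) ((f (BL 0))@_(eb (i - a), Bc)) (kap a (i - a)) k0.
move: (i - a)%:~R => k x d kp k0 E.
have -> : x = 2 / k * (kp * d) by rewrite -E; field.
by field.
Qed.

End CentralPart.
End EvenDerivationsC.

Local Opaque cpull.

(** * Even superderivations are inner *)

Section TwistLinExt.
Local Transparent twist.
Lemma twist_lin_ext (K : fieldType) (I J : choiceType) (p : I -> bool)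
    (f : J -> {malg K[(I * I)%type]}) x :
  twist p (lin_ext f x) = lin_ext (fun j => twist p (f j)) x.
Proof. exact: lin_ext_comp. Qed.
End TwistLinExt.

Lemma twist_sub_act (K : fieldType) (I : choiceType) (p : I -> bool)
    (phi : {linear {malg K[(I * I)%type]} -> {malg K[I]}})
    (gL : lie_superalgebra p phi) x y c (u v : {malg K[(I * I)%type]}) :
  twist p (act p phi x u - c *: act p phi y v) =
  act p phi x (twist p u) - c *: act p phi y (twist p v).
Proof.
rewrite twistB twistZ.
exact: (congr2 (fun s t => s - c *: t) (twist_act gL x u) (twist_act gL y v)).
Qed.



Section EvenInner.
Variable K : numFieldType.
Local Notation F := (Num.NumField.Exports.Num_NumField__to__GRing_Field K).
Local Notation g := {malg F[tw_basis]}.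
Local Notation g2 := {malg F[(tw_basis * tw_basis)%type]}.
Local Notation B := (br (tw_phi F)).
Local Notation ks := (ksign F).
Local Notation act := (act tw_par (tw_phi F)).
Local Notation hom2 := (homog (par2 tw_par tw_par)).
Local Notation twist := (twist tw_par).

(** The G_p generate the whole algebra. *)
Lemma even_zero (f : tw_basis -> g2) :
  der false f -> (forall a, f (BG a) = 0) -> forall x, f x = 0.
Proof.
move=> df fG0.
have E a b : lin_ext f (B << BG a >> << BG b >>) = 0.
  by rewrite (der_even df) !fG0 !act0 scaler0 subr0.
have fT k : f (BT k) = 0.
  have := E (2 * k + 1) 0; rewrite (@br_GG_odd K _ _ k) ?addr0 //.
  rewrite linearZ /= lin_extU; move/eqP; rewrite scaler_eq0 => /orP[|/eqP //].
  rewrite mulf_eq0 expfz_eq0 oppr_eq0 oner_eq0 andbF /= mul0r subr0.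
  by rewrite mulf_eq0 invr_eq0 pnatr_eq0 orbF intr_eq0; lia.
have fL0 : f (BL 0) = 0.
  have := E 1 (- 1); rewrite (@br_GG_even K 1 (- 1) 0) //.
  rewrite linearZ linearD !linearZ /= !lin_extU.
  rewrite (_ : 3^-1 * ((1%:~R / 2) ^+ 2 - 4^-1) * _ = 0 :> F); last by field.
  rewrite scale0r addr0 scalerA expr1z => /eqP; rewrite scaler_eq0.
  by rewrite mulf_eq0 oppr_eq0 oner_eq0 pnatr_eq0 /= => /eqP.
have fL n : f (BL n) = 0.
  case: (n =P 0) => [-> //|n0].
  have := E (2 * n) 0; rewrite (@br_GG_even K _ _ n) ?addr0 //.
  rewrite (_ : (2 * n == 0) = false); last by lia.
  rewrite mulr0 scale0r addr0 signz_even scale1r linearZ /= lin_extU => /eqP.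
  by rewrite scaler_eq0 pnatr_eq0 /= => /eqP.
have fc : f Bc = 0.
  have := E 0 0; rewrite (@br_GG_even K 0 0 0) //.
  rewrite linearZ linearD !linearZ /= !lin_extU.
  rewrite fL0 scaler0 add0r expr0z scale1r => /eqP; rewrite scaler_eq0.
  rewrite (_ : 3^-1 * ((0%:~R / 2) ^+ 2 - 4^-1) * _ = - 12^-1 :> F); last by field.
  by rewrite oppr_eq0 invr_eq0 pnatr_eq0 /= => /eqP.
by case.
Qed.

(** The super-twist is a module map; it exchanges G (x) c and c (x) G. *)
Lemma der_twist (f : tw_basis -> g2) :
  der false f -> der false (fun x => twist (f x)).
Proof.
move=> df x y.
have -> : lin_ext (fun x => twist (f x)) (B << x >> << y >>) =
    twist (lin_ext f (B << x >> << y >>)).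
  by rewrite twist_lin_ext.
rewrite (der_even df) ksE scale1r.
exact: (twist_sub_act (tw_lie_superalgebra K)).
Qed.

Lemma sub_GGfree (f : tw_basis -> g2) v :
    (forall x, tw_par x = false -> GGfree (f x)) -> GGfree v ->
  forall x, tw_par x = false -> GGfree (f x - inn false v x).
Proof.
move=> fGG hv x px; rewrite innE -scaleN1r addrC; apply: GGfree_lin.
  exact: GGfree_act_even.
exact: fGG.
Qed.

Lemma even_inner (f : tw_basis -> g2) :
    der false f -> (forall x, hom2 (tw_par x (+) false) (f x)) ->
  exists2 v, hom2 false v & forall x, f x = inn false v x.
Proof.
move=> df hf.
have [v1 h1 E1] := GG_primitive df.
pose f1 x := f x - inn false v1 x.
have df1 : der false f1 by exact: der_sub.
have fGG1 x : tw_par x = false -> GGfree (f1 x).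
  by apply: GGfree_even => //; rewrite /f1 innE.
have [v2 EE2 E2] := GE_primitive df1 fGG1.
pose f2 x := f1 x - inn false v2 x.
have df2 : der false f2 by exact: der_sub.
have fGG2 := sub_GGfree fGG1 (EEonly_GGfree EE2); rewrite -/f2 in fGG2.
have fGE2 a i k : (f2 (BG a))@_(BG i, eb k) = 0.
  by rewrite /f2 innE; exact: (E2 a i k).1.
have fEG2 a i k : (f2 (BG a))@_(eb k, BG i) = 0.
  by rewrite /f2 innE; exact: (E2 a i k).2.
have [v3 Ec3 E3] := c_primitive df2 fGG2 fGE2 fEG2.
pose f3 x := f2 x - inn false v3 x.
have df3 : der false f3 by exact: der_sub.
have fGG3 := sub_GGfree fGG2 (EEonly_GGfree Ec3.1); rewrite -/f3 in fGG3.
have Ec_GE v a i k : Econly v -> (act (BG a) v)@_(BG i, eb k) = 0.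
  by move=> [hv kv]; rewrite act_G_EE1 // kv mulr0.
have Ec_EG v a i k : Econly v -> (act (BG a) v)@_(eb k, BG i) = 0.
  by move=> [hv kv]; rewrite act_G_EE2 ?par_eb // kv mulr0.
have Ec_cG v a i : Econly v -> (act (BG a) v)@_(Bc, BG i) = 0.
  by move=> [hv kv]; rewrite act_G_EE2 // kv mulr0.
have fGE3 a i k : (f3 (BG a))@_(BG i, eb k) = 0.
  by rewrite /f3 innE mcoeffB Ec_GE // subr0.
have fEG3 a i k : (f3 (BG a))@_(eb k, BG i) = 0.
  by rewrite /f3 innE mcoeffB Ec_EG // subr0.
have fGc3 a i : (f3 (BG a))@_(BG i, Bc) = 0 by rewrite /f3 innE E3.
pose f4 x := twist (f3 x).
have df4 : der false f4 by exact: der_twist.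
have [v4 Ec4 E4] : exists2 v, Econly v &
    forall a i, (f4 (BG a) - act (BG a) v)@_(BG i, Bc) = 0.
  apply: (c_primitive df4).
  - by move=> x px i j; rewrite twist_coef (fGG3 _ px) mulr0.
  - by move=> a i k; rewrite twist_coef fEG3 mulr0.
  - by move=> a i k; rewrite twist_coef fGE3 mulr0.
pose f5 x := f3 x - inn false (twist v4) x.
have df5 : der false f5 by exact: der_sub.
have f5E a : f5 (BG a) = f3 (BG a) - twist (act (BG a) v4).
  by rewrite /f5 innE (twist_act (tw_lie_superalgebra K)).
have hv : hom2 false (v1 + v2 + v3 + twist v4).
  apply: homogD; first apply: homogD; first apply: homogD => //.
  - exact: EEonly_homog.
  - exact: (EEonly_homog Ec3.1).
  - by apply: homog_twist; exact: (EEonly_homog Ec4.1).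
have f5_total x : f5 x = f x - inn false (v1 + v2 + v3 + twist v4) x.
  by rewrite /f5 /f3 /f2 /f1 !innE !actD; malg_ring.
have hf5 a : hom2 true (f5 (BG a)).
  rewrite f5_total innE; apply: homogD; first exact: (hf (BG a)).
  apply: homogN; exact: (homog_act (tw_lie_superalgebra K) (i := BG a) hv).
have f5G a : f5 (BG a) = 0.
  apply/malgP => -[x y]; rewrite mcoeff0.
  case: (boolP (tw_par x (+) tw_par y)) => pxy; last first.
    by apply: (homog_coef (hf5 a)); rewrite /par2 /= (negbTE pxy).
  rewrite f5E mcoeffB twist_coef.
  case: (twP x) pxy => [k|i|]; case: (twP y) => [l|j|]; rewrite /= ?par_eb //= => _.
  - by rewrite fEG3 Ec_GE // mulr0 subr0.
  - by rewrite fGE3 Ec_EG // mulr0 subr0.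
  - by rewrite fGc3 Ec_cG // mulr0 subr0.
  - by have := E4 a j; rewrite mcoeffB /f4 twist_coef /= !ksE !mul1r.
exists (v1 + v2 + v3 + twist v4); first exact: hv.
by move=> x; apply/eqP; rewrite -subr_eq0 -f5_total; apply/eqP; exact: even_zero.
Qed.

End EvenInner.

(** * Invariants of the triple tensor product *)

Section TripleFibres.
Variables (K : fieldType) (I : choiceType).
Variable phi : {linear {malg K[(I * I)%type]} -> {malg K[I]}}.
Local Notation g := {malg K[I]}.
Local Notation g3 := {malg K[(I * (I * I))%type]}.
Local Notation B := (br phi).

(** The fibres of an element of the triple tensor product over basis vectors of
    two of the factors. *)
Definition fib1 j k : g3 -> g := lin_ext (fun t =>
  (if (t.2.1 == j) && (t.2.2 == k) then << t.1 >> else 0) : g).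
Definition fib2 i k : g3 -> g := lin_ext (fun t =>
  (if (t.1 == i) && (t.2.2 == k) then << t.2.1 >> else 0) : g).
Definition fib3 i j : g3 -> g := lin_ext (fun t =>
  (if (t.1 == i) && (t.2.1 == j) then << t.2.2 >> else 0) : g).

Lemma fib1_lin j k a (u v : g3) : fib1 j k (a *: u + v) =
  a *: fib1 j k u + fib1 j k v.
Proof. exact: (linearP (lin_ext _)). Qed.
Lemma fib2_lin i k a (u v : g3) : fib2 i k (a *: u + v) =
  a *: fib2 i k u + fib2 i k v.
Proof. exact: (linearP (lin_ext _)). Qed.
Lemma fib3_lin i j a (u v : g3) : fib3 i j (a *: u + v) =
  a *: fib3 i j u + fib3 i j v.
Proof. exact: (linearP (lin_ext _)). Qed.
Lemma fib10 j k : fib1 j k 0 = 0. Proof. exact: (linear0 (lin_ext _)). Qed.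
Lemma fib20 i k : fib2 i k 0 = 0. Proof. exact: (linear0 (lin_ext _)). Qed.
Lemma fib30 i j : fib3 i j 0 = 0. Proof. exact: (linear0 (lin_ext _)). Qed.
Lemma fib1U j k a b c : fib1 j k << (a, (b, c)) >> =
  if (b == j) && (c == k) then << a >> else 0.
Proof. exact: lin_extU. Qed.
Lemma fib2U i k a b c : fib2 i k << (a, (b, c)) >> =
  if (a == i) && (c == k) then << b >> else 0.
Proof. exact: lin_extU. Qed.
Lemma fib3U i j a b c : fib3 i j << (a, (b, c)) >> =
  if (a == i) && (b == j) then << c >> else 0.
Proof. exact: lin_extU. Qed.
Local Opaque fib1 fib2 fib3.

Lemma fib1_coef j k u i : (fib1 j k u)@_i = u@_(i, (j, k)).
Proof.
pattern u; apply: malg_ind => [|[a [b c]]|a v w Hv Hw].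
- by rewrite fib10 !mcoeff0.
- rewrite fib1U coefU !xpair_eqE andbC.
  by case: ifP => _; rewrite ?mcoeff0 ?coefU ?andbT ?andbF.
- by rewrite fib1_lin; coef_simpl; rewrite Hv Hw.
Qed.

Lemma fib2_coef i k u j : (fib2 i k u)@_j = u@_(i, (j, k)).
Proof.
pattern u; apply: malg_ind => [|[a [b c]]|a v w Hv Hw].
- by rewrite fib20 !mcoeff0.
- rewrite fib2U coefU !xpair_eqE andbCA.
  by case: ifP => _; rewrite ?mcoeff0 ?coefU ?andbT ?andbF.
- by rewrite fib2_lin; coef_simpl; rewrite Hv Hw.
Qed.

Lemma fib3_coef i j u k : (fib3 i j u)@_k = u@_(i, (j, k)).
Proof.
pattern u; apply: malg_ind => [|[a [b c]]|a v w Hv Hw].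
- by rewrite fib30 !mcoeff0.
- rewrite fib3U coefU !xpair_eqE andbA.
  by case: ifP => _; rewrite ?mcoeff0 ?coefU ?andbT ?andbF.
- by rewrite fib3_lin; coef_simpl; rewrite Hv Hw.
Qed.

Lemma act3_coef x u a b c : (act3 phi x u)@_(a, (b, c)) =
  (B << x >> (fib1 b c u))@_a + (B << x >> (fib2 a c u))@_b
  + (B << x >> (fib3 a b u))@_c.
Proof.
pattern u; apply: malg_ind => [|[a' [b' c']]|k v w Hv Hw].
- by rewrite act30 fib10 fib20 fib30 !br0r !mcoeff0 !addr0.
- rewrite act3U fib1U fib2U fib3U; coef_simpl.
  case: (a' =P a) => [->|_]; case: (b' =P b) => [->|_];
    case: (c' =P c) => [->|_];
    rewrite /= ?br0r; coef_simpl; coef_generalize; ring.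
- rewrite act3_lin fib1_lin fib2_lin fib3_lin 3!br_linr; coef_simpl.
  by rewrite Hv Hw; coef_generalize; ring.
Qed.

End TripleFibres.

Section Invariants.
Variable K : numFieldType.
Local Notation F := (Num.NumField.Exports.Num_NumField__to__GRing_Field K).
Local Notation g := {malg F[tw_basis]}.
Local Notation g3 := {malg F[(tw_basis * (tw_basis * tw_basis))%type]}.
Local Notation B := (br (tw_phi F)).

Lemma coef_LL m (y : g) n :
  (B << BL m >> y)@_(BL n) = (m - (n - m))%:~R * y@_(BL (n - m)).
Proof.
apply: br_coef => -[l|k|a|]; rewrite ?br_LT ?br_LG ?br_cr;
  try by coef_simpl; rewrite !mulr0.
rewrite br_LL; coef_simpl; rewrite mulr0 addr0.
case: (boolP (l == n - m)) => [/eqP ->|ne].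
  by rewrite eqxx (_ : m + (n - m) = n) ?eqxx //; ring.
rewrite (_ : (BL l == _) = false); last by apply/eqP => -[e]; case/eqP: ne.
rewrite (_ : (BL _ == _) = false) ?mulr0 //.
by apply/eqP => -[e]; case/eqP: ne; lia.
Qed.

Lemma coef_LT m (y : g) l : (B << BL m >> y)@_(BT l) =
  - ((l - m)%:~R + 2^-1) * y@_(BT (l - m)).
Proof.
apply: br_coef => -[n|k|a|]; rewrite ?br_LL ?br_LG ?br_cr;
  try by coef_simpl; rewrite !(mulr0, addr0).
rewrite br_LT; coef_simpl.
case: (boolP (k == l - m)) => [/eqP ->|ne].
  by rewrite eqxx (_ : l - m + m = l) ?eqxx //; ring.
rewrite (_ : (BT k == _) = false); last by apply/eqP => -[e]; case/eqP: ne.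
rewrite (_ : (BT _ == _) = false) ?mulr0 //.
by apply/eqP => -[e]; case/eqP: ne; lia.
Qed.

(** For m large, L_m carries the coordinate at a given non-central basis
    element injectively to a coordinate arbitrarily far out. *)
Lemma L_shift x N : x != Bc -> exists m y (c : F),
  [/\ c != 0, (N < tw_size y)%N & forall w : g, (B << BL m >> w)@_y = c * w@_x].
Proof.
case: x => [n|k|a|] // _.
- have [m hm] : exists m : int, m = (N + absz (2 * n)).+1%:Z by eexists.
  exists m, (BL (n + m)), (m - n)%:~R; split.
  + by rewrite intr_eq0; lia.
  + by rewrite /=; lia.
  + by move=> w; rewrite coef_LL addrK.
- have [m hm] : exists m : int, m = (N + absz (2 * k + 1)).+1%:Z by eexists.
  exists m, (BT (k + m)), (- (k%:~R + 2^-1)); split.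
  + rewrite oppr_eq0 (_ : k%:~R + 2^-1 = (2 * k + 1)%:~R / 2).
      by rewrite mulf_neq0 ?invr_eq0 ?pnatr_eq0 // intr_eq0; lia.
    by rewrite intrD intrM; field.
  + by rewrite /=; lia.
  + by move=> w; rewrite coef_LT addrK.
- have [m hm] : exists m : int, m = (N + absz a).+1%:Z by eexists.
  exists m, (BG (a + 2 * m)), ((m - a)%:~R / 2); split.
  + by rewrite mulf_neq0 ?invr_eq0 ?pnatr_eq0 // intr_eq0; lia.
  + by rewrite /=; lia.
  + by move=> w; rewrite coef_LG addrK.
Qed.

Lemma support_bound3 (u : g3) : exists N, forall x y z,
  [|| (N < tw_size x)%N, (N < tw_size y)%N | (N < tw_size z)%N] ->
  u@_(x, (y, z)) = 0.
Proof.
pattern u; apply: malg_ind => [|[x [y z]]|a v w [M HM] [N HN]].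
- by exists 0%N => x y z _; rewrite mcoeff0.
- exists (maxn (tw_size x) (maxn (tw_size y) (tw_size z))) => x' y' z' H.
  rewrite coefU; case: eqP => // -[ex ey ez]; move: H.
  by rewrite -ex -ey -ez !gtn_max !ltnn /= !andbF.
- exists (maxn M N) => x y z; rewrite !gtn_max => H; coef_simpl.
  by rewrite HM ?HN ?mulr0 ?addr0 //;
    case/or3P: H => /andP[H1 H2]; rewrite ?H1 ?H2 ?orbT.
Qed.

(** If a coordinate of u has a non-central entry in some factor, let L_m move
    that entry beyond the support of u: the resulting coordinate of L_m . u
    comes from this factor alone, and is a nonzero multiple of the given one. *)
Lemma L_invariants (u : g3) : (forall m, act3 (tw_phi F) (BL m) u = 0) ->
  u@_(Bc, (Bc, Bc)) = 0 -> u = 0.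
Proof.
move=> u0 uc; have [N HN] := support_bound3 u.
have E m x y z : (B << BL m >> (fib1 y z u))@_x
    + (B << BL m >> (fib2 x z u))@_y + (B << BL m >> (fib3 x y u))@_z = 0.
  by rewrite -act3_coef u0 mcoeff0.
have fib1_0 y z : (N < tw_size y)%N || (N < tw_size z)%N -> fib1 y z u = 0.
  by move=> h; apply/malgP => x; rewrite fib1_coef mcoeff0 HN // h orbT.
have fib2_0 x z : (N < tw_size x)%N || (N < tw_size z)%N -> fib2 x z u = 0.
  move=> h; apply/malgP => y; rewrite fib2_coef mcoeff0 HN //.
  by case/orP: h => ->; rewrite ?orbT.
have fib3_0 x y : (N < tw_size x)%N || (N < tw_size y)%N -> fib3 x y u = 0.
  move=> h; apply/malgP => z; rewrite fib3_coef mcoeff0 HN //.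
  by case/orP: h => ->; rewrite ?orbT.
apply/malgP => -[x [y z]]; rewrite mcoeff0.
have [xc|/(L_shift N)[m [x' [k [k0 Nx H]]]]] := eqVneq x Bc; last first.
  have := E m x' y z; rewrite H fib1_coef (fib2_0 x' z) ?(fib3_0 x' y) ?Nx //.
  by rewrite br0r !mcoeff0 !addr0 => /eqP; rewrite mulf_eq0 (negbTE k0) => /eqP.
have [yc|/(L_shift N)[m [y' [k [k0 Ny H]]]]] := eqVneq y Bc; last first.
  have := E m x y' z; rewrite H fib2_coef (fib1_0 y' z) ?(fib3_0 x y') ?Ny ?orbT //.
  rewrite br0r !mcoeff0 addr0 add0r => /eqP.
  by rewrite mulf_eq0 (negbTE k0) => /eqP.
have [zc|/(L_shift N)[m [z' [k [k0 Nz H]]]]] := eqVneq z Bc; last first.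
  have := E m x y z'; rewrite H fib3_coef (fib1_0 y z') ?(fib2_0 x z') ?Nz ?orbT //.
  rewrite br0r !mcoeff0 !add0r => /eqP.
  by rewrite mulf_eq0 (negbTE k0) => /eqP.
by rewrite xc yc zc.
Qed.

End Invariants.

(** * First cohomology and Lie super-bialgebra structures *)

Section MainResult.
Variable K : numFieldType.
Local Notation F := (Num.NumField.Exports.Num_NumField__to__GRing_Field K).
Local Notation g := {malg F[tw_basis]}.
Local Notation g2 := {malg F[(tw_basis * tw_basis)%type]}.
Local Notation g3 := {malg F[(tw_basis * (tw_basis * tw_basis))%type]}.
Local Notation B := (br (tw_phi F)).
Local Notation ks := (ksign F).
Local Notation act := (act tw_par (tw_phi F)).
Local Notation hom2 := (homog (par2 tw_par tw_par)).
Local Notation adiag := (adiag tw_par (tw_phi F)).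
Local Notation inner e v := (inner tw_par adiag e v).

Lemma lin_ext_basis (d : {linear g -> g2}) z :
  lin_ext (fun k => d << k >>) z = d z.
Proof. by rewrite -[in RHS](lin_ext_id z) lin_ext_comp. Qed.

Lemma inner_ext (d : {linear g -> g2}) e v :
    (forall k, d << k >> = inn e v k) -> forall z, d z = inner e v z.
Proof.
move=> H z; rewrite -lin_ext_basis; apply: eq_lin_ext => k _.
by rewrite H adiagU.
Qed.

Lemma superder_der e (d : {linear g -> g2}) :
    (forall i j x y, homog tw_par i x -> homog tw_par j y ->
       d (tw_phi F (x ⊗ y)) = ks e i *: adiag x (d y)
         - ks j (e (+) i) *: adiag y (d x)) ->
  der e (fun k => d << k >>).
Proof.
move=> dH x y; rewrite lin_ext_basis.
refine (etrans (dH (tw_par x) (tw_par y) << x >> << y >> _ _) _).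
- exact: homogU.
- exact: homogU.
- by rewrite 2!adiagU.
Qed.

Lemma superderivation_inner :
  H1_eq0 tw_par (par2 tw_par tw_par) (tw_phi F) adiag.
Proof.
move=> d [d0 [d1 [[p0 e0] [p1 e1] dE]]].
have [v0 hv0 E0] := even_inner (superder_der e0)
  (fun k => p0 _ _ (homogU (erefl (tw_par k)))).
have [v1 hv1 E1] := odd_inner (superder_der e1)
  (fun k => p1 _ _ (homogU (erefl (tw_par k)))).
exists v0, v1; split => // x.
by rewrite dE (inner_ext E0) (inner_ext E1).
Qed.

(** Delta is an even superderivation, so Delta(x) = x . r0; since the values of
    Delta are skew, r0 can be replaced by its skew part r. *)
Lemma bialgebra_triangular (Delta : {linear g -> g2}) :
  lie_superbialgebra tw_par (tw_phi F) Delta ->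
  coboundary_triangular tw_par (tw_phi F) Delta.
Proof.
case=> gL [Dpar Dskew Djac] Dcomp.
have dD : der false (fun k => Delta << k >>).
  apply: superder_der => i j x y hx hy.
  have E (u v : g2) :
      u - ks i j *: v = ks false i *: u - ks j (false (+) i) *: v.
    by rewrite ksE scale1r (ksign_sym _ j).
  exact: (etrans (Dcomp i j x y hx hy) (E _ _)).
have hD k : hom2 (tw_par k (+) false) (Delta << k >>).
  by rewrite addbF; apply: Dpar; exact: homogU.
have [r0 hr0 DE] := even_inner dD hD.
pose s : g2 := 2^-1 *: r0.
have two : 2 != 0 :> F by rewrite pnatr_eq0.
pose r : g2 := s - twist tw_par s.
have hr : hom2 false r.
  apply: homogD; first exact: homogZ.
  by apply: homogN; apply: homog_twist; exact: homogZ.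
have skew_r : twist tw_par r = - r by rewrite twistB twistK opprB.
have Dr k : Delta << k >> = act k r.
  have tD : twist tw_par (Delta << k >>) = - Delta << k >>.
    by have [w ->] := Dskew << k >>; rewrite twistB twistK opprB.
  have Ds : Delta << k >> = act k r0 by rewrite DE innE.
  rewrite /r /s twistZ -scalerBr actZ actB -(twist_act gL) -Ds tD opprK.
  by rewrite -mulr2n -scaler_nat scalerA mulVf // scale1r.
exists false, r; split; first split => //.
- by exists s.
- by apply: inner_ext => k; rewrite innE.
- apply: L_invariants => [m|]; last exact: (cybe_coef gL).
  by rewrite -(cojacobi_cybe gL hr skew_r (erefl (tw_par (BL m))) Dr); exact: Djac.
Qed.

End MainResult.

Theorem corollary1p4 (R : realType) :
  H1_eq0 tw_par (par2 tw_par tw_par) (tw_phi R[i])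
    (adiag tw_par (tw_phi R[i])) /\
  (forall Delta :
     {linear {malg R[i][tw_basis]} -> {malg R[i][(tw_basis * tw_basis)%type]}},
   lie_superbialgebra tw_par (tw_phi R[i]) Delta ->
   coboundary_triangular tw_par (tw_phi R[i]) Delta).
Proof.
split; first exact: (@superderivation_inner R[i]).
exact: (@bialgebra_triangular R[i]).
Qed.
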